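(* Let $X$ be a real Banach space with a normalised $1$-unconditional basis $(e_\gamma)_{\gamma\in\Gamma}$ (where $\Gamma$ is an arbitrary, possibly uncountable, set), and let $\|\cdot\|$ denote the dual norm on $X^*$, with closed unit ball $B_{X^*}$. Let $\mathscr{A}$ be the family of all subsets $A\subseteq\Gamma$ for which there is a bounded linear functional $\mathbf{1}_A\in X^*$ with $\mathbf{1}_A(e_\gamma)=1$ for $\gamma\in A$ and $\mathbf{1}_A(e_\gamma)=0$ for $\gamma\in\Gamma\setminus A$. Let $K_{\mathscr{A}}=\{\chi_A : A\in\mathscr{A}\}\subseteq\{0,1\}^\Gamma$, where $\chi_A$ is the indicator function of $A$. Then the following are equivalent. (1) $(B_{X^*},w^* )$ is a Gruenhage compact space; (2) $X$ admits an equivalent norm with a strictly convex dual norm; (3) there exists a strictly increasing, $\tau_p$-lower semicontinuous map $\rho:K_{\mathscr{A}}\to[0,1]$; (4) $(B_{X^*},w^* )$ is a descriptive compact space; (5) $X$ admits an equivalent norm with a $w^*$-LUR dual norm.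
   Context: Basis: $(e_\gamma)_{\gamma\in\Gamma}$ is an unconditional basis of $X$ if every $x\in X$ has a unique expansion $x=\sum_{\gamma\in\Gamma}x_\gamma e_\gamma$ converging unconditionally; it is normalised if $\|e_\gamma\|=1$ for all $\gamma$; it is $1$-unconditional if $\|\sum_\gamma a_\gamma e_\gamma\|\le\|\sum_\gamma b_\gamma e_\gamma\|$ whenever both sums are in $X$ and $|a_\gamma|\le|b_\gamma|$ for all $\gamma$. $\tau_p$ is the pointwise (product) topology on $\mathbb{R}^\Gamma$, restricted to $K_{\mathscr{A}}$. The order on $\mathbb{R}^\Gamma$ is pointwise, and $y<x$ means $y\le x$ and $y\ne x$. A map $\rho$ is strictly increasing if $\rho(y)<\rho(x)$ whenever $y<x$; on $K_{\mathscr{A}}$ this means $\rho(\chi_B)<\rho(\chi_A)$ whenever $B\subsetneq A$. A norm $\|\cdot\|$ is strictly convex if $x=y$ whenever $\|x\|=\|y\|=\frac12\|x+y\|$. A norm on a dual space $X^*$ is $w^*$-LUR if, given $x$ and $x_n$ ($n\in\mathbb{N}$) in $X^*$ with $\|x\|=\|x_n\|=1$ and $\|x+x_n\|\to2$, we have $x_n\to x$ in the $w^*$-topology. Let $(Z,\tau)$ be a regular topological space. $Z$ is a Gruenhage space if there exist families $(\mathscr{U}_n)_{n\in\mathbb{N}}$ of open sets such that, given distinct $x,y\in Z$, there exist $n\in\mathbb{N}$ and $U\in\mathscr{U}_n$ such that $U\cap\{x,y\}$ is a singleton, and either $x$ lies in only finitely many $U'\in\mathscr{U}_n$ or $y$ lies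 in only finitely many $U'\in\mathscr{U}_n$. A family $\mathscr{N}$ of subsets of $Z$ is a network for $Z$ if, given $x\in U\in\tau$, there is $N\in\mathscr{N}$ with $x\in N\subseteq U$. A family $\mathscr{F}$ of subsets of $Z$ is isolated if $E\cap\overline{\bigcup(\mathscr{F}\setminus\{E\})}=\varnothing$ for every $E\in\mathscr{F}$. A network is $\sigma$-isolated if it can be written as $\bigcup_{n=1}^\infty\mathscr{N}_n$ with each $\mathscr{N}_n$ isolated. $Z$ is descriptive if it is compact and admits a $\sigma$-isolated network. *)

(* Defs.v *)
From HB Require Import structures.
From mathcomp Require Import all_boot all_order all_algebra.
From mathcomp Require Import all_classical all_reals all_analysis.
From mathcomp Require analysis.showcase.summability.

Set Implicit Arguments.
Unset Strict Implicit.
Unset Printing Implicit Defensive.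

Import Order.TTheory GRing.Theory Num.Theory.
Import numFieldNormedType.Exports.

Local Open Scope classical_set_scope.
Local Open Scope ring_scope.

Section Bases.
Context {R : realType} {X : normedModType R} {I : choiceType}.
Implicit Types (e : I -> X) (a b : I -> R) (x y : X).

(* Unconditional convergence of the sum of the a i *: e i to x, as convergence
   of the net of partial sums over the finite subsets of I. *)
Definition expansion e a x :=
  summability.partial_sum (fun i => a i *: e i) @ summability.totally --> x.

Definition unconditional_basis e := forall x, exists! a, expansion e a x.

Definition normalised e := forall i, `|e i| = 1.

Definition one_unconditional e := forall a b x y,
  expansion e a x -> expansion e b y ->
  (forall i, `|a i| <= `|b i|) -> `|x| <= `|y|.

End Bases.

Section Dual.
Context {R : realType}.

Definition bounded_functional (X : normedModType R) : {pred X -> R^o} :=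
  mem [set f : X -> R^o | linear f /\ continuous f].

Lemma bounded_functional_submod (X : normedModType R) :
  submod_closed (@bounded_functional X).
Proof.
split.
  apply/mem_set; split=> [a x y|x]; last exact: cvg_cst.
  by rewrite /= scaler0 addr0.
move=> a f g /set_mem[lf cf] /set_mem[lg cg]; apply/mem_set; split=> [b x y|x].
  rewrite -[LHS]/(a *: f (b *: x + y) + g (b *: x + y)).
  rewrite -[RHS]/(b *: (a *: f x + g x) + (a *: f y + g y)).
  by rewrite lf lg !scalerDr addrACA !scalerA mulrC.
apply: (@cvgD _ _ _ _ _ (a \*: f) g); last exact: cg.
by apply: cvgZl_tmp; exact: cf.
Qed.

HB.instance Definition _ (X : normedModType R) :=
  GRing.isSubmodClosed.Build R (X -> R^o) (@bounded_functional X)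
    (@bounded_functional_submod X).

(* The canonical topology of dual X is the w*-topology, not the norm topology;
   the dual norm is the separate function dual_norm below. *)
Definition dual (X : normedModType R) : Type :=
  {f : X -> R^o | f \in @bounded_functional X}.

HB.instance Definition _ (X : normedModType R) := SubChoice.on (dual X).
HB.instance Definition _ (X : normedModType R) :=
  [SubChoice_isSubLmodule of dual X by <:].
HB.instance Definition _ (X : normedModType R) :=
  Topological.copy (dual X)
    (initial_topology (fun f : dual X => val f : {ptws X -> R})).

Definition dual_fun (X : normedModType R) (f : dual X) : X -> R := val f.

End Dual.

Coercion dual_fun : dual >-> Funclass.

Section Norms.
Context {R : realType}.

Definition is_norm (V : lmodType R) (N : V -> R) :=
  [/\ forall x, N x = 0 -> x = 0,
      forall a x, N (a *: x) = `|a| * N x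
    & forall x y, N (x + y) <= N x + N y].

Definition equivalent_norm (X : normedModType R) (N : X -> R) :=
  is_norm N /\
  exists c C : R, [/\ 0 < c, 0 < C & forall x, c * `|x| <= N x <= C * `|x|].

(* The norm on the dual induced by the norm N; the supremum is the usual one
   only for N equivalent to the given norm, as sup is 0 on unbounded sets. *)
Definition dual_norm (X : normedModType R) (N : X -> R) (f : dual X) : R :=
  sup [set `|f x| | x in [set x : X | N x <= 1]].

Definition dual_ball (X : normedModType R) : set (dual X) :=
  [set f | dual_norm (fun x => `|x|) f <= 1].

Definition strictly_convex (V : lmodType R) (N : V -> R) :=
  forall x y, N x = N y -> N y = 2^-1 * N (x + y) -> x = y.

Definition wstar_LUR (X : normedModType R) (N : dual X -> R) :=
  forall (f : dual X) (fs : nat -> dual X),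
    N f = 1 -> (forall n, N (fs n) = 1) ->
    N (f + fs n) @[n --> \oo] --> (2 : R) ->
    fs @ \oo --> f.

End Norms.

Section Topology.
Context (T : topologicalType).

Definition gruenhage_space :=
  regular_space T /\
  exists U : nat -> set (set T),
    (forall n V, U n V -> open V) /\
    forall x y : T, x <> y -> exists n, exists2 V, U n V &
      (exists z, V `&` [set x; y] = [set z]) /\
      (finite_set [set W | U n W /\ W x] \/
       finite_set [set W | U n W /\ W y]).

Definition network (N : set (set T)) :=
  forall (x : T) (V : set T), open V -> V x ->
    exists2 M, N M & M x /\ M `<=` V.

Definition isolated_family (F : set (set T)) :=
  forall E, F E -> E `&` closure (\bigcup_(M in F `\ E) M) = set0.

Definition sigma_isolated (N : set (set T)) :=
  exists F : nat -> set (set T),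
    (forall n, isolated_family (F n)) /\ N = \bigcup_n F n.

Definition gruenhage_compact := compact [set: T] /\ gruenhage_space.

Definition descriptive :=
  [/\ regular_space T, compact [set: T]
    & exists N, network N /\ sigma_isolated N].

End Topology.

Section Supports.
Context {R : realType} {X : normedModType R} {I : choiceType}.

Definition functional_sets (e : I -> X) : set (set I) :=
  [set A | exists f : dual X,
    (forall i, A i -> f (e i) = 1) /\ (forall i, ~ A i -> f (e i) = 0)].

Definition indicator_space (e : I -> X) : set {ptws I -> R} :=
  [set \1_A | A in functional_sets e].

Definition pointwise_lt (y x : I -> R) := (forall i, y i <= x i) /\ y <> x.

Definition strictly_increasing (K : set {ptws I -> R}) (rho : K -> R) :=
  forall y x : K, pointwise_lt (set_val y) (set_val x) -> rho y < rho x.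

End Supports.

(* Main.v *)
(* (2) => (3): by strict convexity, averaging the square G of the dual norm over
   the signs +-1 on a finite set of coordinates strictly increases, in the
   supremum over the finite subsets of A, with A.  For the strictness at a
   coordinate i, a Baire type argument yields a finite sign pattern over all of
   whose finite extensions the gain from the additional coordinate i is bounded
   below.  The map is then encoded by countably many families F_n of finite sets
   such that, for i in A, some F_n has members included in A, all containing i.

   (3) => (4): if f lies in the dual ball, the intersection of all the members
   of F_n included in {i : |f (e i)| > r} is a finite set D.  As f varies with
   the cardinality of D fixed, the sets of functionals sharing the same D form
   an isolated family; refining by the approximate values of f on D and taking
   finite intersections over n and r gives a network.

   (1) => (2) and (4) => (5): open sets G_i and disjoint families (V_i j)_j,
   relatively open outside G_i, are extracted from the Gruenhage or
   sigma-isolated families.  A functional f is represented by finitely additive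
   positive measures mu on the ball, and the new norm is built from the infimum
   over mu of sup sum_n 2^-n mu(C_n)^2, where C_n ranges over the closed subsets
   of the unions of G_i with k of the V_i j, n coding (i, k).  If mu_t and mu are
   almost optimal at their mean then mu_t(V_i j) -> mu(V_i j).  The V_i j form a
   network when the ball is descriptive, whence w*-convergence of the
   barycentres; they separate points when it is Gruenhage, which gives
   uniqueness.

   (4) => (1) holds in every compact Hausdorff space, and (5) implies that the
   dual norm is strictly convex. *)

Require Import Defs.
From HB Require Import structures.
From mathcomp Require Import all_boot all_order all_algebra.
From mathcomp Require Import all_classical all_reals all_analysis.
From mathcomp Require Import finmap lra ring.
From mathcomp Require analysis.showcase.summability.

Set Implicit Arguments.
Unset Strict Implicit.
Unset Printing Implicit Defensive.

Import Order.TTheory GRing.Theory Num.Theory.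
Import numFieldNormedType.Exports.

Local Open Scope classical_set_scope.
Local Open Scope ring_scope.

(** For fixed i the family (V_i j)_j may be uncountable, so the values mu(V_i j) cannot enter the
    norm as a series. In the spirit of Day's norm on c_0(Gamma), only the largest sums of k of them
    enter; near-optimality for every k pins down the values above any threshold, and then each
    single value. Finitely additive measures are used because a limit along an ultrafilter, taken
    set by set, is again one: this is why the infimum over mu is attained and the new norm is
    w*-lower semicontinuous. The price is that mu need not be regular. Hence closed sets enter the
    norm, the strata are measured by a Carathéodory outer content made from closed sets, and
    compactness of the ball supplies the countable subadditivity that mu lacks. The basis acts
    mainly through one fact: the coordinates of a functional may be shrunk or change sign without
    increasing its norm. This provides all sign vectors on A when 1_A exists, and the indicators of
    the level sets of f. *)

Lemma cvg_initialP (S : choiceType) (T : topologicalType) (f : S -> T)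
    (F : set_system S) (s : S) : Filter F ->
  F --> (s : initial_topology f) <-> f @ F --> f s.
Proof.
move=> FF; split=> [Fs|Ff].
  by move=> U nU; apply: Fs; exact: (@initial_continuous S T f s U nU).
move=> U [_ [[B oB <-] Bfs BU]].
by apply: filterS BU _; apply: Ff; exact: open_nbhs_nbhs.
Qed.

Lemma ptws_cvgP (I : choiceType) (T : topologicalType) (F : set_system (I -> T))
    (f : I -> T) : Filter F ->
  F --> (f : {ptws I -> T}) <-> forall i, (fun g => g i) @ F --> f i.
Proof.
move=> FF; rewrite cvg_sup; split=> H i.
  by move: (H i) => /cvg_initialP; apply.
by apply/cvg_initialP; exact: H.
Qed.

(** * The w*-topology and dual norms *)

Section DualBasics.
Context {R : realType} {X : normedModType R}.
Implicit Types (f g : dual X) (x y : X).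

Lemma dual_cvgP (F : set_system (dual X)) f : Filter F ->
  F --> f <-> forall x, (fun g : dual X => g x) @ F --> f x.
Proof.
move=> FF.
have -> : (F --> f) = (F --> (f : initial_topology (fun f : dual X => val f : {ptws X -> R}))) by [].
rewrite cvg_initialP ptws_cvgP.
by [].
Qed.

Lemma dual_eqP f g : (forall x, f x = g x) -> f = g.
Proof. by move=> fg; apply/val_inj/funext. Qed.

Lemma dual_linear f : linear (f : X -> R).
Proof. by have [] := set_mem (valP f). Qed.

Lemma dual_continuous f : continuous (f : X -> R).
Proof. by have [] := set_mem (valP f). Qed.

Lemma dual_addE f g x : (f + g : dual X) x = f x + g x.
Proof. by rewrite /dual_fun GRing.valD. Qed.
Lemma dual_scaleE (a : R) f x : (a *: f : dual X) x = a * f x.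
Proof. by rewrite /dual_fun GRing.valZ. Qed.
Lemma dual_zeroE x : (0 : dual X) x = 0.
Proof. by rewrite /dual_fun GRing.val0. Qed.
Lemma dual_oppE f x : (- f : dual X) x = - f x.
Proof. by rewrite /dual_fun GRing.valN. Qed.

End DualBasics.

(** * The Hahn-Banach theorem through minimal sublinear functionals *)

Section HahnBanach.
Context {R : realType} {X : lmodType R}.
Implicit Types (p q : X -> R) (x y v : X).

(** Homogeneity is asked only as an inequality for [t > 0], the form that passes to infima; equality
    and [p 0 = 0] follow on using [t^-1]. *)
Definition sublinear p :=
  (forall x y, p (x + y) <= p x + p y) /\
  (forall t x, 0 < t -> p (t *: x) <= t * p x).

Lemma sublinear0 p : sublinear p -> p 0 = 0.
Proof.
move=> [_ hp]; have := hp 2 0; have := hp 2^-1 0.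
rewrite !scaler0 invr_gt0 ltr0n => /(_ isT) h1 /(_ isT) h2; lra.
Qed.

Lemma sublinearZ p t x : sublinear p -> 0 <= t -> p (t *: x) = t * p x.
Proof.
move=> hp; rewrite le_eqVlt => /predU1P[<-|t0].
  by rewrite scale0r mul0r sublinear0.
apply/eqP; rewrite eq_le hp.2 //=.
rewrite -ler_pdivlMl //; apply: le_trans (hp.2 t^-1 (t *: x) _); last by rewrite invr_gt0.
by rewrite scalerA mulVf ?scale1r // gt_eqF.
Qed.

Lemma sublinear_ge p x : sublinear p -> - p (- x) <= p x.
Proof.
by move=> hp; have := hp.1 x (- x); rewrite subrr sublinear0 //; lra.
Qed.

(* The smallest sublinear functional below [p] that is linear along [v]. *)
Definition sublinear_along p v x :=
  inf [set p (x + t *: v) - t * p v | t in [set t | 0 <= t]].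

Lemma sublinear_along_lb p v x t : sublinear p -> 0 <= t ->
  - p (- x) <= p (x + t *: v) - t * p v.
Proof.
move=> hp t0; rewrite -(sublinearZ v hp t0).
by have := hp.1 (x + t *: v) (- x); rewrite addrC addrA addNr add0r; lra.
Qed.

Lemma sublinear_along_le p v x t : sublinear p -> 0 <= t ->
  sublinear_along p v x <= p (x + t *: v) - t * p v.
Proof.
move=> hp t0; apply: ge_inf; last by exists t.
by exists (- p (- x)) => _ [s s0 <-]; exact: sublinear_along_lb.
Qed.

Lemma sublinear_along_sublinear p v : sublinear p -> sublinear (sublinear_along p v).
Proof.
move=> hp; split=> [x y|t x t0].
  rewrite -lerBlDr; apply: lb_le_inf; first by eexists; exists 0 => //=.
  move=> _ [s s0 <-]; rewrite lerBlDl -lerBlDr.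
  apply: lb_le_inf; first by eexists; exists 0 => //=.
  move=> _ [u u0 <-]; rewrite lerBlDr.
  have su0 : 0 <= s + u by rewrite addr_ge0.
  apply: le_trans (sublinear_along_le _ _ hp su0) _.
  have := hp.1 (x + s *: v) (y + u *: v).
  by rewrite addrACA -scalerDl; lra.
rewrite -ler_pdivrMl //; apply: lb_le_inf; first by eexists; exists 0 => //=.
move=> _ [s s0 <-]; rewrite ler_pdivrMl //.
have ts0 : 0 <= t * s by rewrite mulr_ge0 // ltW.
apply: le_trans (sublinear_along_le _ _ hp ts0) _.
by rewrite -scalerA -scalerDr (sublinearZ _ hp (ltW t0)) mulrBr mulrA.
Qed.

Lemma sublinear_along_opp p v : sublinear p -> sublinear_along p v (- v) <= - p v.
Proof.
move=> hp; have := @sublinear_along_le p v (- v) 1 hp ler01.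
by rewrite scale1r addNr sublinear0 // mul1r sub0r.
Qed.

Lemma sublinear_along_id p v x : sublinear p -> sublinear_along p v x <= p x.
Proof.
move=> hp; have := @sublinear_along_le p v x 0 hp (lexx _).
by rewrite scale0r addr0 mul0r subr0.
Qed.

(* A minimal sublinear functional is linear, since it equals its
   [sublinear_along] in every direction. *)
Lemma hahn_banach p : sublinear p ->
  exists f : X -> R, linear (f : X -> R^o) /\ forall x, f x <= p x.
Proof.
move=> hp; pose T := {q | sublinear q /\ forall x, q x <= p x}.
(* The order is reversed, so that a maximal element from Zorn's lemma is a minimal sublinear
   functional. *)
pose r (s t : T) := `[< forall x, sval t x <= sval s x >].
have t0 : T by exists p.
have [||A Atot|[q [hq qp]] qmin] := @ZL_preorder T t0 r.
- by move=> t; apply/asboolP.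
- move=> s t u /asboolP h1 /asboolP h2; apply/asboolP => x.
  exact: le_trans (h2 x) (h1 x).
- have [[a Aa]|nA] := pselect (exists a, A a); last first.
    by exists t0 => s As; case: nA; exists s.
  pose m x := inf [set sval q x | q in A].
  have lbm x : has_lbound [set sval q x | q in A].
    exists (- p (- x)) => _ [[q [hq qp]] _ <-] /=.
    by apply: le_trans (sublinear_ge x hq); rewrite lerN2.
  have mle (q : T) x : A q -> m x <= sval q x.
    by move=> Aq; apply: ge_inf => //; exists q.
  have mge c x : (forall q : T, A q -> c <= sval q x) -> c <= m x.
    move=> h; apply: lb_le_inf; first by exists (sval a x), a.
    by move=> _ [q Aq <-]; exact: h.
  have hm : sublinear m.
    split=> [x y|t x t0'].
      rewrite -lerBlDr; apply: (mge) => q Aq.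
      rewrite lerBlDl -lerBlDr; apply: (mge) => s As; rewrite lerBlDr.
      have [/asboolP qs|/asboolP sq] := Atot _ _ Aq As.
        apply: le_trans (mle _ _ As) _; apply: le_trans ((svalP s).1.1 _ _) _.
        by rewrite addrC lerD2l; exact: qs.
      apply: le_trans (mle _ _ Aq) _; apply: le_trans ((svalP q).1.1 _ _) _.
      by rewrite addrC lerD2r; exact: sq.
    rewrite -ler_pdivrMl //; apply: (mge) => q Aq; rewrite ler_pdivrMl //.
    apply: le_trans (mle _ _ Aq) _; exact: (svalP q).1.2.
  have mp x : m x <= p x by apply: le_trans (mle _ x Aa) _; exact: (svalP a).2.
  by exists (exist _ m (conj hm mp)) => s As; apply/asboolP => x /=; exact: mle.
- have qN v : q (- v) = - q v.
    have hqv := sublinear_along_sublinear v hq.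
    have qvp x : sublinear_along q v x <= p x.
      by apply: le_trans (sublinear_along_id v x hq) _.
    have /qmin/asboolP/(_ (- v)) /= : r (exist _ q (conj hq qp)) (exist _ _ (conj hqv qvp)).
      by apply/asboolP => x /=; exact: sublinear_along_id.
    move=> h; apply/eqP; rewrite eq_le (le_trans h) ?sublinear_along_opp //=.
    by rewrite lerNl; have := sublinear_ge v hq.
  have qD x y : q (x + y) = q x + q y.
    apply/eqP; rewrite eq_le hq.1 /=.
    by have := hq.1 (- x) (- y); rewrite -opprD !qN; lra.
  exists q; split=> // t x y; rewrite qD; congr (_ + _).
  have [t0'|t0'] := leP 0 t; first exact: sublinearZ.
  rewrite -[t]opprK scaleNr qN sublinearZ ?oppr_ge0 ?ltW //.
  by rewrite [RHS]scaleNr.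
Qed.
End HahnBanach.

Section LinearFunctional.
Context {R : realType} {X : lmodType R} (g : X -> R).
Hypothesis lg : linear (g : X -> R^o).

Lemma linfunD x y : g (x + y) = g x + g y.
Proof. by have := lg 1 x y; rewrite !scale1r. Qed.
Lemma linfun0 : g 0 = 0.
Proof. by have := linfunD 0 0; rewrite addr0 => /eqP; rewrite eq_sym -subr_eq0 addrK => /eqP. Qed.
Lemma linfunZ a x : g (a *: x) = a * g x.
Proof. by have := lg a x 0; rewrite linfun0 !addr0. Qed.
Lemma linfunN x : g (- x) = - g x.
Proof. by rewrite -scaleN1r linfunZ mulN1r. Qed.
Lemma linfunB x y : g (x - y) = g x - g y.
Proof. by rewrite linfunD linfunN. Qed.
Lemma linfun_sum (I : Type) (s : seq I) (P : pred I) (F : I -> X) :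
  g (\sum_(i <- s | P i) F i) = \sum_(i <- s | P i) g (F i).
Proof. by apply: (big_morph g linfunD linfun0). Qed.

End LinearFunctional.

Section DualExistence.
Context {R : realType} {X : normedModType R}.

Lemma dual_of_bounded (g : X -> R) (C : R) : linear (g : X -> R^o) ->
  (forall x, `|g x| <= C * `|x|) -> exists f : dual X, forall x, f x = g x.
Proof.
move=> lg bg.
have cg : continuous (g : X -> R^o).
  move=> x; apply/cvgrPdist_lt => e e0.
  have gB y : g x - g y = g (x - y) by rewrite linfunB.
  have C1 : 0 < `|C| + 1 by rewrite ltr_wpDl.
  near=> y; rewrite gB.
  have h : `|x - y| < e / (`|C| + 1).
    by near: y; apply: cvgr_dist_lt => //; rewrite divr_gt0.
  apply: le_lt_trans (bg _) _; apply: (@le_lt_trans _ _ (`|x - y| * (`|C| + 1))).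
    rewrite mulrC ler_wpM2l // (le_trans (ler_norm _)) // lerDl //.
  by rewrite -ltr_pdivlMr.
have hm : (g : X -> R^o) \in @bounded_functional R X by apply/mem_set.
by exists (exist _ (g : X -> R^o) hm).
Unshelve. all: by end_near.
Qed.

(** Hahn-Banach is applied to the norm made linear along [x0]: a functional below it satisfies
    [g (- x0) <= - |x0|], which forces equality at [x0]. *)
Lemma norming_functional (x0 : X) :
  exists f : dual X, (forall x, `|f x| <= `|x|) /\ f x0 = `|x0|.
Proof.
have hn : sublinear (fun x : X => `|x|).
  by split=> [x y|t x t0]; [exact: ler_normD | rewrite normrZ gtr0_norm].
have [g [lg gle]] := hahn_banach (sublinear_along_sublinear x0 hn).
have gN x : g (- x) = - g x by exact: linfunN.
have gb x : `|g x| <= `|x|.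
  rewrite ler_norml; apply/andP; split.
    rewrite lerNl -gN -[leRHS]normrN; apply: le_trans (gle _) _; exact: sublinear_along_id.
  by apply: le_trans (gle _) _; exact: sublinear_along_id.
have [f fE] : exists f : dual X, forall x, f x = g x.
  by apply: (@dual_of_bounded _ 1) => // x; rewrite mul1r.
exists f; split=> [x|]; first by rewrite fE.
rewrite fE; apply/eqP; rewrite eq_le (le_trans (ler_norm _) (gb _)) /=.
rewrite -lerN2 -gN; apply: le_trans (gle _) _; exact: sublinear_along_opp.
Qed.
End DualExistence.

Section RealSup.
Context {R : realType}.
Implicit Types (A : set R) (x y M : R).

Lemma le_supP A x M : A x -> ubound A M -> x <= sup A.
Proof. by move=> Ax AM; apply: ub_le_sup => //; exists M. Qed.

Lemma sup_leP A M : A !=set0 -> ubound A M -> sup A <= M.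
Proof. by move=> A0 AM; exact: ge_sup. Qed.

Lemma sup_gtP A M x : A !=set0 -> ubound A M -> x < sup A -> exists2 y, A y & x < y.
Proof.
move=> A0 AM xA; have /sup_adherent-/(_ (sup A - x)) : has_sup A by split=> //; exists M.
by rewrite subr_gt0 => /(_ xA)[y Ay]; rewrite opprB addrC subrK; exists y.
Qed.

Lemma inf_ltP A M x : A !=set0 -> lbound A M -> inf A < x -> exists2 y, A y & y < x.
Proof.
move=> A0 AM xA; have /inf_adherent-/(_ (x - inf A)) : has_inf A by split=> //; exists M.
by rewrite subr_gt0 => /(_ xA)[y Ay]; rewrite addrC subrK; exists y.
Qed.

Lemma ultra_bounded_cvg (T : Type) (U : set_system T) (h : T -> R) (C : R) :
  UltraFilter U -> (forall t, `|h t| <= C) -> exists l : R, h @ U --> l.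
Proof.
move=> UU hC; have [|l []] := @segment_compact R (- C) C (h @ U).
  apply: (@filterS _ U _ setT) => [t _|]; last exact: filterT.
  by rewrite /= in_itv /= -ler_norml; exact: hC.
move=> _ hl; exists l => B nB; have [//|nUB] := in_ultra_setVsetC (h @^-1` B) UU.
by have [|z []] // := hl (~` B) B _ nB.
Qed.

Lemma cvg_le_cst (T : Type) (F : set_system T) (h : T -> R) (l c : R) :
  ProperFilter F -> h @ F --> l -> (\forall t \near F, h t <= c) -> l <= c.
Proof.
move=> FF hl hc; rewrite leNgt; apply/negP => cl.
have hg : \forall t \near F, c < h t by apply: (cvgr_gt l).
have [t [h1 h2]] := filter_ex (filterI hc hg).
by have := lt_le_trans h2 h1; rewrite ltxx.
Qed.

End RealSup.

Section Hausdorff.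
Context {R : realType}.

Lemma hausdorff_separating (T : topologicalType) (I : Type) (h : I -> T -> R) :
  (forall i, continuous (h i)) -> (forall x y, (forall i, h i x = h i y) -> x = y) ->
  hausdorff_space T.
Proof.
move=> ch hi p q; rewrite cluster_cvgE => -[G GP [Gq pG]].
apply: hi => i.
have hp : h i @ G --> h i p by apply: cvg_trans (ch i p); apply: cvg_app.
have hq : h i @ G --> h i q by apply: cvg_trans (ch i q); apply: cvg_app.
exact: (cvg_unique _ hp hq).
Qed.

(** The sets that contain such a box form a filter converging to [f] in each coordinate, hence in
    the product topology; so this filter contains every neighbourhood of [f]. *)
Lemma ptws_nbhsP (I : choiceType) (f : {ptws I -> R}) (V : set {ptws I -> R}) :
  nbhs f V -> exists s : seq I, exists2 eta : R, 0 < eta &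
    forall g : I -> R, (forall i, i \in s -> `|g i - f i| < eta) -> V g.
Proof.
pose F : set_system (I -> R) := [set W | exists s : seq I, exists2 eta : R, 0 < eta &
    forall g : I -> R, (forall i, i \in s -> `|g i - f i| < eta) -> W g].
have FF : Filter F.
  split=> [|P Q [s [a a0 sP]] [t [b b0 tQ]]|P Q PQ [s [a a0 sP]]].
  - by exists [::], 1.
  - exists (s ++ t), (Num.min a b); first by rewrite lt_min a0 b0.
    move=> g h; split; [apply: sP|apply: tQ] => i is_.
      by have := h i; rewrite mem_cat is_ => /(_ isT); rewrite lt_min => /andP[].
    by have := h i; rewrite mem_cat is_ orbT => /(_ isT); rewrite lt_min => /andP[].
  - by exists s, a => // g /sP/PQ.
suff : F --> f by apply.
apply/ptws_cvgP => i; apply/cvgrPdist_lt => e e0.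
by exists [:: i], e => // g /(_ i); rewrite inE eqxx distrC => /(_ isT).
Qed.

End Hausdorff.

Section DualTopology.
Context {R : realType} {X : normedModType R}.
Implicit Types (f g : dual X) (x y : X).

Local Notation B := (set_type (@dual_ball R X)).

Lemma ball_cvgP (F : set_system B) (f : B) : Filter F ->
  F --> f <-> forall x, (fun g : B => set_val g x) @ F --> set_val f x.
Proof.
move=> FF.
have -> : (F --> f) = (F --> (f : initial_topology (set_val : B -> dual X))) by [].
by rewrite cvg_initialP dual_cvgP.
Qed.

Lemma ball_eval_continuous x : continuous (fun f : B => set_val f x : R).
Proof. by move=> f; have /ball_cvgP := @cvg_id _ (nbhs f); apply. Qed.

Lemma hausdorff_ball : hausdorff_space B.
Proof.
apply: (@hausdorff_separating R _ X (fun x (f : B) => set_val f x)).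
  by move=> x; exact: ball_eval_continuous.
by move=> f g fg; apply: val_inj; apply: dual_eqP => x; have := fg x; rewrite set_valE.
Qed.

Lemma dual_nbhsP f (V : set (dual X)) : nbhs f V ->
  exists s : seq X, exists2 eta : R, 0 < eta &
    forall g, (forall x, x \in s -> `|g x - f x| < eta) -> V g.
Proof.
move=> [_ [[W oW <-] /= Wf WV]].
have [s [eta eta0 h]] : exists s : seq X, exists2 eta : R, 0 < eta &
    forall g : X -> R, (forall i, i \in s -> `|g i - f i| < eta) -> W g.
  by apply: (@ptws_nbhsP R X (val f) W); exact: open_nbhs_nbhs.
by exists s, eta => // g gf; apply: WV; exact: h.
Qed.

Lemma ball_nbhsP (f : B) (V : set B) : nbhs f V ->
  exists s : seq X, exists2 eta : R, 0 < eta &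
    forall g : B, (forall x, x \in s -> `|set_val g x - set_val f x| < eta) -> V g.
Proof.
move=> [_ [[W oW <-] /= Wf WV]].
have [s [eta eta0 h]] := dual_nbhsP (open_nbhs_nbhs (conj oW Wf)).
by exists s, eta => // g gf; apply: WV; exact: h.
Qed.

End DualTopology.

Section DualNorm.
Context {R : realType} {X : normedModType R}.
Implicit Types (f g : dual X) (x y : X) (N : X -> R).

Lemma equivalent_norm_id : equivalent_norm (fun x : X => `|x|).
Proof.
split; last by exists 1, 1; split=> // x; rewrite !mul1r lexx.
split=> [x /normr0_eq0//|a x|x y]; [exact: normrZ|exact: ler_normD].
Qed.

Lemma dual_bounded f : exists2 C : R, 0 < C & forall x, `|f x| <= C * `|x|.
Proof.
have f0 : f 0 = 0 by exact: (linfun0 (dual_linear f)).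
have cf : f y @[y --> (0 : X)] --> (0 : R) by rewrite -f0; exact: dual_continuous.
have /cvgrPdist_lt/(_ 1 ltr01)/nbhs_norm0P[r /= r0 hr] := cf.
exists (2 / r) => [|x]; first by rewrite divr_gt0.
have [->|x0] := eqVneq x 0; first by rewrite f0 !normr0 mulr0.
have nx0 : 0 < `|x| by rewrite normr_gt0.
have /hr /= : `|(r / 2 / `|x|) *: x| < r.
  rewrite normrZ normrM normfV normr_id mulfVK ?gt_eqF // gtr0_norm ?divr_gt0 //.
  by rewrite ltr_pdivrMr // ltr_pMr // ltr1n.
rewrite sub0r normrN (linfunZ (dual_linear f)) normrM gtr0_norm ?divr_gt0 //.
rewrite -ltr_pdivlMl ?divr_gt0 // mulr1 => /ltW/le_trans; apply.
by rewrite invf_div invf_div mulrC.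
Qed.

Section Equivalent.
Variables (N : X -> R) (hN : equivalent_norm N).

Lemma eqnorm0 : N 0 = 0.
Proof. by have [[_ h _] _] := hN; rewrite -(scale0r 0) h normr0 mul0r. Qed.

Lemma eqnormZ a x : N (a *: x) = `|a| * N x.
Proof. by have [[_ h _] _] := hN. Qed.

Lemma eqnormN x : N (- x) = N x.
Proof. by rewrite -scaleN1r eqnormZ normrN1 mul1r. Qed.

Lemma eqnorm_gt0 x : x != 0 -> 0 < N x.
Proof.
have [_ [c [C [c0 C0 h]]]] := hN; move=> x0.
by have /andP[h1 _] := h x; apply: lt_le_trans h1; rewrite mulr_gt0 // normr_gt0.
Qed.

Lemma eqnorm_ge0 x : 0 <= N x.
Proof. by have [->|/eqnorm_gt0/ltW//] := eqVneq x 0; rewrite eqnorm0. Qed.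

Lemma dual_norm_set_nonempty f : [set `|f x| | x in [set x : X | N x <= 1]] !=set0.
Proof. by exists `|f 0|, 0 => //=; rewrite eqnorm0. Qed.

Lemma dual_norm_le f c : 0 <= c -> (forall x, `|f x| <= c * N x) -> dual_norm N f <= c.
Proof.
move=> c0 h; apply: sup_leP (dual_norm_set_nonempty f) _ => _ [z /= z1 <-].
by apply: le_trans (h z) _; rewrite ler_piMr.
Qed.

Lemma dual_norm_ub f : exists M, ubound [set `|f x| | x in [set x : X | N x <= 1]] M.
Proof.
have [C C0 hC] := dual_bounded f; have [_ [c [D [c0 D0 h]]]] := hN.
exists (C / c) => _ [x /= x1 <-]; apply: le_trans (hC x) _.
rewrite ler_pM2l // -[c^-1]mul1r ler_pdivlMr // mulrC.
by have /andP[h1 _] := h x; apply: le_trans h1 _.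
Qed.

Lemma dual_norm_ge f x : `|f x| <= dual_norm N f * N x.
Proof.
have [->|x0] := eqVneq x 0.
  by rewrite (linfun0 (dual_linear f)) eqnorm0 normr0 mulr0.
have Nx0 := eqnorm_gt0 x0; rewrite -ler_pdivrMr //.
have [M hM] := dual_norm_ub f; apply: le_supP hM => /=.
exists ((N x)^-1 *: x); first by rewrite /= eqnormZ gtr0_norm ?invr_gt0 // mulVf // gt_eqF.
by rewrite (linfunZ (dual_linear f)) normrM gtr0_norm ?invr_gt0 // mulrC.
Qed.

Lemma dual_norm_ge0 f : 0 <= dual_norm N f.
Proof.
have [M hM] := dual_norm_ub f; apply: le_trans (le_supP _ hM).
  exact: (normr_ge0 (f 0)).
by exists 0 => //=; rewrite eqnorm0.
Qed.

End Equivalent.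
End DualNorm.

(** * The Banach-Alaoglu theorem *)

Section Alaoglu.
Context {R : realType} {X : normedModType R}.
Implicit Types (f g : dual X) (x y : X).
Local Notation B := (set_type (@dual_ball R X)).
Local Notation dn := (dual_norm (fun x : X => `|x|)).

Lemma dual_ballP f : dual_ball f <-> forall x, `|f x| <= `|x|.
Proof.
split=> [f1 x|h]; last by apply: (dual_norm_le equivalent_norm_id) => // x; rewrite mul1r.
apply: le_trans (dual_norm_ge equivalent_norm_id f x) _.
by rewrite -[leRHS]mul1r ler_wpM2r.
Qed.

(** Boundedness gives a limit at each vector, and linearity and the bound pass to it. This takes the
    place of Tychonoff's theorem, and serves again to build functionals from finite sections. *)
Lemma ultra_dual_limit (T : Type) (U : set_system T) (F : T -> dual X) (C : R) :
  UltraFilter U -> (forall t x, `|F t x| <= C * `|x|) ->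
  exists2 f : dual X, (forall x, (fun t => F t x) @ U --> f x) &
    forall x, `|f x| <= C * `|x|.
Proof.
move=> UU hF.
have /choice[l lP] : forall x, exists l : R, (fun t => F t x) @ U --> l.
  by move=> x; apply: (ultra_bounded_cvg UU) => t; exact: hF.
have ll : linear (l : X -> R^o).
  move=> a x y; apply: (@cvg_unique _ (@norm_hausdorff _ R^o) (F t (a *: x + y) @[t --> U])).
    exact: lP.
  have -> : (fun t => F t (a *: x + y)) = (fun t => a * F t x + F t y).
    by apply/funext => t; rewrite (dual_linear (F t)).
  by apply: cvgD; [apply: cvgMr; exact: lP|exact: lP].
have lb x : `|l x| <= C * `|x|.
  apply: (@cvg_le_cst _ _ U (fun t => `|F t x|)).
    by apply: cvg_norm; exact: lP.
  by apply: nearW => t; exact: hF.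
have [f fE] := dual_of_bounded ll lb.
by exists f => x; rewrite fE.
Qed.

Lemma compact_ball : compact [set: B].
Proof.
rewrite compact_ultra => U UU _.
have [|f fl fb] := @ultra_dual_limit B U (fun g : B => set_val g) 1 UU.
  by move=> g x; rewrite mul1r; exact: (dual_ballP (set_val g)).1 (set_valP g) x.
have Bf : f \in @dual_ball R X.
  by apply/mem_set/dual_ballP => x; rewrite -[leRHS]mul1r.
exists (exist _ f Bf); split=> //=.
by apply/ball_cvgP => x; rewrite set_valE; exact: fl.
Qed.

Lemma regular_ball : regular_space B.
Proof.
move=> f; apply: (@compact_regular _ f setT hausdorff_ball compact_ball).
exact: filterT.
Qed.

Lemma normal_ball : normal_space B.
Proof. exact: compact_normal hausdorff_ball compact_ball. Qed.

End Alaoglu.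

Section DualNormIsNorm.
Context {R : realType} {X : normedModType R} (N : X -> R).
Hypothesis hN : equivalent_norm N.
Implicit Types (f g : dual X) (x y : X).

Lemma dual_norm0 : dual_norm N 0 = 0.
Proof.
apply/eqP; rewrite eq_le dual_norm_ge0 // andbT dual_norm_le // => x.
by rewrite dual_zeroE normr0 mul0r.
Qed.

Lemma dual_normD f g : dual_norm N (f + g) <= dual_norm N f + dual_norm N g.
Proof.
apply: dual_norm_le => // [|x]; first by rewrite addr_ge0 // dual_norm_ge0.
rewrite dual_addE mulrDl; apply: le_trans (ler_normD _ _) _.
by rewrite lerD // dual_norm_ge.
Qed.

Lemma dual_normZ (a : R) f : dual_norm N (a *: f) = `|a| * dual_norm N f.
Proof.
have le b h : dual_norm N (b *: h) <= `|b| * dual_norm N h.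
  apply: dual_norm_le => // [|x]; first by rewrite mulr_ge0 // dual_norm_ge0.
  by rewrite dual_scaleE normrM -mulrA ler_wpM2l // dual_norm_ge.
have [->|a0] := eqVneq a 0; first by rewrite scale0r normr0 mul0r dual_norm0.
apply/eqP; rewrite eq_le le /=.
have := le a^-1 (a *: f); rewrite scalerA mulVf // scale1r normfV.
by rewrite -ler_pdivrMl ?invr_gt0 ?normr_gt0 // invrK.
Qed.

Lemma dual_norm_eq0 f : dual_norm N f = 0 -> f = 0.
Proof.
move=> f0; apply: dual_eqP => x; rewrite dual_zeroE; apply/eqP; rewrite -normr_le0.
by have := dual_norm_ge hN f x; rewrite f0 mul0r.
Qed.

(** Evaluation at the witness [x] is w*-continuous, so this is the w*-lower semicontinuity of the
    dual norm; replacing [x] by [- x] removes the absolute value. *)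
Lemma dual_norm_lsc f c : c < dual_norm N f -> exists x,
  N x <= 1 /\ c < f x.
Proof.
move=> cf; have [M hM] := dual_norm_ub hN f.
have [_ [x /= x1 <-]] := sup_gtP (dual_norm_set_nonempty hN f) hM cf.
have [f0|f0] := leP 0 (f x); first by rewrite ger0_norm //; exists x.
rewrite ltr0_norm // => h; exists (- x); rewrite eqnormN //; split=> //.
by rewrite (linfunN (dual_linear f)).
Qed.

End DualNormIsNorm.

(** * Norms on the dual with w*-closed unit ball are dual norms *)

Section Bipolar.
Context {R : realType} {X : normedModType R} (M : dual X -> R) (c C : R).
Local Notation dn := (dual_norm (fun x : X => `|x|)).
Hypotheses (M_norm : is_norm M) (c0 : 0 < c) (C0 : 0 < C).
Hypothesis M_equiv : forall f, c * dn f <= M f <= C * dn f.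
Hypothesis M_closed : closed [set f : dual X | M f <= 1].
Implicit Types (f g : dual X) (x y : X).

Let M0 : M 0 = 0.
Proof. by have [_ h _] := M_norm; rewrite -(scale0r 0) h normr0 mul0r. Qed.
Let MZ a f : M (a *: f) = `|a| * M f.
Proof. by have [_ h _] := M_norm. Qed.
Let MD f g : M (f + g) <= M f + M g.
Proof. by have [_ _ h] := M_norm. Qed.
Let MN f : M (- f) = M f.
Proof. by rewrite -scaleN1r MZ normrN1 mul1r. Qed.
Let M_ge0 f : 0 <= M f.
Proof.
have /andP[h _] := M_equiv f; apply: le_trans h.
exact: mulr_ge0 (ltW c0) (dual_norm_ge0 equivalent_norm_id f).
Qed.

Let M_bound f x : `|f x| <= M f / c * `|x|.
Proof.
apply: le_trans (dual_norm_ge equivalent_norm_id f x) _; rewrite ler_wpM2r //.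
by rewrite ler_pdivlMr // mulrC; have /andP[] := M_equiv f.
Qed.

(* A functional outside the w*-closed unit ball differs from its elements on
   finitely many vectors; in these coordinates the direction towards a nearly
   nearest point separates. *)
Let separation f : 1 < M f ->
  exists x (b : R), b < f x /\ forall g, M g <= 1 -> g x <= b.
Proof.
move=> f1.
have [s [eta eta0 hs]] : exists s : seq X, exists2 eta : R, 0 < eta &
    forall g, (forall x, x \in s -> `|g x - f x| < eta) -> ~ (M g <= 1).
  apply: (@dual_nbhsP R X f (~` [set f | M f <= 1])).
  apply: open_nbhs_nbhs; split; first exact: closed_openC.
  by apply/negP; rewrite -ltNge.
pose ip (u v : X -> R) := \sum_(x <- s) u x * v x.
pose phi g := ip (fun x => f x - g x) (fun x => f x - g x).
pose A := [set phi g | g in [set g | M g <= 1]].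
have A0 : A !=set0 by exists (phi 0), 0 => //=; rewrite M0.
pose m := inf A.
have phi_ge g : M g <= 1 -> eta ^+ 2 <= phi g.
  move=> g1; rewrite leNgt; apply/negP => lt.
  apply: (hs g) => // x xs; rewrite distrC ltNge; apply/negP => le.
  move: lt; apply/negP; rewrite -leNgt /phi /ip (big_rem x) //=.
  rewrite -[leLHS]addr0 lerD ?sumr_ge0 // => [|y _]; last by rewrite -expr2 sqr_ge0.
  by rewrite -expr2 -[leRHS]real_normK ?num_real // lerXn2r ?nnegrE // ltW.
have lbA : lbound A 0.
  by move=> _ [g /= g1 <-]; apply: le_trans (phi_ge g g1); rewrite sqr_ge0.
have m0 : 0 < m.
  apply: (@lt_le_trans _ _ (eta ^+ 2)); first by rewrite exprn_gt0.
  by apply: lb_le_inf => // _ [g /= g1 <-]; exact: phi_ge.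
have mle g : M g <= 1 -> m <= phi g.
  by move=> g1; apply: ge_inf; [exists 0|exists g].
pose D := \sum_(x <- s) (2 / c * `|x|) ^+ 2 + 1.
have D0 : 0 < D.
  by rewrite ltr_wpDl // sumr_ge0 // => x _; rewrite sqr_ge0.
(* Moving from [g0] to [g] by the fraction [t] changes [phi] by a linear term and at most
   [t ^+ 2 * D]. This [t] makes the latter at most [t * m / 2], which is also the tolerance allowed
   in the choice of [g0]; dividing by [t] then leaves [g y - g0 y <= m / 2]. *)
pose t := m / (2 * (D + m)).
have Dm : 0 < D + m by rewrite addr_gt0.
have t0 : 0 < t by rewrite divr_gt0 // mulr_gt0.
have tE : t * (2 * (D + m)) = m by rewrite divfK // gt_eqF // mulr_gt0.
have t1 : t <= 1 by nra.
have : inf A < m + t * m / 2 by rewrite ltrDl divr_gt0 // mulr_gt0.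
move=> /(inf_ltP A0 lbA)[_ [g0 /= g01 <-] g0m].
pose y := \sum_(x <- s) (f x - g0 x) *: x.
have ipy (h : dual X) : h y = ip h (fun x => f x - g0 x).
  rewrite /y (linfun_sum (dual_linear h)); apply: eq_bigr => x _.
  by rewrite (linfunZ (dual_linear h)) mulrC.
have fy : f y = g0 y + phi g0.
  rewrite !ipy -big_split /=; apply: eq_bigr => x _; ring.
exists y, (g0 y + m / 2); split.
  by rewrite fy ltrD2l; have := mle _ g01; lra.
move=> g g1.
pose h : dual X := (1 - t) *: g0 + t *: g.
have h1 : M h <= 1.
  apply: le_trans (MD _ _) _; rewrite !MZ !ger0_norm ?subr_ge0 ?(ltW t0) //.
  by have := M_ge0 g; nra.
have hE : phi h = phi g0 - 2 * t * (g y - g0 y) + t ^+ 2 * ip (fun x => g x - g0 x) (fun x => g x - g0 x).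
  rewrite !ipy /phi /ip -!sumrB ?mulr_sumr -?sumrB -?big_split /=.
  by apply: eq_bigr => x _; rewrite /h dual_addE !dual_scaleE; ring.
have ipD : ip (fun x => g x - g0 x) (fun x => g x - g0 x) <= D.
  apply: (@le_trans _ _ (\sum_(x <- s) (2 / c * `|x|) ^+ 2)); last by rewrite lerDl.
  apply: ler_sum => x _; rewrite -expr2 -[leLHS]real_normK ?num_real //.
  have c2 : 0 <= 2 / c by rewrite divr_ge0 // ltW.
  rewrite lerXn2r ?nnegrE // ?(mulr_ge0 c2) //.
  apply: le_trans (ler_normB _ _) _.
  have b1 := M_bound g x; have b2 := M_bound g0 x.
  have k : 0 <= c^-1 * `|x| by rewrite mulr_ge0 // invr_ge0 ltW.
  by move: b1 b2 k; rewrite -!mulrA; move: (_^-1 * _) => z; nra.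
have := mle _ h1; rewrite hE => H.
have e1 : 2 * t * (g y - g0 y) <= t * m / 2 + t ^+ 2 * D.
  have : t ^+ 2 * ip (fun x => g x - g0 x) (fun x => g x - g0 x) <= t ^+ 2 * D.
    by rewrite ler_wpM2l // sqr_ge0.
  lra.
have e2 : t * (2 * (g y - g0 y)) <= t * m by nra.
by move: e2; rewrite ler_pM2l //; lra.
Qed.

(** The norm on [X] is the support function [p] of the unit ball of [M]. If its dual norm were
    smaller than [M] at [f], then rescaling [f] by a value strictly between the two puts it outside
    the ball, and a separating vector contradicts the definition of [p]. *)
Lemma bipolar_norm : exists2 N : X -> R, equivalent_norm N & forall f, dual_norm N f = M f.
Proof.
pose p x := sup [set `|f x| | f in [set f | M f <= 1]].
have ne x : [set `|f x| | f in [set f | M f <= 1]] !=set0.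
  by exists `|(0 : dual X) x|, 0 => //=; rewrite M0.
have ub x : ubound [set `|f x| | f in [set f | M f <= 1]] (c^-1 * `|x|).
  move=> _ [f /= f1 <-]; apply: le_trans (M_bound f x) _.
  by rewrite ler_wpM2r // -[leRHS]mul1r ler_wpM2r // invr_ge0 ltW.
have ple f x : M f <= 1 -> `|f x| <= p x by move=> f1; apply: le_supP (ub x); exists f.
have ple' f x : `|f x| <= M f * p x.
  have [f0|f0] := eqVneq (M f) 0.
    have [h _ _] := M_norm.
    by rewrite (h _ f0) M0 mul0r dual_zeroE normr0.
  have Mf : 0 < M f by rewrite lt_neqAle eq_sym f0 M_ge0.
  rewrite -ler_pdivrMl //; have := ple ((M f)^-1 *: f) x.
  rewrite MZ dual_scaleE normrM gtr0_norm ?invr_gt0 // mulVf //; exact.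
have pub x b : (forall f, M f <= 1 -> `|f x| <= b) -> p x <= b.
  by move=> h; apply: sup_leP => // _ [f f1 <-]; exact: h.
have plow x : C^-1 * `|x| <= p x.
  have [f [f1 fx]] := norming_functional x.
  have : M (C^-1 *: f) <= 1.
    rewrite MZ gtr0_norm ?invr_gt0 // ler_pdivrMl // mulr1.
    have /andP[_ h] := M_equiv f; apply: le_trans h _.
    by rewrite -[leRHS]mulr1 (ler_wpM2l (ltW C0)) //; apply/dual_ballP.
  by move=> h; have := ple _ x h; rewrite dual_scaleE fx normrM normr_id gtr0_norm ?invr_gt0.
have pZ a x : p (a *: x) = `|a| * p x.
  have le b z : p (b *: z) <= `|b| * p z.
    apply: pub => f f1; rewrite (linfunZ (dual_linear f)) normrM ler_wpM2l //; exact: ple.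
  have [->|a0] := eqVneq a 0.
    rewrite scale0r normr0 mul0r; apply/eqP; rewrite eq_le.
    have h0 := le 0 0; rewrite scale0r normr0 mul0r in h0; rewrite h0 /=.
    by apply: le_trans (plow 0); rewrite normr0 mulr0.
  apply/eqP; rewrite eq_le le /=.
  have := le a^-1 (a *: x); rewrite scalerA mulVf // scale1r normfV.
  by rewrite -ler_pdivrMl ?invr_gt0 ?normr_gt0 // invrK.
have hp : equivalent_norm p.
  split; last first.
    by exists C^-1, c^-1; split=> [||x]; rewrite ?invr_gt0 // plow /=; exact: sup_leP.
  split=> [x x0|//|x y].
    apply/eqP; rewrite -normr_le0.
    by have := plow x; rewrite x0 pmulr_rle0 // invr_gt0.
  apply: pub => f f1; rewrite (linfunD (dual_linear f)).
  by apply: le_trans (ler_normD _ _) _; rewrite lerD // ple.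
exists p => // f; apply/eqP; rewrite eq_le; apply/andP; split.
  by apply: dual_norm_le => // x; exact: ple'.
rewrite leNgt; apply/negP => lt.
pose d := dual_norm p f; pose t := (d + M f) / 2.
have d0 : 0 <= d by exact: dual_norm_ge0.
have [dt tM] : d < t /\ t < M f by split; rewrite /t /d; lra.
have t0 : 0 < t by exact: le_lt_trans d0 dt.
have [|x [b [bf hb]]] := @separation (t^-1 *: f).
  by rewrite MZ gtr0_norm ?invr_gt0 // ltr_pdivlMl // mulr1.
have px : p x <= b.
  apply: pub => g g1; rewrite ler_norml; apply/andP; split; last exact: hb.
  by rewrite lerNl -dual_oppE hb // MN.
have := dual_norm_ge hp f x; rewrite -/d => h.
have p0 : 0 <= p x by exact: eqnorm_ge0 hp x.
move: bf; rewrite dual_scaleE ltr_pdivlMl // => bf.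
have h2 : f x <= d * p x by apply: le_trans h; exact: ler_norm.
have : t * b < t * b.
  apply: lt_le_trans bf _; apply: le_trans h2 _; nra.
by rewrite ltxx.
Qed.

End Bipolar.

Lemma compact_finite_cover (T : topologicalType) (J : choiceType) (A : set T)
    (f : J -> set T) : compact A -> (forall j, open (f j)) ->
  A `<=` \bigcup_j f j -> exists D : {fset J}, A `<=` \bigcup_(j in [set` D]) f j.
Proof.
move=> /compact_near_coveringP cA fo Af.
pose P (D : {fset J}) x := (\bigcup_(j in [set` D]) f j) x.
have FF : ProperFilter (@summability.totally J) := summability.totally_filter.
have H x : A x -> \forall x' \near x & D \near @summability.totally J, P D x'.
  move=> /Af[j _ fjx].
  exists (f j, [set D : {fset J} | [fset j]%fset `<=` D]%fset).
    split; first exact: (open_nbhs_nbhs (conj (fo j) fjx)).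
    by exists [fset j]%fset.
  move=> [y D] /= [fy jD]; exists j => //=.
  by have := jD; rewrite /= fsub1set.
have [D h] := filter_ex (cA _ _ P _ H).
by exists D.
Qed.

(** * Finitely additive measures on a compact space *)

Section PositiveFunctionals.
Context {R : realType} {K : topologicalType}.
Implicit Types (phi psi : K -> R) (mu nu : (K -> R) -> R) (C D O : set K).

Definition bounded_on phi := exists c : R, forall k, `|phi k| <= c.

(* A positive functional on the bounded functions on [K], that is a finitely
   additive positive measure on all subsets of [K]; its values on unbounded
   functions are irrelevant. *)
Definition positive_functional mu :=
  [/\ forall phi psi, bounded_on phi -> bounded_on psi ->
        mu (fun k => phi k + psi k) = mu phi + mu psi,
      forall a phi, bounded_on phi -> mu (fun k => a * phi k) = a * mu phi
    & forall phi, bounded_on phi -> (forall k, 0 <= phi k) -> 0 <= mu phi].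

Definition mass mu := mu (fun=> 1).
Definition content mu C := mu (\1_C).
(** As [mu] is only finitely additive, closed subsets need not exhaust the content of an open set.
    The inner content is the regularised value, and the outer content extends it from open sets to
    all sets. *)
Definition inner_content mu O := sup [set content mu C | C in [set C | closed C /\ C `<=` O]].
Definition outer_content mu S := inf [set inner_content mu O | O in [set O | open O /\ S `<=` O]].

Lemma bounded_on_cst (c : R) : bounded_on (fun=> c).
Proof. by exists `|c|. Qed.

Lemma bounded_onD phi psi : bounded_on phi -> bounded_on psi -> bounded_on (fun k => phi k + psi k).
Proof.
move=> [c hc] [d hd]; exists (c + d) => k.
by apply: le_trans (ler_normD _ _) _; rewrite lerD.
Qed.

Lemma bounded_onZ (a : R) phi : bounded_on phi -> bounded_on (fun k => a * phi k).
Proof. by move=> [c hc]; exists (`|a| * c) => k; rewrite normrM ler_wpM2l. Qed.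

Lemma bounded_on_indic C : bounded_on (\1_C).
Proof. by exists 1 => k; rewrite indicE; case: (_ \in _); rewrite ?normr1 ?normr0. Qed.

Hint Resolve bounded_on_cst bounded_on_indic bounded_onD bounded_onZ : core.

Section OneFunctional.
Variable mu : (K -> R) -> R.
Hypothesis hmu : positive_functional mu.

Let muD phi psi : bounded_on phi -> bounded_on psi -> mu (fun k => phi k + psi k) = mu phi + mu psi.
Proof. by have [h _ _] := hmu; exact: h. Qed.
Let muZ a phi : bounded_on phi -> mu (fun k => a * phi k) = a * mu phi.
Proof. by have [_ h _] := hmu; exact: h. Qed.
Let mu_ge0 phi : bounded_on phi -> (forall k, 0 <= phi k) -> 0 <= mu phi.
Proof. by have [_ _ h] := hmu; exact: h. Qed.

Lemma posfN phi : bounded_on phi -> mu (fun k => - phi k) = - mu phi.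
Proof.
move=> b; rewrite -mulN1r -muZ //; congr mu; apply/funext => k; by rewrite mulN1r.
Qed.

Lemma posf_le phi psi : bounded_on phi -> bounded_on psi ->
  (forall k, phi k <= psi k) -> mu phi <= mu psi.
Proof.
move=> b1 b2 h; rewrite -subr_ge0 -posfN // -muD //; last first.
  by have := bounded_onZ (-1) b1; under eq_fun do rewrite mulN1r.
apply: mu_ge0 => [|k]; last by rewrite subr_ge0.
by apply: bounded_onD => //; have := bounded_onZ (-1) b1; under eq_fun do rewrite mulN1r.
Qed.

Lemma mu_cst (c : R) : mu (fun=> c) = c * mass mu.
Proof. by rewrite /mass -muZ //; congr mu; apply/funext => k; rewrite mulr1. Qed.

Lemma mass_ge0 : 0 <= mass mu.
Proof. by apply: mu_ge0 => // k; rewrite ler01. Qed.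

Lemma posf_norm phi c : (forall k, `|phi k| <= c) -> `|mu phi| <= c * mass mu.
Proof.
move=> h; have b : bounded_on phi by exists c.
rewrite ler_norml -mulNr -!mu_cst; apply/andP.
by split; apply: posf_le => // k; have := h k; rewrite ler_norml => /andP[].
Qed.

Lemma content_ge0 C : 0 <= content mu C.
Proof. by apply: mu_ge0. Qed.

Lemma content_mono C D : C `<=` D -> content mu C <= content mu D.
Proof.
move=> CD; apply: posf_le => // k; rewrite !indicE ler_nat.
have [kC|//] := boolP (k \in C); by rewrite (mem_set (CD _ (set_mem kC))).
Qed.

Lemma content_disj C D : C `&` D = set0 -> content mu (C `|` D) = content mu C + content mu D.
Proof.
move=> CD; rewrite /content -muD //; congr mu; apply/funext => k; rewrite !indicE in_setU.
have [kC|kC] := boolP (k \in C); have [kD|kD] := boolP (k \in D); rewrite ?addr0 ?add0r //.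
by exfalso; rewrite -[False]/(set0 k) -CD; split; exact: set_mem.
Qed.

Lemma content_setT : content mu setT = mass mu.
Proof. by rewrite /content indicT. Qed.

Lemma content_set0 : content mu set0 = 0.
Proof. by rewrite /content indic0 [mu _]mu_cst mul0r. Qed.

Lemma content_le_mass C : content mu C <= mass mu.
Proof. by rewrite -content_setT content_mono. Qed.

Lemma content_subU C D : content mu (C `|` D) <= content mu C + content mu D.
Proof.
have -> : C `|` D = C `|` (D `\` C).
  apply/seteqP; split=> k /=; last by move=> [?|[? _]]; [left|right].
  by move=> [?|?]; [left|have [?|?] := pselect (C k); [left|right]].
rewrite content_disj ?lerD2l; first by apply: content_mono => k [].
by apply/seteqP; split=> k // [kC []].
Qed.

Let inner_set O := [set content mu C | C in [set C | closed C /\ C `<=` O]].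
Let inner_ne O : inner_set O !=set0.
Proof. by exists (content mu set0), set0 => //; split=> //; exact: closed0. Qed.
Let inner_ub O : ubound (inner_set O) (mass mu).
Proof. by move=> _ [C _ <-]; exact: content_le_mass. Qed.

Lemma inner_ge C O : closed C -> C `<=` O -> content mu C <= inner_content mu O.
Proof. by move=> cC CO; apply: le_supP (@inner_ub O); exists C. Qed.

Lemma inner_le O b : (forall C, closed C -> C `<=` O -> content mu C <= b) -> inner_content mu O <= b.
Proof. by move=> h; apply: sup_leP (@inner_ne O) _ => _ [C [cC CO] <-]; exact: h. Qed.

Lemma inner_approx O e : 0 < e -> exists C, [/\ closed C, C `<=` O & inner_content mu O - e < content mu C].
Proof.
move=> e0; have lt : inner_content mu O - e < inner_content mu O by rewrite ltrBlDr ltrDl.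
by have [_ [C [cC CO] <-] ?] := sup_gtP (@inner_ne O) (@inner_ub O) lt; exists C.
Qed.

Lemma inner_mono O P : O `<=` P -> inner_content mu O <= inner_content mu P.
Proof. by move=> OP; apply: inner_le => C cC CO; apply: inner_ge => //; exact: subset_trans OP. Qed.

Lemma inner_ge0 O : 0 <= inner_content mu O.
Proof. by apply: le_trans (inner_ge closed0 (@sub0set _ O)); rewrite content_set0. Qed.

Lemma inner_le_mass O : inner_content mu O <= mass mu.
Proof. by apply: inner_le => C _ _; exact: content_le_mass. Qed.

Lemma inner_setT : inner_content mu setT = mass mu.
Proof. by apply/eqP; rewrite eq_le inner_le_mass -content_setT inner_ge. Qed.

Lemma inner_split C O : closed C -> C `<=` O ->
  content mu C + inner_content mu (O `\` C) <= inner_content mu O.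
Proof.
move=> cC CO; rewrite -lerBrDl; apply: inner_le => D cD DO; rewrite lerBrDl -content_disj.
  apply: inner_ge; first exact: closedU.
  by move=> k [/CO//|/DO[]].
by apply/seteqP; split=> k // [kC /DO[]].
Qed.

Let outer_set S := [set inner_content mu O | O in [set O | open O /\ S `<=` O]].
Let outer_ne S : outer_set S !=set0.
Proof. by exists (inner_content mu setT), setT => //; split=> //; exact: openT. Qed.
Let outer_lb S : lbound (outer_set S) 0.
Proof. by move=> _ [ O _ <-]; exact: inner_ge0. Qed.

Lemma outer_le S O : open O -> S `<=` O -> outer_content mu S <= inner_content mu O.
Proof. by move=> oO SO; apply: ge_inf; [exists 0; exact: outer_lb|exists O]. Qed.

Lemma outer_ge S b : (forall O, open O -> S `<=` O -> b <= inner_content mu O) -> b <= outer_content mu S.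
Proof. by move=> h; apply: lb_le_inf (outer_ne S) _ => _ [ O [oO SO] <-]; exact: h. Qed.

Lemma outer_approx S e : 0 < e ->
  exists O, [/\ open O, S `<=` O & inner_content mu O < outer_content mu S + e].
Proof.
move=> e0; have lt : outer_content mu S < outer_content mu S + e by rewrite ltrDl.
by have [_ [ O [oO SO] <-] ?] := inf_ltP (@outer_ne S) (@outer_lb S) lt; exists O.
Qed.

Lemma outer_ge0 S : 0 <= outer_content mu S.
Proof. by apply: outer_ge => O _ _; exact: inner_ge0. Qed.

Lemma outer_mono S T : S `<=` T -> outer_content mu S <= outer_content mu T.
Proof. by move=> ST; apply: outer_ge => O oO TO; apply: outer_le => //; exact: subset_trans TO. Qed.

Lemma outer_open O : open O -> outer_content mu O = inner_content mu O.
Proof.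
move=> oO; apply/eqP; rewrite eq_le outer_le //=.
by apply: outer_ge => P _ OP; exact: inner_mono.
Qed.

Lemma outer_closed_ge C : closed C -> content mu C <= outer_content mu C.
Proof. by move=> cC; apply: outer_ge => O _ CO; exact: inner_ge. Qed.

Lemma outer_setT : outer_content mu setT = mass mu.
Proof. by rewrite outer_open ?inner_setT //; exact: openT. Qed.

(** Carathéodory's measurability condition for the outer content. *)
Definition splitting S := forall T,
  outer_content mu T = outer_content mu (T `&` S) + outer_content mu (T `\` S).

Hypothesis compK : compact [set: K].
Hypothesis normK : normal_space K.

(** Normality gives disjoint open sets around the disjoint closed sets [C \ O] and [C \ P]; removing
    one or the other from [C] leaves the two pieces. *)
Lemma closed_setU_shrink C O P : closed C -> open O -> open P -> C `<=` O `|` P ->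
  exists C1 C2, [/\ closed C1, closed C2, C1 `<=` O, C2 `<=` P & C `<=` C1 `|` C2].
Proof.
move=> cC oO oP COP.
have [U [V [oU oV CU CV UV]]] : exists U V : set K,
    [/\ open U, open V, C `\` O `<=` U, C `\` P `<=` V & U `&` V = set0].
  apply: (@normal_openP R K).1 => //.
  - by rewrite setDE; apply: closedI => //; exact: open_closedC.
  - by rewrite setDE; apply: closedI => //; exact: open_closedC.
  - by apply/seteqP; split=> k // [[kC kO] [_ kP]]; have [] := COP k kC.
exists (C `\` U), (C `\` V); split.
- by rewrite setDE; apply: closedI => //; exact: open_closedC.
- by rewrite setDE; apply: closedI => //; exact: open_closedC.
- by move=> k [kC kU]; apply: contrapT => kO; exact: kU (CU k (conj kC kO)).
- by move=> k [kC kV]; apply: contrapT => kP; exact: kV (CV k (conj kC kP)).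
- move=> k kC; have [kU|kU] := pselect (U k); last by left.
  by right; split=> // kV; rewrite -[False]/(set0 k) -UV.
Qed.

Lemma inner_setU O P : open O -> open P ->
  inner_content mu (O `|` P) <= inner_content mu O + inner_content mu P.
Proof.
move=> oO oP; apply: inner_le => C cC COP.
have [C1 [C2 [c1 c2 C1O C2P CC]]] := closed_setU_shrink cC oO oP COP.
apply: le_trans (content_mono CC) _; apply: le_trans (content_subU _ _) _.
by rewrite lerD // inner_ge.
Qed.

Lemma outer_setU S T : outer_content mu (S `|` T) <= outer_content mu S + outer_content mu T.
Proof.
apply/ler_addgt0Pr => e e0; have e2 : 0 < e / 2 by rewrite divr_gt0.
have [ O [oO SO hO]] := outer_approx S e2; have [P [oP TP hP]] := outer_approx T e2.
have h : outer_content mu (S `|` T) <= inner_content mu (O `|` P).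
  by apply: outer_le; [exact: openU|move=> k [/SO|/TP]; [left|right]].
have := inner_setU oO oP; lra.
Qed.

(** For an open [W] containing [T], some closed [C] almost exhausts [W & O], while [W \ C] is an
    open set around [T \ O]; [inner_split] adds up the two contributions inside [W]. *)
Lemma splitting_open O : open O -> splitting O.
Proof.
move=> oO T; apply/eqP; rewrite eq_le; apply/andP; split.
  by rewrite -{1}(setUIDK T O); exact: outer_setU.
apply: outer_ge => W oW TW; apply/ler_addgt0Pr => e e0.
have [C [cC CWO hC]] := inner_approx (W `&` O) e0.
have h1 : outer_content mu (T `&` O) <= inner_content mu (W `&` O).
  by apply: outer_le; [exact: openI|exact: setSI].
have h2 : outer_content mu (T `\` O) <= inner_content mu (W `\` C).
  apply: outer_le; first by rewrite setDE; apply: openI => //; exact: closed_openC.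
  by move=> k [/TW kW kO]; split=> // /CWO[].
have CW : C `<=` W by move=> k /CWO[].
have := inner_split cC CW; lra.
Qed.

Lemma splitting_setC S : splitting S -> splitting (~` S).
Proof. by move=> h T; rewrite h addrC setDE setDE setCK. Qed.

Lemma splitting_setI S S' : splitting S -> splitting S' -> splitting (S `&` S').
Proof.
move=> h h' T; rewrite (h T) (h' (T `&` S)) -setIA -addrA; congr (_ + _).
rewrite (h (T `\` (S `&` S'))); congr (_ + _); congr outer_content.
  by apply/seteqP; split=> k /=; [move=> [[kT kS] kS']; split=> //; split=> // -[]|move=> [[kT h1] kS]; split=> // kS'; apply: h1].
by apply/seteqP; split=> k /=; [move=> [kT kS]; split=> //; split=> // -[]|move=> [[kT _] kS]].
Qed.

Lemma splitting_setD S S' : splitting S -> splitting S' -> splitting (S `\` S').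
Proof. by move=> h h'; rewrite setDE; apply: splitting_setI => //; exact: splitting_setC. Qed.

Lemma splitting_setU S S' : splitting S -> splitting S' -> splitting (S `|` S').
Proof.
move=> h h'; rewrite -[S]setCK -[S']setCK -setCI.
by apply: splitting_setC; apply: splitting_setI; exact: splitting_setC.
Qed.

Lemma outer_disj S T : splitting S -> S `&` T = set0 ->
  outer_content mu (S `|` T) = outer_content mu S + outer_content mu T.
Proof.
move=> h ST; rewrite h; congr (_ + _); congr outer_content.
  by apply/seteqP; split=> k; [case|move=> kS; split=> //; left].
apply/seteqP; split=> k; first by case=> -[].
by move=> kT; split; [right|move=> kS; rewrite -[False]/(set0 k) -ST].
Qed.

Lemma outer_setD S T : splitting T -> T `<=` S ->
  outer_content mu (S `\` T) = outer_content mu S - outer_content mu T.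
Proof. by move=> h TS; rewrite (h S) (setIidr TS) addrAC subrr add0r. Qed.

(** A closed subset of the union is compact, hence covered by finitely many of the [G n]: countable
    subadditivity comes from the topology and not from [mu]. *)
Lemma inner_bigcup_le (G : nat -> set K) (b : R) : (forall n, open (G n)) ->
  (forall m, \sum_(n < m) inner_content mu (G n) <= b) -> inner_content mu (\bigcup_n G n) <= b.
Proof.
move=> oG hb; apply: inner_le => C cC CG.
have [D CD] := compact_finite_cover (subclosed_compact cC compK (@subsetT _ _)) oG CG.
have fin m : inner_content mu (\bigcup_(n in [set n | (n < m)%N]) G n) <= \sum_(n < m) inner_content mu (G n).
  elim: m => [|m IH].
    rewrite big_ord0; apply: inner_le => E _ ES.
    by rewrite (_ : E = set0) ?content_set0 //; apply/seteqP; split=> k // /ES[].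
  rewrite big_ord_recr /=; apply: (@le_trans _ _ (inner_content mu (\bigcup_(n in [set n | (n < m)%N]) G n `|` G m))).
    apply: inner_mono => k [n /= nm Gk]; move: nm; rewrite ltnS leq_eqVlt => /predU1P[nE|nm].
      by right; rewrite -nE.
    by left; exists n.
  apply: le_trans (inner_setU _ (oG m)) _; first by apply: bigcup_open => n _; exact: oG.
  by rewrite lerD2r.
apply: le_trans (hb (\max_(n <- D) n.+1)%N); apply: le_trans (fin _).
apply: inner_ge => // k /CD[n /= nD Gk]; exists n => //=.
by rewrite (big_rem n) //= leq_max ltnSn.
Qed.

End OneFunctional.

Lemma posf_add mu nu : positive_functional mu -> positive_functional nu ->
  positive_functional (fun phi => mu phi + nu phi).
Proof.
move=> [a1 a2 a3] [b1 b2 b3]; split=> [phi psi h1 h2|a phi h|phi h h'].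
- by rewrite a1 // b1 // addrACA.
- by rewrite a2 // b2 // mulrDr.
- by rewrite addr_ge0 ?a3 ?b3.
Qed.

Lemma posf_scale (t : R) mu : 0 <= t -> positive_functional mu ->
  positive_functional (fun phi => t * mu phi).
Proof.
move=> t0 [a1 a2 a3]; split=> [phi psi h1 h2|a phi h|phi h h'].
- by rewrite a1 // mulrDr.
- by rewrite a2 // mulrCA.
- by rewrite mulr_ge0 ?a3.
Qed.

Lemma posf_dirac (k : K) : positive_functional (fun phi => phi k).
Proof. by split. Qed.

(** The union of a closed set nearly optimal for [mu] and one nearly optimal for [nu] is nearly
    optimal for both. *)
Lemma inner_contentD mu nu O : positive_functional mu -> positive_functional nu ->
  inner_content (fun phi => mu phi + nu phi) O = inner_content mu O + inner_content nu O.
Proof.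
move=> hm hn; have hs := posf_add hm hn.
apply/eqP; rewrite eq_le; apply/andP; split.
  by apply: inner_le => C cC CO; apply: lerD; apply: inner_ge.
apply/ler_addgt0Pr => e e0; have e2 : 0 < e / 2 by rewrite divr_gt0.
have [C [cC CO hC]] := inner_approx hm O e2; have [D [cD DO hD]] := inner_approx hn O e2.
have : content mu (C `|` D) + content nu (C `|` D) <= inner_content (fun phi => mu phi + nu phi) O.
  by apply: (inner_ge hs); [exact: closedU|move=> k [/CO|/DO]].
have : content mu C <= content mu (C `|` D) by apply: content_mono => // k; left.
have : content nu D <= content nu (C `|` D) by apply: content_mono => // k; right.
lra.
Qed.

End PositiveFunctionals.

#[global] Hint Resolve bounded_on_cst bounded_on_indic bounded_onD bounded_onZ : core.

(** * The quadratic form on measures and its deficit *)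

Section QuadraticForm.
Context {R : realType} {K : topologicalType}.
Variable cls : nat -> set (set K).
Hypothesis cls0 : forall n, cls n set0.
Hypothesis cls_all : forall C, closed C -> cls 0%N C.
Implicit Types (mu nu : (K -> R) -> R) (C : nat -> set K).

Definition weighted_sum (m : nat) C mu : R := \sum_(n < m) 2^-1 ^+ n * content mu (C n) ^+ 2.
(** The number [m] of terms is part of the supremum, so no series appears. For each choice of sets
    the weighted sum is the square of a Hilbertian seminorm; a supremum of these keeps the triangle
    inequality but not the parallelogram law. *)
Definition quadratic_form mu : R :=
  sup [set weighted_sum c.1 c.2 mu | c in [set c : nat * (nat -> set K) | forall n, cls n (c.2 n)]].
Local Notation q := quadratic_form.

Lemma half_sum_le2 (m : nat) : \sum_(n < m) 2^-1 ^+ n <= 2 :> R.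
Proof.
suff -> : \sum_(n < m) 2^-1 ^+ n = 2 - 2 * 2^-1 ^+ m :> R.
  by rewrite lerBlDr lerDl mulr_ge0 // exprn_ge0 // invr_ge0.
elim: m => [|m IH]; first by rewrite big_ord0 expr0 mulr1 subrr.
by rewrite big_ord_recr /= IH exprS; lra.
Qed.

Lemma weight_ge0 n : 0 <= 2^-1 ^+ n :> R.
Proof. by rewrite exprn_ge0 // invr_ge0. Qed.

Lemma weight_gt0 n : 0 < 2^-1 ^+ n :> R.
Proof. by rewrite exprn_gt0 // invr_gt0. Qed.

Lemma weighted_sum_mono m m' C mu : (m <= m')%N -> weighted_sum m C mu <= weighted_sum m' C mu.
Proof.
move=> /subnKC <-; rewrite /weighted_sum big_split_ord /= lerDl sumr_ge0 // => i _.
by rewrite mulr_ge0 ?weight_ge0 // sqr_ge0.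
Qed.

Section Bounds.
Variables (mu : (K -> R) -> R) (hmu : positive_functional mu).

Lemma weighted_sum_le m C : weighted_sum m C mu <= 2 * mass mu ^+ 2.
Proof.
apply: (@le_trans _ _ (\sum_(n < m) 2^-1 ^+ n * mass mu ^+ 2)).
  apply: ler_sum => n _; rewrite ler_wpM2l ?weight_ge0 // lerXn2r ?nnegrE //.
  - exact: content_ge0.
  - exact: mass_ge0.
  - exact: content_le_mass.
by rewrite -mulr_suml ler_wpM2r ?sqr_ge0 // half_sum_le2.
Qed.

Let qset := [set weighted_sum c.1 c.2 mu | c in [set c : nat * (nat -> set K) | forall n, cls n (c.2 n)]].
Let qne : qset !=set0.
Proof. by eexists; exists (0%N, fun=> set0). Qed.
Let qub : ubound qset (2 * mass mu ^+ 2).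
Proof. by move=> _ [c _ <-]; exact: weighted_sum_le. Qed.

Lemma quadratic_ge m C : (forall n, cls n (C n)) -> weighted_sum m C mu <= q mu.
Proof. by move=> h; apply: le_supP qub; exists (m, C). Qed.

Lemma quadratic_le b : (forall m C, (forall n, cls n (C n)) -> weighted_sum m C mu <= b) -> q mu <= b.
Proof. by move=> h; apply: sup_leP qne _ => _ [[m C] hC <-]; exact: h. Qed.

Lemma quadratic_approx b : b < q mu ->
  exists m C, (forall n, cls n (C n)) /\ b < weighted_sum m C mu.
Proof. by move=> /(sup_gtP qne qub)[_ [[m C] hC <-] h]; exists m, C. Qed.

Lemma quadratic_le_mass : q mu <= 2 * mass mu ^+ 2.
Proof. by apply: quadratic_le => m C _; exact: weighted_sum_le. Qed.

(** Class 0 contains the whole space and has weight 1; this is what lets the form control the mass,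
    and later the dual norm. *)
Lemma quadratic_ge_mass : mass mu ^+ 2 <= q mu.
Proof.
have := @quadratic_ge 1 (fun n => if n is 0%N then setT else set0).
rewrite /weighted_sum big_ord1 expr0 mul1r content_setT; apply => -[|n] //.
exact/cls_all/closedT.
Qed.

End Bounds.

Lemma quadraticZ t mu : positive_functional mu -> 0 <= t ->
  q (fun phi => t * mu phi) <= t ^+ 2 * q mu.
Proof.
move=> h t0; apply: quadratic_le => m C hC.
have -> : weighted_sum m C (fun phi => t * mu phi) = t ^+ 2 * weighted_sum m C mu.
  by rewrite /weighted_sum mulr_sumr; apply: eq_bigr => n _; rewrite /content; ring.
by rewrite ler_wpM2l ?sqr_ge0 // quadratic_ge.
Qed.

(** Termwise this is [(a + b)^2 <= (1 + s) a^2 + (1 + 1/s) b^2]. The parameter is kept free because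
    these inequalities are linear in the values of the form: they survive suprema and infima and can
    be added for [f] and [- f]. Only at the end does the best [s] turn them into a triangle
    inequality. *)
Lemma quadraticD mu nu s : positive_functional mu -> positive_functional nu -> 0 < s ->
  q (fun phi => mu phi + nu phi) <= (1 + s) * q mu + (1 + s^-1) * q nu.
Proof.
move=> hm hn s0; apply: quadratic_le => m C hC.
apply: (@le_trans _ _ ((1 + s) * weighted_sum m C mu + (1 + s^-1) * weighted_sum m C nu)).
  rewrite /weighted_sum !mulr_sumr -big_split /=; apply: ler_sum => n _.
  rewrite [X in _ <= X + _]mulrCA [X in _ <= _ + X]mulrCA -mulrDr ler_wpM2l ?weight_ge0 // /content.
  move: (mu _) (nu _) => a b; rewrite -subr_ge0.
  have -> : (1 + s) * a ^+ 2 + (1 + s^-1) * b ^+ 2 - (a + b) ^+ 2 = s^-1 * (s * a - b) ^+ 2.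
    by field; rewrite gt_eqF.
  by rewrite mulr_ge0 ?sqr_ge0 // invr_ge0 ltW.
have s1 : 0 <= s^-1 by rewrite invr_ge0 ltW.
by apply: lerD; rewrite ler_wpM2l ?quadratic_ge //; rewrite addr_ge0 // ltW.
Qed.

(** The slack in [quadraticD] at [s = 1]. *)
Definition deficit mu nu := 2 * q mu + 2 * q nu - q (fun phi => mu phi + nu phi).

(** Sets nearly optimal for [mu + nu] are chosen. For fixed sets the parallelogram law equates the
    slack with the weighted sum of the squares [(mu C_i - nu C_i)^2]; so these are small and the
    same sets are nearly optimal for [mu] and for [nu]. Exchanging only the set of index [n]
    localises the optimality to class [n]. *)
Lemma quadratic_deficit mu nu n d : positive_functional mu -> positive_functional nu ->
  deficit mu nu < d ->
  exists C : set K, [/\ cls n C, 2^-1 ^+ n * (content mu C - content nu C) ^+ 2 <= d,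
    forall D, cls n D -> 2^-1 ^+ n * content mu D ^+ 2 <= 2^-1 ^+ n * content mu C ^+ 2 + d
  & forall D, cls n D -> 2^-1 ^+ n * content nu D ^+ 2 <= 2^-1 ^+ n * content nu C ^+ 2 + d].
Proof.
move=> hm hn; rewrite /deficit => dd.
have hs := posf_add hm hn.
have [m0 [C [hC]]] : exists m C, (forall n, cls n (C n)) /\
    2 * q mu + 2 * q nu - d < weighted_sum m C (fun phi => mu phi + nu phi).
  by apply: (quadratic_approx hs); lra.
(* The sum is lengthened so as to include index [n], which can only increase it. *)
pose m := maxn m0 n.+1.
move=> /lt_le_trans/(_ (weighted_sum_mono C _ (leq_maxl m0 n.+1))); rewrite -/m => lt.
have nm : (n < m)%N by rewrite leq_max ltnSn orbT.
have id : 2 * weighted_sum m C mu + 2 * weighted_sum m C nu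
    - weighted_sum m C (fun phi => mu phi + nu phi)
    = \sum_(i < m) 2^-1 ^+ i * (content mu (C i) - content nu (C i)) ^+ 2.
  rewrite /weighted_sum !mulr_sumr -big_split /= -sumrB; apply: eq_bigr => i _.
  by rewrite /content; ring.
have qm := quadratic_ge hm m hC; have qn := quadratic_ge hn m hC.
have S0 : 0 <= \sum_(i < m) 2^-1 ^+ i * (content mu (C i) - content nu (C i)) ^+ 2.
  by apply: sumr_ge0 => i _; rewrite mulr_ge0 ?weight_ge0 // sqr_ge0.
have repl la D : positive_functional la -> cls n D -> q la <= weighted_sum m C la + d ->
    2^-1 ^+ n * content la D ^+ 2 <= 2^-1 ^+ n * content la (C n) ^+ 2 + d.
  move=> hl hD hq.
  pose C' i := if i == n then D else C i.
  have hC' i : cls i (C' i) by rewrite /C'; case: eqP => [->|].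
  have := quadratic_ge hl m hC'; move: hq; rewrite /weighted_sum.
  rewrite (bigD1 (Ordinal nm)) //= [X in _ -> X <= _ -> _](bigD1 (Ordinal nm)) //=.
  rewrite {1}/C' eqxx.
  have -> : \sum_(i < m | i != Ordinal nm) 2^-1 ^+ i * content la (C' i) ^+ 2
     = \sum_(i < m | i != Ordinal nm) 2^-1 ^+ i * content la (C i) ^+ 2.
    by apply: eq_bigr => i /negPf; rewrite -val_eqE /= /C' => ->.
  lra.
exists (C n); split=> //.
- have : 2^-1 ^+ n * (content mu (C n) - content nu (C n)) ^+ 2 <=
     \sum_(i < m) 2^-1 ^+ i * (content mu (C i) - content nu (C i)) ^+ 2.
    rewrite (bigD1 (Ordinal nm)) //= lerDl sumr_ge0 // => i _.
    by rewrite mulr_ge0 ?weight_ge0 // sqr_ge0.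
  lra.
- by move=> D hD; apply: repl => //; lra.
- by move=> D hD; apply: repl => //; lra.
Qed.

End QuadraticForm.

Section FiniteSums.
Context {R : realType} {J : choiceType} (v : J -> R).

Lemma fset_of_bounded (P : set J) (N : nat) :
  (forall D : {fset J}, (forall j, j \in D -> P j) -> (#|` D| <= N)%N) ->
  exists D : {fset J}, forall j, (j \in D) <-> P j.
Proof.
move=> h; have [fP|iP] := pselect (finite_set P).
  have [D PD] := finite_fsetP.1 fP.
  by exists D => j; rewrite PD.
have [D DP ND] := infinite_set_fset N.+1 iP.
by have := leq_trans ND (h D (fun j jD => DP j jD)); rewrite ltnn.
Qed.

(* The set [G] is the positive part of [v - c]. *)
Lemma fset_sum_positive_part (c : R) (D G : {fset J}) :
  (forall j, (j \in G) <-> c <= v j) ->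
  \sum_(j <- D) (v j - c) <= \sum_(j <- G) (v j - c).
Proof.
move=> hG; rewrite (big_fsetID _ (mem G)) /= [leRHS](big_fsetID _ (mem D)) /=.
have -> : [fset x in D | x \in G]%fset = [fset x in G | x \in D]%fset.
  by apply/fsetP => x; rewrite !inE andbC.
apply: lerD => //.
apply: (@le_trans _ _ 0).
  rewrite big_seq_cond sumr_le0 // => j; rewrite andbT !inE => /andP[_ /negP jG].
  by rewrite subr_le0 leNgt; apply/negP => /ltW /hG.
by rewrite big_seq_cond sumr_ge0 // => j; rewrite andbT !inE => /andP[/hG ? _]; rewrite subr_ge0.
Qed.

Lemma fset_sumB (c : R) (D : {fset J}) :
  \sum_(j <- D) (v j - c) = \sum_(j <- D) v j - #|` D|%:R * c.
Proof.
rewrite sumrB; congr (_ - _); rewrite big_const_seq count_predT iter_addr_0.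
by rewrite mulr_natl cardfE.
Qed.

(** Only finitely many values exceed [c / 2], so the largest one below [c] stays away from [c]. *)
Lemma threshold_gap (c : R) (G : {fset J}) : 0 < c ->
  (forall j, (j \in G) <-> c / 2 <= v j) ->
  exists2 c', 0 < c' < c & forall j, c' <= v j -> c <= v j.
Proof.
move=> c0 hG.
have [m [m1 m2 hm]] : exists m, [/\ c / 2 <= m, m < c &
    forall j, j \in (G : seq J) -> v j < c -> v j <= m].
  elim: (G : seq J) => [|i s [m [m1 m2 hm]]]; first by exists (c / 2); split=> //; lra.
  have [vi|vi] := ltP (v i) c.
    exists (Num.max m (v i)); split; rewrite ?le_max ?m1 // ?gt_max ?m2 // => j.
    rewrite inE le_max => /predU1P[->|js /(hm _ js) ->//]; first by rewrite lexx orbT.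
  exists m; split=> // j; rewrite inE => /predU1P[->|]; last exact: hm.
  by rewrite ltNge vi.
exists ((m + c) / 2) => [|j hj]; first by apply/andP; split; lra.
rewrite leNgt; apply/negP => lt.
have : v j <= m by apply: hm => //; apply/hG; lra.
lra.
Qed.

End FiniteSums.

(** * Strata, and convergence of their contents when the deficit tends to zero *)

Section Stratification.
Context {R : realType} {K : topologicalType} {I : countType} {J : choiceType}.
Variables (G : I -> set K) (V : I -> J -> set K).
Implicit Types (mu nu : (K -> R) -> R) (i : I) (j : J) (D : {fset J}).

(* For each [i], the sets [V i j] are pairwise disjoint and relatively open in
   the closed complement of the open set [G i]. *)
Definition stratification :=
  [/\ forall i, open (G i), forall i j, open (G i `|` V i j),
      forall i j, G i `&` V i j = set0
    & forall i j j', j <> j' -> V i j `&` V i j' = set0].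

Definition stratum_union i D := G i `|` \bigcup_(j in [set` D]) V i j.

(** Index 0 is kept for all closed sets, to control the mass; [n.+1] codes the family [i] and the
    number [k] of strata. Numbers that code no pair fall back to all closed sets. *)
Definition stratum_class (n : nat) : set (set K) :=
  if n is n.+1 then
    if (choice.unpickle n : option (I * nat)) is Some (i, k)
    then [set C | closed C /\ exists2 D, (#|` D| <= k)%N & C `<=` stratum_union i D]
    else [set C | closed C]
  else [set C | closed C].

Hypothesis hV : stratification.
Hypothesis compK : compact [set: K].
Hypothesis normK : normal_space K.

Let oG i : open (G i). Proof. by have [h _ _ _] := hV. Qed.
Let oGV i j : open (G i `|` V i j). Proof. by have [_ h _ _] := hV. Qed.
Let GV0 i j : G i `&` V i j = set0. Proof. by have [_ _ h _] := hV. Qed.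
Let VV0 i j j' : j <> j' -> V i j `&` V i j' = set0. Proof. by have [_ _ _ h] := hV; exact: h. Qed.

Lemma stratum_class0 n : stratum_class n set0.
Proof.
case: n => [|n] /=; first exact: closed0.
case: choice.unpickle => [[i k]|]; last exact: closed0.
by split; [exact: closed0|exists fset0].
Qed.

Lemma open_stratum_union i D : open (stratum_union i D).
Proof.
have -> : stratum_union i D = G i `|` \bigcup_(j in [set` D]) (G i `|` V i j).
  apply/seteqP; split=> k [Gk|[j jD Vk]]; [by left|by right; exists j => //; right|by left|].
  by case: Vk => [|Vk]; [left|right; exists j].
by apply: openU => //; apply: bigcup_open.
Qed.

Lemma stratum_union0 i : stratum_union i fset0 = G i.
Proof. by apply/seteqP; split=> k; [case=> // -[j]|left]. Qed.

Lemma stratum_unionU1 i j D : stratum_union i (j |` D)%fset = V i j `|` stratum_union i D.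
Proof.
apply/seteqP; split=> k.
  case=> [|[j' /= ]]; first by right; left.
  by rewrite in_fset1U => /predU1P[->|jD Vk]; [left|right; right; exists j'].
case=> [Vk|[Gk|[j' /= jD Vk]]]; [right; exists j|left|right; exists j'] => //=.
  by rewrite in_fset1U eqxx.
by rewrite in_fset1U jD orbT.
Qed.

Section Content.
Variables (mu : (K -> R) -> R) (hmu : positive_functional mu).
Local Notation E := (outer_content mu).

Lemma splitting_stratum i j : splitting mu (V i j).
Proof.
have -> : V i j = (G i `|` V i j) `\` G i.
  apply/seteqP; split=> k; last by move=> [[|]].
  by move=> Vk; split; [right|move=> Gk; rewrite -[False]/(set0 k) -(GV0 i j)].
by apply: splitting_setD => //; apply: splitting_open.
Qed.

Lemma outer_stratum_union i D : E (stratum_union i D) = E (G i) + \sum_(j <- D) E (V i j).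
Proof.
move: D; apply: finSet_rect => D IH.
have [->|[j jD]] := fset_0Vmem D; first by rewrite stratum_union0 big_seq_fset0 addr0.
have DE : D = (j |` (D `\ j))%fset by rewrite fsetD1K.
rewrite (big_fsetD1 j) //= {1}DE stratum_unionU1 outer_disj ?IH //.
- by rewrite addrCA.
- by apply: fproperD1.
- exact: splitting_stratum.
apply/seteqP; split=> k // [Vk [Gk|[j' /= ]]].
  by rewrite -(GV0 i j).
rewrite in_fsetD1 => /andP[/eqP jj' _] Vk'.
by rewrite -[False]/(set0 k) -(@VV0 i j' j jj').
Qed.

Lemma outer_stratum_union_approx S i k e : 0 < e ->
  (exists2 D : {fset J}, (#|` D| <= k)%N & S = stratum_union i D) ->
  exists C', [/\ stratum_class (choice.pickle (i, k)).+1 C', C' `<=` S & E S < content mu C' + e].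
Proof.
move=> e0 [D Dk ->]; have [C [cC CU hC]] := inner_approx hmu (stratum_union i D) e0.
exists C; split=> //; first by rewrite /= choice.pickleK; split=> //; exists D.
by rewrite (outer_open hmu (open_stratum_union i D)); move: hC; lra.
Qed.

End Content.

Local Notation q := (quadratic_form stratum_class : ((K -> R) -> R) -> R).
Local Notation deficit := (deficit stratum_class).

(** The nearly optimal closed set given by [quadratic_deficit] lies in some union of at most [k]
    strata. The point is that this union is one and the same for [mu] and [nu], so near-optimality
    can be transported from one to the other. *)
Lemma near_optimal_union i k (eta : R) : 0 < eta -> exists2 d : R, 0 < d &
  forall mu nu, positive_functional mu -> positive_functional nu -> deficit mu nu < d ->
  exists D, [/\ (#|` D| <= k)%N,
    forall D', (#|` D'| <= k)%N ->
      outer_content mu (stratum_union i D') <= outer_content mu (stratum_union i D) + eta,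
    forall D', (#|` D'| <= k)%N ->
      outer_content nu (stratum_union i D') <= outer_content nu (stratum_union i D) + eta
  & `|outer_content mu (stratum_union i D) - outer_content nu (stratum_union i D)| <= eta].
Proof.
move=> eta0; pose n := (choice.pickle (i, k)).+1; pose e := eta / 4.
have e0 : 0 < e by rewrite divr_gt0.
exists (2^-1 ^+ n * e ^+ 2) => [|mu nu hm hn hd]; first by rewrite mulr_gt0 ?weight_gt0 // exprn_gt0.
have [C [Cn hC hCm hCn]] := @quadratic_deficit _ _ _ stratum_class0 mu nu n _ hm hn hd.
have sq (a b : R) : 0 <= b -> 2^-1 ^+ n * a ^+ 2 <= 2^-1 ^+ n * b ^+ 2 + 2^-1 ^+ n * e ^+ 2 -> a <= b + e.
  move=> b0; rewrite -mulrDr ler_pM2l ?weight_gt0 // => h.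
  rewrite leNgt; apply/negP => h'; have : (b + e) ^+ 2 < a ^+ 2.
    by rewrite ltrXn2r // ?nnegrE //; lra.
  have : 0 <= b * e by rewrite mulr_ge0 // ltW.
  by move: h; rewrite sqrrD mulr2n; lra.
have abs : `|content mu C - content nu C| <= e.
  move: hC; rewrite ler_pM2l ?weight_gt0 // -[X in X <= _]real_normK ?num_real //.
  by rewrite ler_pXn2r ?nnegrE // ltW.
have [cC [D Dk CD]] : closed C /\ exists2 D, (#|` D| <= k)%N & C `<=` stratum_union i D.
  by move: Cn; rewrite /n /= choice.pickleK.
have near la D' : positive_functional la ->
    (forall D : set K, stratum_class n D -> 2^-1 ^+ n * content la D ^+ 2 <=
      2^-1 ^+ n * content la C ^+ 2 + 2^-1 ^+ n * e ^+ 2) ->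
    (#|` D'| <= k)%N ->
    outer_content la (stratum_union i D') <= content la C + 2 * e.
  move=> hl h D'k.
  have [C' [C'n C'D hC']] := @outer_stratum_union_approx la hl (stratum_union i D') i k e e0
    (ex_intro2 _ _ D' D'k erefl).
  have := sq _ _ (content_ge0 hl C) (h _ C'n); lra.
have low (la : (K -> R) -> R) : positive_functional la -> content la C <= outer_content la (stratum_union i D).
  by move=> hl; rewrite (outer_open hl (open_stratum_union i D)); exact: inner_ge.
have lm := low _ hm; have ln := low _ hn.
have um := near _ D hm hCm Dk; have un := near _ D hn hCn Dk.
exists D; split=> //.
- by move=> D' /(near _ _ hm hCm); rewrite /e; lra.
- by move=> D' /(near _ _ hn hCn); rewrite /e; lra.
- move: abs; rewrite !ler_norml => /andP[h1 h2]; apply/andP.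
  by move: lm ln um un h1 h2; rewrite /e => *; split; lra.
Qed.

Section Limit.
Variables (mu : (K -> R) -> R) (hmu : positive_functional mu).
Local Notation E := (outer_content mu).
Variable i : I.
Let v j := E (V i j).
Let v_ge0 j : 0 <= v j. Proof. exact: outer_ge0. Qed.

(** Disjoint strata of content at least [c] number at most [mass mu / c]. *)
Let superlevel_fset (c : R) : 0 < c -> exists D : {fset J}, forall j, (j \in D) <-> c <= v j.
Proof.
move=> c0; apply: (@fset_of_bounded _ _ (Num.Def.trunc (mass mu / c))) => D hD.
rewrite truncn_ge_nat; last by rewrite divr_ge0 ?mass_ge0 // ltW.
rewrite ler_pdivlMr //.
apply: (@le_trans _ _ (E (stratum_union i D))); last first.
  by rewrite -outer_setT // outer_mono.
rewrite outer_stratum_union //; apply: (@le_trans _ _ (\sum_(j <- D) v j)); last first.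
  by rewrite lerDr outer_ge0.
rewrite -subr_ge0 -fset_sumB big_seq_cond sumr_ge0 // => j; rewrite andbT => /hD.
by rewrite subr_ge0.
Qed.

(** With [k] the size of [D], the gap below [c] makes [D] the only nearly optimal choice for [mu]: a
    set of at most [k] indices missing some member of [D] loses at least [c - c']. Hence the set
    common to [mu] and [nu] is [D] itself, and the two contents of its union are close. *)
Let content_superlevel (c eta : R) D : 0 < c -> 0 < eta -> (forall j, (j \in D) <-> c <= v j) ->
  exists2 d : R, 0 < d & forall nu, positive_functional nu -> deficit mu nu < d ->
    `|E (stratum_union i D) - outer_content nu (stratum_union i D)| <= eta.
Proof.
move=> c0 eta0 hD; have c20 : 0 < c / 2 by rewrite divr_gt0.
have [D2 hD2] := superlevel_fset c20.
have [c' /andP[c'0 c'c] hc'] := threshold_gap c0 hD2.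
pose eta' := Num.min eta ((c - c') / 2).
have eta'0 : 0 < eta' by rewrite lt_min eta0 divr_gt0 // subr_gt0.
have [d d0 hd] := near_optimal_union i #|` D| eta'0.
exists d => // nu hn /(hd _ _ hmu hn)[D' [D'k opt _ ab]].
suff DD' : D' = D by rewrite DD' in ab; apply: le_trans ab _; rewrite ge_min lexx.
apply/eqP; rewrite eq_sym eqEfcard D'k andbT; apply/fsubsetP => j jD; apply: contraT => jD'.
have hD' j' : (j' \in D) <-> c' <= v j'.
  split=> [/hD|/hc'/hD//]; apply: le_trans; exact: ltW.
have := fset_sum_positive_part (j |` D')%fset hD'.
rewrite big_fsetU1 //= !fset_sumB; have /hD vj := jD.
have := opt D (leqnn _); rewrite !outer_stratum_union //.
have cd : (#|` D'|%:R : R) * c' <= #|` D|%:R * c' by rewrite ler_wpM2r ?ler_nat // ltW.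
have : eta' <= (c - c') / 2 by rewrite ge_min lexx orbT.
rewrite -/(v _); move: (\sum_(_ <- _) _) => S'; move: (\sum_(_ <- _) _) => S.
lra.
Qed.

Let content_optimum k (eta : R) : 0 < eta ->
  exists2 d : R, 0 < d & forall nu, positive_functional nu -> deficit mu nu < d ->
    forall D', (#|` D'| <= k)%N -> exists2 D, (#|` D| <= k)%N &
      outer_content nu (stratum_union i D') <= E (stratum_union i D) + eta.
Proof.
move=> eta0; have e2 : 0 < eta / 2 by rewrite divr_gt0.
have [d d0 hd] := near_optimal_union i k e2.
exists d => // nu hn /(hd _ _ hmu hn)[D [Dk _ opt ab]] D' D'k; exists D => //.
have := opt D' D'k; move: ab; rewrite ler_norml => /andP[]; lra.
Qed.

(** Let [D] be the indices of content at least [v j]. The union over [D] has almost the same content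
    for [nu] as for [mu]. Without [j], its content for [nu] is at most the optimum for [mu] with one
    index fewer, which is at most the full sum less [v j]. The difference bounds stratum [j] from
    below. *)
Lemma content_stratum_ge j (eta : R) : 0 < eta ->
  exists2 d : R, 0 < d & forall nu, positive_functional nu -> deficit mu nu < d ->
    E (V i j) - eta <= outer_content nu (V i j).
Proof.
move=> eta0; have e2 : 0 < eta / 2 by rewrite divr_gt0.
have [v0|v0] := leP (v j) 0.
  exists 1 => // nu hn _; apply: le_trans (outer_ge0 hn _).
  by rewrite -/(v j); lra.
have [D hD] := superlevel_fset v0.
have [d1 d10 h1] := content_superlevel v0 e2 hD.
have [d2 d20 h2] := content_optimum #|` D `\ j|%fset e2.
exists (Num.min d1 d2) => [|nu hn]; first by rewrite lt_min d10.
rewrite lt_min => /andP[/(h1 _ hn) ab /(h2 _ hn)/(_ _ (leqnn _))[D' D'k le]].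
have jD : j \in D by apply/hD.
have DE : D = (j |` (D `\ j))%fset by rewrite fsetD1K.
have nuE : outer_content nu (stratum_union i D) =
    outer_content nu (V i j) + outer_content nu (stratum_union i (D `\ j)%fset).
  by rewrite !outer_stratum_union // (big_fsetD1 j) //= addrCA.
have sp := fset_sum_positive_part D' hD; rewrite !fset_sumB in sp.
have cd : (#|` D'|%:R : R) * v j <= (#|` D|%:R - 1) * v j.
  rewrite ler_wpM2r //.
  by rewrite lerBrDr natr1 ler_nat (cardfsD1 j D) jD add1n ltnS.
move: ab; rewrite ler_norml => /andP[ab1 ab2].
move: le ab1 ab2; rewrite nuE !outer_stratum_union // -/(v j).
move: sp cd; rewrite -/v.
move: (\sum_(_ <- D') _) => S'; move: (\sum_(_ <- D) _) => S; move: (outer_content nu (V i j)) => x.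
move: (\sum_(_ <- _) _) => S''.
lra.
Qed.

(** The threshold is now slightly above [v j], so [j] is outside [D]. Adding [j] gives a union whose
    content for [nu] is at most the optimum for [mu] with one index more, and by
    [fset_sum_positive_part] that extra index gains at most the threshold. *)
Lemma content_stratum_le j (eta : R) : 0 < eta ->
  exists2 d : R, 0 < d & forall nu, positive_functional nu -> deficit mu nu < d ->
    outer_content nu (V i j) <= E (V i j) + eta.
Proof.
move=> eta0; have e3 : 0 < eta / 3 by rewrite divr_gt0.
have c0 : 0 < v j + eta / 3 by rewrite ltr_wpDl.
have [D hD] := superlevel_fset c0.
have [d1 d10 h1] := content_superlevel c0 e3 hD.
have [d2 d20 h2] := content_optimum #|` j |` D|%fset e3.
exists (Num.min d1 d2) => [|nu hn]; first by rewrite lt_min d10.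
rewrite lt_min => /andP[/(h1 _ hn) ab /(h2 _ hn)/(_ _ (leqnn _))[D' D'k le]].
have jD : j \notin D by apply/negP => /hD; lra.
have nuE : outer_content nu (stratum_union i (j |` D)%fset) =
    outer_content nu (V i j) + outer_content nu (stratum_union i D).
  by rewrite !outer_stratum_union // big_fsetU1 //= addrCA.
have sp := fset_sum_positive_part D' hD; rewrite !fset_sumB in sp.
have cd : (#|` D'|%:R : R) * (v j + eta / 3) <= (#|` D|%:R + 1) * (v j + eta / 3).
  rewrite ler_wpM2r ?(ltW c0) // natr1 ler_nat; apply: leq_trans D'k _.
  by rewrite cardfsU1 jD add1n.
move: ab; rewrite ler_norml => /andP[ab1 ab2].
move: le ab1 ab2; rewrite nuE !outer_stratum_union // -/(v j).
move: sp cd; rewrite -/v.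
move: (\sum_(_ <- D') _) => S'; move: (\sum_(_ <- D) _) => S; move: (outer_content nu (V i j)) => x.
move: (\sum_(_ <- _) _) => S''.
lra.
Qed.

Lemma content_stratum_cvg j (eta : R) : 0 < eta ->
  exists2 d : R, 0 < d & forall nu, positive_functional nu -> deficit mu nu < d ->
    `|outer_content nu (V i j) - E (V i j)| <= eta.
Proof.
move=> eta0; have [d1 d10 h1] := content_stratum_ge j eta0.
have [d2 d20 h2] := content_stratum_le j eta0.
exists (Num.min d1 d2) => [|nu hn]; first by rewrite lt_min d10.
rewrite lt_min => /andP[/(h1 _ hn) ? /(h2 _ hn) ?].
by rewrite ler_norml; apply/andP; split; lra.
Qed.

End Limit.
End Stratification.

(** * From inequalities on closed and open sets to integrals of continuous functions *)

Section Portmanteau.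
Context {R : realType} {K : topologicalType} {T : Type} (F : set_system T).
Context {FF : ProperFilter F}.
Variables (mu : (K -> R) -> R) (nu : T -> (K -> R) -> R).
Hypotheses (hmu : positive_functional mu) (hnu : forall t, positive_functional (nu t)).
Hypothesis port : forall (C W : set K) (d : R), closed C -> open W -> C `<=` W -> 0 < d ->
  \forall t \near F, content mu C <= inner_content (nu t) W + d.
Hypothesis mass_cvg : (fun t => mass (nu t)) @ F --> mass mu.

Lemma posf_sum (la : (K -> R) -> R) (m : nat) (phi : nat -> K -> R) : positive_functional la ->
  (forall n, bounded_on (phi n)) ->
  bounded_on (fun k => \sum_(n < m) phi n k) /\
  la (fun k => \sum_(n < m) phi n k) = \sum_(n < m) la (phi n).
Proof.
move=> hl hb; elim: m => [|m [IHb IH]].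
  under eq_fun do rewrite big_ord0.
  by split=> //; rewrite big_ord0 (mu_cst hl 0) mul0r.
under eq_fun do rewrite big_ord_recr /=.
split; first by apply: bounded_onD.
by have [h _ _] := hl; rewrite h // IH big_ord_recr.
Qed.

Lemma step_sum_ge (h x : R) (m : nat) : 0 <= h -> 0 <= x ->
  Num.min x (m%:R * h) <= \sum_(n < m) h * (n%:R * h <= x)%R%:R.
Proof.
move=> h0 x0; elim: m => [|m IH]; first by rewrite big_ord0 mul0r ge_min lexx orbT.
rewrite big_ord_recr /= -natr1 mulrDl mul1r.
have [le|lt] := leP (m%:R * h) x.
  rewrite mulr1; move: IH; rewrite (min_idPr _) // => IH.
  by rewrite ge_min (lerD IH) // orbT.
rewrite mulr0 addr0; apply: le_trans IH; rewrite le_min ge_min lexx /= ge_min.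
by rewrite (ltW lt) .
Qed.

Lemma step_sum_le (h x : R) (m : nat) : 0 <= h -> 0 <= x ->
  \sum_(n < m) h * (n.+1%:R * h <= x)%R%:R <= Num.min x (m%:R * h).
Proof.
move=> h0 x0; elim: m => [|m IH]; first by rewrite big_ord0 mul0r le_min x0 lexx.
rewrite big_ord_recr /= -[in leRHS]natr1 mulrDl mul1r; move: IH; rewrite !le_min => /andP[IH1 IH2].
have [le|lt] := leP (m.+1%:R * h) x.
  rewrite mulr1 (lerD IH2) // andbT; apply: le_trans le.
  by rewrite -natr1 mulrDl mul1r lerD.
by rewrite mulr0 addr0 IH1 /=; apply: le_trans IH2 _; rewrite lerDl.
Qed.

(** [phi] lies between step functions of mesh [h] over its superlevel sets [A n]. The open set
    [phi > (n + 1) h] lies between [A n.+2] and [A n.+1], so [port] compares [mu] on the former with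
    [nu t] on the latter; the shift by two levels telescopes to at most [h] times twice the mass. *)
Lemma posf_lower (phi : K -> R) (c : R) : continuous phi -> 0 < c ->
  (forall k, 0 <= phi k <= c) -> forall e, 0 < e ->
  \forall t \near F, mu phi <= nu t phi + e.
Proof.
move=> cphi c0 hphi e e0.
have M0 := mass_ge0 hmu.
(* Two errors of at most [c * e'] arise: the level shift, once [m] exceeds twice the mass over [e'],
   and the [m] uses of [port] with weight [h = c / m]. *)
pose e' := e / (2 * c + 2).
have c2 : 0 < 2 * c + 2 by lra.
have e'0 : 0 < e' by rewrite divr_gt0.
pose m := (Num.trunc (2 * mass mu / e')).+1.
have m0 : 0 < m%:R :> R by rewrite ltr0n.
have mE : 2 * mass mu <= e' * m%:R.
  rewrite -ler_pdivrMl // mulrC; apply: ltW; have := @truncnS_gt R (2 * mass mu / e'); exact.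
pose h := c / m%:R.
have h0 : 0 < h by rewrite divr_gt0.
have mh : m%:R * h = c by rewrite mulrC divfK // gt_eqF.
pose A (n : nat) := [set k | n%:R * h <= phi k].
have bphi : bounded_on phi.
  by exists c => k; have /andP[h1 h2] := hphi k; rewrite ger0_norm.
have indA n k : (\1_(A n) k : R) = ((n%:R * h <= phi k)%R : bool)%:R.
  by rewrite indicE; congr (nat_of_bool _)%:R; apply/idP/idP => [/set_mem//|?]; exact: mem_set.
have upper (la : (K -> R) -> R) : positive_functional la -> la phi <= \sum_(n < m) h * content la (A n).
  move=> hl; have [b E] := posf_sum m hl (fun n => bounded_onZ h (bounded_on_indic (A n))).
  have -> : \sum_(n < m) h * content la (A n) = la (fun k => \sum_(n < m) h * \1_(A n) k).
    by rewrite E; apply: eq_bigr => n _; have [_ hz _] := hl; rewrite hz.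
  apply: posf_le => // k; under eq_bigr do rewrite indA.
  have /andP[h1 h2] := hphi k.
  by have := step_sum_ge m (ltW h0) h1; rewrite mh (min_idPl h2).
have lower (la : (K -> R) -> R) : positive_functional la -> \sum_(n < m) h * content la (A n.+1) <= la phi.
  move=> hl; have [b E] := posf_sum m hl (fun n => bounded_onZ h (bounded_on_indic (A n.+1))).
  have -> : \sum_(n < m) h * content la (A n.+1) = la (fun k => \sum_(n < m) h * \1_(A n.+1) k).
    by rewrite E; apply: eq_bigr => n _; have [_ hz _] := hl; rewrite hz.
  apply: posf_le => // k; under eq_bigr do rewrite indA.
  have /andP[h1 h2] := hphi k.
  by have := step_sum_le m (ltW h0) h1; rewrite mh (min_idPl h2).
have clA n : closed (A n).
  apply: (@closed_comp _ _ phi [set x | n%:R * h <= x]) => //; exact: closed_ge.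
have stepH n : \forall t \near F, content mu (A n.+2) <= content (nu t) (A n.+1) + e'.
  have : \forall t \near F, content mu (A n.+2) <= inner_content (nu t) [set k | n.+1%:R * h < phi k] + e'.
    apply: port => //.
      by apply: (@open_comp _ _ phi [set x | n.+1%:R * h < x]) => //; exact: open_gt.
    by move=> k /=; apply: lt_le_trans; rewrite ltr_pM2r // ltr_nat.
  apply: filterS => t /le_trans; apply; rewrite lerD2r.
  by apply: inner_le => C _ hC; apply: content_mono => // k /hC /ltW.
have allH : \forall t \near F, forall n, (n < m)%N -> content mu (A n.+2) <= content (nu t) (A n.+1) + e'.
  suff : forall m', \forall t \near F, forall n, (n < m')%N -> content mu (A n.+2) <= content (nu t) (A n.+1) + e' by apply.
  elim=> [|m' IH]; first by apply: nearW.
  apply: filterS2 IH (stepH m') => t IH s n; rewrite ltnS leq_eqVlt => /predU1P[->//|]; exact: IH.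
apply: filterS allH => t H.
apply: le_trans (upper _ hmu) _.
have b1 : \sum_(n < m) h * content mu (A n) <= h * (2 * mass mu) + \sum_(n < m) h * content mu (A n.+2).
  rewrite -!mulr_sumr -mulrDr ler_pM2l //.
  have tel : \sum_(n < m) content mu (A n) - \sum_(n < m) content mu (A n.+2) =
     content mu (A 0%N) + content mu (A 1%N) - content mu (A m) - content mu (A m.+1).
    elim: (m) => [|m' IH]; first by rewrite !big_ord0; lra.
    rewrite !big_ord_recr /=; lra.
  have := content_le_mass hmu (A 0%N); have := content_le_mass hmu (A 1%N).
  have := content_ge0 hmu (A m); have := content_ge0 hmu (A m.+1).
  lra.
have b2 : \sum_(n < m) h * content mu (A n.+2) <= \sum_(n < m) h * content (nu t) (A n.+1) + c * e'.
  have -> : c * e' = \sum_(n < m) h * e'.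
    by rewrite sumr_const card_ord -mulr_natl mulrA mh.
  by rewrite -big_split /=; apply: ler_sum => n _; rewrite -mulrDr ler_pM2l // H.
have b3 := lower _ (hnu t).
have b4 : h * (2 * mass mu) <= c * e'.
  have -> : c * e' = h * (e' * m%:R) by rewrite -mh; ring.
  by rewrite ler_pM2l.
have b5 : e = (2 * c + 2) * e' by rewrite mulrC divfK // gt_eqF.
lra.
Qed.

(** The one-sided bound is applied to [phi] and [- phi], both made nonnegative by adding [c']; the
    added constants are compared through the masses. *)
Lemma posf_cvg (phi : K -> R) (c : R) : continuous phi ->
  (forall k, `|phi k| <= c) -> (fun t => nu t phi) @ F --> mu phi.
Proof.
move=> cphi hphi; apply/cvgrPdist_le => e e0.
have e2 : 0 < e / 2 by rewrite divr_gt0.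
pose c' := `|c| + 1.
have c'0 : 0 < c' by rewrite ltr_wpDl.
have hc k : - c' <= phi k <= c'.
  by rewrite -ler_norml; apply: le_trans (hphi k) _; rewrite /c'; have := ler_norm c; lra.
have bphi : bounded_on phi by exists c.
have shift (la : (K -> R) -> R) s : positive_functional la -> la (fun k => s * phi k + c') = s * la phi + c' * mass la.
  by move=> hl; have [h1 h2 _] := hl; rewrite h1 // ?h2 // ?(mu_cst hl) //; exact: bounded_onZ.
have c2 : 0 < 2 * c' by lra.
have cont s : continuous (fun k => s * phi k + c').
  by move=> k; apply: cvgD; [apply: cvgMr; exact: cphi|exact: cvg_cst].
have h1 : \forall t \near F, mu (fun k => 1 * phi k + c') <= nu t (fun k => 1 * phi k + c') + e / 2.
  apply: posf_lower c2 _ _ e2 => // k; have /andP[] := hc k; lra.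
have h2 : \forall t \near F, mu (fun k => (-1) * phi k + c') <= nu t (fun k => (-1) * phi k + c') + e / 2.
  apply: posf_lower c2 _ _ e2 => // k; have /andP[] := hc k; lra.
have e2c : 0 < e / (2 * c') by rewrite divr_gt0.
move/cvgrPdist_le/(_ _ e2c): mass_cvg; apply: filterS3 h1 h2 => t.
rewrite !shift // => h1 h2 h3.
have h4 : c' * `|mass mu - mass (nu t)| <= e / 2.
  rewrite -ler_pdivlMl //; apply: le_trans h3 _; rewrite invfM [leRHS]mulrC -!mulrA.
  by rewrite [2^-1 * _]mulrC.
have /andP[h5 h6] : - (e / 2) <= c' * (mass mu - mass (nu t)) <= e / 2.
  by rewrite -ler_norml normrM gtr0_norm.
rewrite ler_norml; apply/andP; split; lra.
Qed.

End Portmanteau.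

(** * Comparing measures through the contents of the strata *)

Section Strata.
Context {R : realType} {K : topologicalType} {I : countType} {J : choiceType}.
Variables (G : I -> set K) (V : I -> J -> set K).
Hypothesis hV : stratification G V.
Hypothesis compK : compact [set: K].
Hypothesis normK : normal_space K.
Implicit Types (mu : (K -> R) -> R) (i : I) (j : J).

Let oG i : open (G i). Proof. by have [h _ _ _] := hV. Qed.
Let oGV i j : open (G i `|` V i j). Proof. by have [_ h _ _] := hV. Qed.
Let GV0 i j : G i `&` V i j = set0. Proof. by have [_ _ h _] := hV. Qed.
Let VV0 i j j' : j <> j' -> V i j `&` V i j' = set0. Proof. by have [_ _ _ h] := hV; exact: h. Qed.

(* Egorov-type statement: up to small measure all strata are clopen. *)
Lemma strata_clopen_core mu (d : R) : positive_functional mu -> 0 < d ->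
  exists L : set K, [/\ closed L, inner_content mu (~` L) <= d
    & forall i j, closed (V i j `&` L) /\ closed (L `\` V i j)].
Proof.
move=> hmu d0.
pose O i := G i `|` \bigcup_j V i j.
have oO i : open (O i).
  have -> : O i = G i `|` \bigcup_j (G i `|` V i j).
    apply/seteqP; split=> k [Gk|[j jD Vk]]; [by left|by right; exists j => //; right|by left|].
    by case: Vk => [|Vk]; [left|right; exists j].
  by apply: openU => //; apply: bigcup_open.
have cut (W : set K) (e : R) : open W -> 0 < e ->
    exists Q, [/\ closed Q, Q `<=` W & inner_content mu (W `\` Q) <= e].
  move=> oW e0; have [Q [cQ QW hQ]] := inner_approx hmu W e0.
  exists Q; split=> //; have := inner_split hmu cQ QW; lra.
(* Outside a small open [P n], both [G i] and the union [O i] of [G i] with its strata coincide with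
   closed sets. On [L] they are therefore clopen, and so is each stratum: its complement in [O i] is
   open, and it is relatively open off [G i]. *)
have ex n : exists P : set K, [/\ open P, inner_content mu P <= d / 2 * 2^-1 ^+ n &
    forall i, choice.unpickle n = Some i -> exists Q Q', [/\ closed Q, closed Q', Q `<=` G i, Q' `<=` O i
       & G i `\` Q `<=` P /\ O i `\` Q' `<=` P]].
  have e0 : 0 < d / 4 * 2^-1 ^+ n by rewrite mulr_gt0 ?weight_gt0 // divr_gt0.
  case E : (choice.unpickle n) => [i|]; last first.
    exists set0; split=> //; first exact: open0.
    apply: inner_le => C _; rewrite subset0 => ->; rewrite content_set0 //.
    by rewrite mulr_ge0 ?weight_ge0 // divr_ge0 // ltW.
  have [Q [cQ QG hQ]] := cut _ _ (oG i) e0; have [Q' [cQ' QO hQ']] := cut _ _ (oO i) e0.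
  have o1 : open (G i `\` Q) by rewrite setDE; apply: openI => //; exact: closed_openC.
  have o2 : open (O i `\` Q') by rewrite setDE; apply: openI => //; exact: closed_openC.
  exists ((G i `\` Q) `|` (O i `\` Q')); split.
  - exact: openU.
  - have := inner_setU hmu normK o1 o2; lra.
  - by move=> _ [<-]; exists Q, Q'; split=> //.
have [P hP] := choice ex.
have oP : open (\bigcup_n P n) by apply: bigcup_open => n _; have [] := hP n.
pose L := ~` (\bigcup_n P n).
exists L; split; first by apply: open_closedC.
  rewrite /L setCK; apply: inner_bigcup_le => // [n|m]; first by have [] := hP n.
  apply: (@le_trans _ _ (\sum_(n < m) d / 2 * 2^-1 ^+ n)).
    by apply: ler_sum => n _; have [] := hP n.
  by rewrite -mulr_sumr -[leRHS](@divfK _ 2) // ler_wpM2l ?half_sum_le2 // divr_ge0 // ltW.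
move=> i j; have [_ _ /(_ i (choice.pickleK i))] := hP (choice.pickle i).
set n := choice.pickle i.
move=> [Q [Q' [cQ cQ' QG QO [GP OP]]]].
have cL : closed L by exact: open_closedC.
have LP k : L k -> ~ P n k by move=> h Pk; apply: h; exists n.
split.
- have -> : V i j `&` L = L `&` (Q' `&` ~` (G i `|` \bigcup_(j' in [set j' | j' <> j]) (G i `|` V i j'))).
    apply/seteqP; split=> k.
      move=> [Vk Lk]; split=> //; split.
        apply: contrapT => Qk; apply: (LP k Lk); apply: OP; split=> //.
        by right; exists j.
      move=> [Gk|[j' /= jj' [Gk|Vk']]].
      - by rewrite -[False]/(set0 k) -(GV0 i j).
      - by rewrite -[False]/(set0 k) -(GV0 i j).
      - by rewrite -[False]/(set0 k) -(@VV0 i j' j).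
    move=> [Lk [/QO [Gk|[j' _ Vk]] nk]]; first by case: nk; left.
    split=> //; have [<-//|jj'] := pselect (j' = j).
    by case: nk; right; exists j' => //; right.
  apply: closedI => //; apply: closedI => //; apply: open_closedC.
  by apply: openU => //; apply: bigcup_open.
- have -> : L `\` V i j =
     L `&` (~` (G i `|` V i j) `|` Q).
    apply/seteqP; split=> k.
      move=> [Lk Vk]; split=> //; have [Gk|Gk] := pselect (G i k); last by left; move=> [].
      right; apply: contrapT => Qk; apply: (LP k Lk); exact: GP.
    move=> [Lk [h|/QG Gk]]; split=> // Vk; first by apply: h; right.
    by rewrite -[False]/(set0 k) -(GV0 i j).
  by apply: closedI => //; apply: closedU => //; exact: open_closedC.
Qed.

(** Intersections are needed so that convergence on strata passes to their Boolean combinations, by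
    subtraction; the full space is included to obtain the masses. *)
Definition strata_cap_closed :=
  (exists i j, V i j = setT) /\
  forall i j i' j', exists i'' j'', V i j `&` V i' j' = V i'' j''.
Hypothesis capV : strata_cap_closed.

Section Limits.
Context {T : Type} (F : set_system T) {FF : ProperFilter F}.
Variables (mu : (K -> R) -> R) (nu : T -> (K -> R) -> R).
Hypotheses (hmu : positive_functional mu) (hnu : forall t, positive_functional (nu t)).
Hypothesis cvgV : forall i j, (fun t => outer_content (nu t) (V i j)) @ F --> outer_content mu (V i j).

Let conv S := (fun t => outer_content (nu t) S) @ F --> outer_content mu S.
(** Convergence is required on all traces on strata, which makes the property stable under cutting
    by a further stratum. That on [S] itself is the trace on the stratum [setT]. *)
Let good S := (forall la, positive_functional la -> @splitting R K la S) /\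
  forall i j, conv (S `&` V i j).

Let good_setT : good setT.
Proof.
split=> [la hl|i j]; last by rewrite setTI; exact: cvgV.
by apply: splitting_open => //; exact: openT.
Qed.

Let good_conv S : good S -> conv S.
Proof. by move=> [_ h]; have [[i [j E]] _] := capV; have := h i j; rewrite E setIT. Qed.

Let good_setI S i j : good S -> good (S `&` V i j).
Proof.
move=> [h1 h2]; split=> [la hl|i' j'].
  by apply: splitting_setI => //; [exact: h1|exact: splitting_stratum hV normK la hl i j].
by rewrite -setIA; have [_ /(_ i j i' j')[i'' [j'' ->]]] := capV.
Qed.

Let good_setD S i j : good S -> good (S `\` V i j).
Proof.
move=> hS; have [h1 h2] := hS; have [_ h3] := good_setI i j hS; split=> [la hl|i' j'].
  by apply: splitting_setD => //; [exact: h1|exact: splitting_stratum hV normK la hl i j].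
have E (la : (K -> R) -> R) : positive_functional la -> outer_content la ((S `\` V i j) `&` V i' j') =
    outer_content la (S `&` V i' j') - outer_content la (S `&` V i j `&` V i' j').
  move=> hl; rewrite -outer_setD //.
  - congr outer_content; apply/seteqP; split=> k.
      by move=> [[Sk Vk] Vk']; split=> // -[[]].
    by move=> [[Sk Vk'] nk]; split=> //; split=> // Vk; apply: nk.
  - apply: splitting_setI => //; last exact: splitting_stratum hV normK la hl i' j'.
    by apply: splitting_setI => //; [exact: h1|exact: splitting_stratum hV normK la hl i j].
  - by move=> k [[]].
rewrite /conv E //; under eq_fun do rewrite E //.
by apply: cvgB; [exact: h2|exact: h3].
Qed.

Let good_setU S S' : good S -> good S' -> S `&` S' = set0 -> good (S `|` S').
Proof.
move=> [h1 h2] [h1' h2'] SS'; split=> [la hl|i j].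
  by apply: splitting_setU; [exact: h1|exact: h1'].
have E (la : (K -> R) -> R) : positive_functional la -> outer_content la ((S `|` S') `&` V i j) =
    outer_content la (S `&` V i j) + outer_content la (S' `&` V i j).
  move=> hl; rewrite setIUl outer_disj //.
    by apply: splitting_setI; [exact: h1|exact: splitting_stratum hV normK la hl i j].
  by rewrite setIACA SS' set0I.
rewrite /conv E //; under eq_fun do rewrite E //.
by apply: cvgD; [exact: h2|exact: h2'].
Qed.

(** Predicates on this bit vector describe the members of the finite Boolean algebra generated by
    the strata listed in [vs]. *)
Definition stratum_pattern (vs : seq (I * J)) (k : K) := [seq `[< V p.1 p.2 k >] | p <- vs].

Let good_pattern (vs : seq (I * J)) (Pi : seq bool -> Prop) S : good S ->
  good (S `&` [set k | Pi (stratum_pattern vs k)]).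
Proof.
elim: vs Pi S => [|[i j] vs IH] Pi S hS /=.
  have [h|h] := pselect (Pi [::]).
    by have -> : S `&` [set k | Pi (stratum_pattern [::] k)] = S by apply/seteqP; split=> k // [].
  have -> : S `&` [set k | Pi (stratum_pattern [::] k)] = (S `&` set0) by apply/seteqP; split=> k // [].
  rewrite setI0; have := good_setT => -[h1 h2]; split=> [la hl|i j].
    by apply: splitting_open => //; exact: open0.
  have E (la : (K -> R) -> R) : positive_functional la -> outer_content la (set0 `&` V i j) = 0.
    move=> hl; rewrite set0I outer_open //; last exact: open0.
    apply/eqP; rewrite eq_le inner_ge0 // andbT; apply: inner_le => C _.
    by rewrite subset0 => ->; rewrite content_set0.
  by rewrite /conv E //; under eq_fun do rewrite E //; exact: cvg_cst.
have -> : S `&` [set k | Pi (stratum_pattern ((i, j) :: vs) k)] =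
   (S `&` V i j) `&` [set k | Pi (true :: stratum_pattern vs k)] `|`
   (S `\` V i j) `&` [set k | Pi (false :: stratum_pattern vs k)].
  apply/seteqP; split=> k /=.
    move=> [Sk]; have [Vk|Vk] := pselect (V i j k).
      by rewrite asboolT // => ?; left.
    by rewrite asboolF // => ?; right.
  by move=> [[[Sk Vk]]|[[Sk Vk]]]; [rewrite asboolT|rewrite asboolF].
apply: good_setU.
- by apply: (IH (fun s => Pi (true :: s))); exact: good_setI.
- by apply: (IH (fun s => Pi (false :: s))); exact: good_setD.
- by apply/seteqP; split=> k // [[[_ Vk] _] [[_ nVk] _]].
Qed.

Lemma pattern_cvg vs (Pi : seq bool -> Prop) :
  (fun t => outer_content (nu t) [set k | Pi (stratum_pattern vs k)]) @ F -->
  outer_content mu [set k | Pi (stratum_pattern vs k)].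
Proof.
have := good_conv (good_pattern vs Pi good_setT); rewrite setTI; exact.
Qed.

(** On [L] the strata are relatively open, so by compactness finitely many strata contained in [W]
    cover [C & L]. Contents converge on their union [S], and the part of [C] outside [L] is
    negligible for [mu]. *)
Lemma network_portmanteau :
  (forall (x : K) W, open W -> W x -> exists i j, V i j x /\ V i j `<=` W) ->
  forall (C W : set K) (d : R), closed C -> open W -> C `<=` W -> 0 < d ->
  \forall t \near F, content mu C <= inner_content (nu t) W + d.
Proof.
move=> net C W d cC oW CW d0; have d2 : 0 < d / 2 by rewrite divr_gt0.
have [L [cL hL LV]] := strata_clopen_core hmu d2.
(* An open set with the same trace on [L] as the stratum. *)
pose f (p : I * J) := if `[< V p.1 p.2 `<=` W >] then ~` (L `\` V p.1 p.2) else set0.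
have [D hD] : exists D : {fset I * J}, C `&` L `<=` \bigcup_(p in [set` D]) f p.
  apply: compact_finite_cover.
  - exact: subclosed_compact (closedI cC cL) compK (@subsetT _ _).
  - move=> p; rewrite /f; case: ifP => _; last exact: open0.
    by apply: closed_openC; have [] := LV p.1 p.2.
  - move=> k [Ck Lk]; have [i [j [Vk VW]]] := net k W oW (CW k Ck).
    by exists (i, j) => //; rewrite /f asboolT // => -[].
pose vs := [seq p <- (D : seq (I * J)) | `[< V p.1 p.2 `<=` W >]].
pose S := [set k | true \in stratum_pattern vs k].
have SW : S `<=` W.
  move=> k /mapP[p]; rewrite mem_filter => /andP[/asboolP pW _] /esym/asboolP; exact: pW.
have CS : C `<=` S `|` ~` L.
  move=> k Ck; have [Lk|] := pselect (L k); last by right.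
  left; have [p /= pD] := hD k (conj Ck Lk); rewrite /f; case: ifP => // pW nk.
  apply/mapP; exists p; first by rewrite mem_filter pW.
  by apply/esym/asboolP; apply: contrapT => nV; apply: nk.
have e1 : content mu C <= outer_content mu S + d / 2.
  apply: le_trans (outer_closed_ge hmu cC) _.
  apply: le_trans (outer_mono hmu CS) _; apply: le_trans (outer_setU hmu normK _ _) _.
  by rewrite lerD2l // outer_open //; exact: closed_openC.
have /cvgrPdist_le/(_ _ d2) : (fun t => outer_content (nu t) S) @ F --> outer_content mu S.
  have := @pattern_cvg vs (fun s => is_true (true \in s)); exact.
apply: filterS => t; rewrite ler_norml => /andP[_ h].
have : outer_content (nu t) S <= inner_content (nu t) W by exact: outer_le.
lra.
Qed.

End Limits.

(** Strata only separate points here, so compactness is applied to pairs: finitely many strata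
    separate every point of [C & L] from every point of [L \ W]. The set [S] of points sharing their
    pattern with a point of [C & L] then contains [C] and is contained in [W], up to the complement
    of [L], and both measures agree on it. *)
Lemma separating_portmanteau mu nu : positive_functional mu -> positive_functional nu ->
  (forall i j, outer_content mu (V i j) = outer_content nu (V i j)) ->
  (forall x y : K, x <> y -> exists i j, (V i j x /\ ~ V i j y) \/ (V i j y /\ ~ V i j x)) ->
  forall (C W : set K) (d : R), closed C -> open W -> C `<=` W -> 0 < d ->
  content mu C <= inner_content nu W + d.
Proof.
move=> hm hn eqV sep C W d cC oW CW d0; have d2 : 0 < d / 2 by rewrite divr_gt0.
(* The sum is used so that the complement of [L] is small for both measures at once. *)
have [L [cL hL LV]] := strata_clopen_core (posf_add hm hn) d2.
rewrite inner_contentD // in hL.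
pose f (p : I * J * bool) : set (K * K) :=
  let A := ~` (L `\` V p.1.1 p.1.2) in let B := ~` (V p.1.1 p.1.2 `&` L) in
  if p.2 then A `*` B else B `*` A.
have openX (A B : set K) : open A -> open B -> open (A `*` B).
  move=> oA oB; rewrite openE => -[x y] [Ax By]; exists (A, B) => //=.
  by split; apply: open_nbhs_nbhs.
have cW : closed (L `\` W) by rewrite setDE; apply: closedI => //; exact: open_closedC.
have [D hD] : exists D : {fset I * J * bool}, (C `&` L) `*` (L `\` W) `<=` \bigcup_(p in [set` D]) f p.
  apply: compact_finite_cover.
  - apply: compact_setX; apply: subclosed_compact compK (@subsetT _ _) => //.
    exact: closedI.
  - by move=> [[i j] b]; have [c1 c2] := LV i j; case: b; apply: openX; exact: closed_openC.
  - move=> [x y] [[Cx Lx] [Ly Wy]] /=.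
    have xy : x <> y by move=> E; apply: Wy; rewrite -E; exact: CW.
    have [i [j [[Vx Vy]|[Vy Vx]]]] := sep _ _ xy.
      by exists ((i, j), true) => //; split=> /= -[].
    by exists ((i, j), false) => //; split=> /= -[].
pose vs := [seq p.1 | p <- (D : seq (I * J * bool))].
pose Pi s := exists2 x, (C `&` L) x & s = stratum_pattern vs x.
pose S := [set k | Pi (stratum_pattern vs k)].
have CS : C `<=` S `|` ~` L.
  by move=> k Ck; have [Lk|] := pselect (L k); [left; exists k|right].
have SW : S `<=` W `|` ~` L.
  move=> y [x CLx E]; have [Ly|] := pselect (L y); last by right.
  left; apply: contrapT => nWy.
  have [[[i j] b] /= pD] := hD (x, y) (conj CLx (conj Ly nWy)).
  have : `[< V i j x >] = `[< V i j y >].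
    have ivs : (i, j) \in vs by apply/mapP; exists ((i, j), b).
    have nE k : nth false (stratum_pattern vs k) (index (i, j) vs) = `[< V i j k >].
      by rewrite (nth_map (i, j)) ?index_mem // nth_index.
    by rewrite -!nE E.
  have Lx := CLx.2.
  have Ly' := Ly; rewrite /f /=; case: b {pD} => + [/= h1 h2].
    have Vx : V i j x by apply: contrapT => nV; apply: h1.
    have Vy : ~ V i j y by move=> Vy; apply: h2.
    by rewrite asboolT // asboolF.
  have Vx : ~ V i j x by move=> Vx; apply: h1.
  have Vy : V i j y by apply: contrapT => nV; apply: h2.
  by rewrite asboolF // asboolT.
have oL : open (~` L) by exact: closed_openC.
have e1 : content mu C <= outer_content mu S + inner_content mu (~` L).
  apply: le_trans (outer_closed_ge hm cC) _.
  apply: le_trans (outer_mono hm CS) _; apply: le_trans (outer_setU hm normK _ _) _.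
  by rewrite lerD2l // outer_open.
have e2 : outer_content nu S <= inner_content nu W + inner_content nu (~` L).
  apply: le_trans (outer_mono hn SW) _; apply: le_trans (outer_setU hn normK _ _) _.
  by rewrite !outer_open.
have e3 : outer_content mu S = outer_content nu S.
  (* Equality on patterns is the convergence statement for a constant family, along an arbitrarily
     chosen proper filter. *)
  have F0 : ProperFilter (nbhs (0 : R)) by exact: nbhs_pfilter.
  have := @pattern_cvg R (nbhs (0 : R)) F0 mu (fun=> nu) hm (fun=> hn) _ vs Pi.
  move=> /(_ _) H; apply/esym; apply: (@cvg_unique _ (@norm_hausdorff _ R^o) (outer_content nu S @[t --> (0 : R)])).
    exact: cvg_cst.
  by apply: H => i j; rewrite eqV; exact: cvg_cst.
lra.
Qed.

End Strata.

Lemma cvg_sum_ord (R : realType) (T : Type) (F : set_system T) (m : nat)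
    (h : nat -> T -> R) (l : nat -> R) : Filter F ->
  (forall n, h n @ F --> l n) -> (fun t => \sum_(n < m) h n t) @ F --> \sum_(n < m) l n.
Proof.
move=> FF hl; elim: m => [|m IH].
  by under eq_fun do rewrite big_ord0; rewrite big_ord0; exact: cvg_cst.
by under eq_fun do rewrite big_ord_recr; rewrite big_ord_recr; apply: cvgD.
Qed.

(** * Renormings from stratifications of the dual ball *)

Section Representations.
Context {R : realType} {X : normedModType R}.
Local Notation B := (set_type (@dual_ball R X)).
Local Notation dn := (dual_norm (fun x : X => `|x|)).
Variable cls : nat -> set (set B).
Hypothesis cls0 : forall n, cls n set0.
Hypothesis cls_all : forall C, closed C -> cls 0%N C.
Implicit Types (f g : dual X) (mu nu : (B -> R) -> R) (x : X).
Local Notation q := (quadratic_form cls).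

(** [f] is the barycentre of [mu]. *)
Definition represents mu f :=
  positive_functional mu /\ forall x, mu (fun k => set_val k x) = f x.

Lemma ball_eval_le (k : B) x : `|set_val k x| <= `|x|.
Proof. exact: (dual_ballP (set_val k)).1 (set_valP k) x. Qed.

Lemma ball_eval_bounded x : bounded_on (fun k : B => set_val k x).
Proof. by exists `|x| => k; exact: ball_eval_le. Qed.

Lemma dn_ge0 f : 0 <= dn f.
Proof. exact: dual_norm_ge0 equivalent_norm_id f. Qed.

Lemma represents_mass mu f : represents mu f -> dn f <= mass mu.
Proof.
move=> [hm h]; apply: (dual_norm_le equivalent_norm_id); first exact: mass_ge0.
move=> x; rewrite -h mulrC; apply: posf_norm => // k; exact: ball_eval_le.
Qed.

(** A multiple of the point mass at the normalised functional; for [f = 0] the convention [0^-1 = 0]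
    yields the zero measure. *)
Lemma represents_exists f : exists2 mu, represents mu f & mass mu = dn f.
Proof.
have hB : (dn f)^-1 *: f \in @dual_ball R X.
  apply/mem_set/dual_ballP => x; rewrite dual_scaleE normrM ger0_norm ?invr_ge0 ?dn_ge0 //.
  have [->|f0] := eqVneq (dn f) 0; first by rewrite invr0 mul0r.
  rewrite ler_pdivrMl ?lt_neqAle 1?eq_sym ?f0 ?dn_ge0 //.
  exact: dual_norm_ge equivalent_norm_id f x.
pose k0 : B := @exist (dual X) (fun g => g \in @dual_ball R X) _ hB.
exists (fun phi => dn f * phi k0); last by rewrite /mass mulr1.
split=> [|x]; first by apply: posf_scale; [exact: dn_ge0|exact: posf_dirac].
rewrite set_valE /= dual_scaleE mulrA.
have [f0|f0] := eqVneq (dn f) 0; last by rewrite mulfV // mul1r.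
by rewrite f0 mul0r mul0r (dual_norm_eq0 equivalent_norm_id f0) dual_zeroE.
Qed.

Lemma represents_add mu nu f g : represents mu f -> represents nu g ->
  represents (fun phi => mu phi + nu phi) (f + g).
Proof.
by move=> [h1 h2] [h3 h4]; split=> [|x]; [exact: posf_add|rewrite h2 h4 dual_addE].
Qed.

Lemma represents_scale (t : R) mu f : 0 <= t -> represents mu f ->
  represents (fun phi => t * mu phi) (t *: f).
Proof.
by move=> t0 [h1 h2]; split=> [|x]; [exact: posf_scale|rewrite h2 dual_scaleE].
Qed.

Definition dual_form f := inf [set q mu | mu in [set mu | represents mu f]].
Local Notation Q := dual_form.

Let Q_ne f : [set q mu | mu in [set mu | represents mu f]] !=set0.
Proof. by have [mu h _] := represents_exists f; exists (q mu), mu. Qed.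

Let Q_lb f : lbound [set q mu | mu in [set mu | represents mu f]] (dn f ^+ 2).
Proof.
move=> _ [mu h <-]; apply: le_trans (quadratic_ge_mass cls0 cls_all h.1).
by rewrite lerXn2r ?nnegrE ?dn_ge0 ?(mass_ge0 h.1) // represents_mass.
Qed.

Lemma dual_form_le mu f : represents mu f -> Q f <= q mu.
Proof. by move=> h; apply: ge_inf; [exists (dn f ^+ 2); exact: Q_lb|exists mu]. Qed.

Lemma dual_form_ge_norm f : dn f ^+ 2 <= Q f.
Proof. exact: lb_le_inf (Q_ne f) (@Q_lb f). Qed.

Lemma dual_form_le_norm f : Q f <= 2 * dn f ^+ 2.
Proof.
have [mu h <-] := represents_exists f; apply: le_trans (dual_form_le h) _.
exact: quadratic_le_mass h.1.
Qed.

Lemma dual_form_ge0 f : 0 <= Q f.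
Proof. by apply: le_trans (dual_form_ge_norm f); rewrite sqr_ge0. Qed.

(** Bounded masses make the values on each bounded function, in particular on each indicator,
    converge along the ultrafilter. Every weighted sum passes to the limit, and a supremum of such
    sums can only drop. *)
Lemma represents_limit (T : Type) (U : set_system T) (mu : T -> (B -> R) -> R)
    (g : T -> dual X) (c : T -> R) f (M b : R) : UltraFilter U ->
  (forall t, represents (mu t) (g t)) -> (forall t, mass (mu t) <= M) ->
  (forall t, q (mu t) <= c t) ->
  (forall x, (fun t => g t x) @ U --> f x) -> c @ U --> b ->
  exists2 la, represents la f & q la <= b.
Proof.
move=> UU hr hM hq gf cb.
have PU : ProperFilter U by exact: ultra_proper.
have M0 (t : T) : 0 <= M by apply: le_trans (hM t); exact: mass_ge0 (hr t).1.
have /choice[la hla] : forall phi, exists l : R, bounded_on phi -> (fun t => mu t phi) @ U --> l.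
  move=> phi; have [[d hd]|nb] := pselect (bounded_on phi); last by exists 0.
  have [l hl] : exists l : R, (fun t => mu t phi) @ U --> l.
    apply: (@ultra_bounded_cvg _ _ _ _ (`|d| * M) UU) => t.
    apply: le_trans (posf_norm (hr t).1 hd) _.
    apply: (@le_trans _ _ (`|d| * mass (mu t))); last by rewrite ler_wpM2l.
    by rewrite ler_wpM2r ?ler_norm //; exact: mass_ge0 (hr t).1.
  by exists l.
have uniq (h h' : T -> R) (l l' : R) : h @ U --> l -> h' @ U --> l' -> h =1 h' -> l = l'.
  move=> hl hl' /funext E; rewrite E in hl.
  exact: (@cvg_unique _ (@norm_hausdorff _ R^o) _ _ _ _ hl hl').
have hp : positive_functional la.
  split=> [phi psi b1 b2|a phi b1|phi b1 p0].
  - apply: (uniq (fun t => mu t (fun k => phi k + psi k)) (fun t => mu t phi + mu t psi)).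
    + by apply: hla; exact: bounded_onD.
    + by apply: cvgD; exact: hla.
    + by move=> t; have [h _ _] := (hr t).1; exact: h.
  - apply: (uniq (fun t => mu t (fun k => a * phi k)) (fun t => a * mu t phi)).
    + by apply: hla; exact: bounded_onZ.
    + by apply: cvgMr; exact: hla.
    + by move=> t; have [_ h _] := (hr t).1; exact: h.
  - rewrite -oppr_le0; apply: (@cvg_le_cst _ _ U (fun t => - mu t phi)).
      by apply: cvgN; exact: hla.
    by apply: nearW => t; rewrite oppr_le0; have [_ _ h] := (hr t).1; exact: h.
exists la.
  split=> // x; apply: (uniq (fun t => mu t (fun k : B => set_val k x)) (fun t => g t x)) => //.
    by apply: hla; exact: ball_eval_bounded.
  by move=> t; exact: (hr t).2.
apply: quadratic_le => // m C hC; rewrite -subr_le0.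
apply: (@cvg_le_cst _ _ U (fun t => weighted_sum m C (mu t) - c t)).
  apply: cvgB => //; rewrite /weighted_sum.
  have H n : (fun t => 2^-1 ^+ n * content (mu t) (C n) ^+ 2) @ U --> 2^-1 ^+ n * content la (C n) ^+ 2.
    apply: cvgMr; rewrite expr2; under eq_fun do rewrite expr2.
    by apply: cvgM; apply: hla; exact: bounded_on_indic.
  exact: (@cvg_sum_ord R T U m _ _ _ H).
apply: nearW => t; rewrite subr_le0; apply: le_trans (hq t).
exact: (quadratic_ge (hr t).1 m hC).
Qed.

Lemma dual_form_attained f : exists2 mu, represents mu f & q mu = Q f.
Proof.
have /choice[mu hmu] : forall n : nat, exists mu, represents mu f /\ q mu < Q f + n.+1%:R^-1.
  move=> n; have lt : Q f < Q f + n.+1%:R^-1 by rewrite ltrDl invr_gt0.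
  have [_ [mu h <-] ?] := inf_ltP (Q_ne f) (@Q_lb f) lt.
  by exists mu.
have [U [UU sU]] := ultraFilterLemma (@eventually_filter).
have PU : ProperFilter U by exact: ultra_proper.
pose c (n : nat) := Q f + n.+1%:R^-1.
(* The masses [z] stay below [Q f + 2] because [2 z <= z^2 + 1] and [z^2 <= q (mu n) < Q f + 1]. *)
have [|||||la h1 h2] := @represents_limit nat U mu (fun=> f) c f (Q f + 2) (Q f) UU.
- by move=> n; exact: (hmu n).1.
- move=> n; have h := quadratic_ge_mass cls0 cls_all (hmu n).1.1.
  have m0 := mass_ge0 (hmu n).1.1; have := (hmu n).2; have := dual_form_ge0 f.
  have : n.+1%:R^-1 <= 1 :> R by rewrite invf_le1 ?ler1n // ltr0n.
  move: h m0; move: (mass (mu n)) (q (mu n)) (n.+1%:R^-1 : R) => z w u h m0 u1 Q0 wQ.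
  have : 0 <= (z - 1) ^+ 2 by rewrite sqr_ge0.
  by rewrite sqrrB1 mulr2n; lra.
- by move=> n; apply/ltW; exact: (hmu n).2.
- move=> x; exact: cvg_cst.
- rewrite -[X in _ --> X]addr0; apply: cvgD; first exact: cvg_cst.
  apply: cvg_trans (@cvg_harmonic R); move=> A hA; exact: sU.
- by exists la => //; apply/eqP; rewrite eq_le h2 dual_form_le.
Qed.

Lemma dual_formD (s : R) f g : 0 < s -> Q (f + g) <= (1 + s) * Q f + (1 + s^-1) * Q g.
Proof.
move=> s0; have [mu h <-] := dual_form_attained f; have [nu h' <-] := dual_form_attained g.
apply: le_trans (dual_form_le (represents_add h h')) _.
exact: (quadraticD cls0 h.1 h'.1 s0).
Qed.

Lemma dual_formZ (t : R) f : 0 <= t -> Q (t *: f) <= t ^+ 2 * Q f.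
Proof.
move=> t0; have [mu h <-] := dual_form_attained f.
apply: le_trans (dual_form_le (represents_scale t0 h)) _.
exact: (quadraticZ cls0 h.1 t0).
Qed.

(** Representing measures are positive, so nothing relates those of [f] to those of [- f] and the
    infimum need not be even; adding the value at [- f] restores symmetry. *)
Definition dual_form_norm f := Num.sqrt (Q f + Q (- f)).
Local Notation N := dual_form_norm.

Let S f := Q f + Q (- f).
Let S_ge0 f : 0 <= S f. Proof. by rewrite addr_ge0 ?dual_form_ge0. Qed.
Let N_sqr f : N f ^+ 2 = S f. Proof. by rewrite /dual_form_norm sqr_sqrtr //; exact: S_ge0. Qed.
Let N_ge0 f : 0 <= N f. Proof. exact: sqrtr_ge0. Qed.

Let dnN f : dn (- f) = dn f.
Proof. by rewrite -scaleN1r (dual_normZ equivalent_norm_id) normrN1 mul1r. Qed.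

Lemma dual_form_norm_equiv f : 1 * dn f <= N f <= 2 * dn f.
Proof.
have h1 := dual_form_ge_norm f; have h2 := dual_form_ge_norm (- f).
have h3 := dual_form_le_norm f; have h4 := dual_form_le_norm (- f).
rewrite dnN in h2 h4; have d0 := dn_ge0 f; have := N_sqr f; rewrite /S => E.
have n0 := N_ge0 f; apply/andP; split; rewrite leNgt; apply/negP => lt.
  have : N f ^+ 2 < dn f ^+ 2 by rewrite ltrXn2r // ?nnegrE //; lra.
  rewrite E; have := sqr_ge0 (dn f); lra.
have : (2 * dn f) ^+ 2 < N f ^+ 2 by rewrite ltrXn2r // ?nnegrE //; lra.
rewrite E exprMn; have -> : (2 : R) ^+ 2 = 4 by rewrite expr2; lra.
lra.
Qed.

Let S_scale t f : 0 <= t -> S (t *: f) <= t ^+ 2 * S f.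
Proof. by move=> t0; rewrite /S -scalerN mulrDr lerD // dual_formZ. Qed.

Let SN f : S (- f) = S f.
Proof. by rewrite /S opprK addrC. Qed.

Lemma dual_form_is_norm : is_norm N.
Proof.
split=> [f Nf|a f|f g].
- have /andP[h _] := dual_form_norm_equiv f; rewrite Nf mul1r in h.
  by apply: (dual_norm_eq0 equivalent_norm_id); apply/eqP; rewrite eq_le h dn_ge0.
- have pos t h : 0 <= t -> N (t *: h) <= t * N h.
    move=> t0; rewrite -(@ler_pXn2r _ 2) ?nnegrE ?mulr_ge0 // N_sqr exprMn N_sqr.
    exact: S_scale.
  have eqp t h : 0 <= t -> N (t *: h) = t * N h.
    rewrite le_eqVlt => /predU1P[<-|t0].
      by apply/eqP; rewrite eq_le pos //= mul0r.
    apply/eqP; rewrite eq_le (pos _ _ (ltW t0)) /=.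
    have := pos t^-1 (t *: h); rewrite scalerA mulVf ?gt_eqF // scale1r invr_ge0 ltW // => /(_ isT).
    by rewrite ler_pdivlMl.
  have NN h : N (- h) = N h by rewrite /N -/(S _) -/(S _) SN.
  have [a0|a0] := leP 0 a; first by rewrite eqp // ger0_norm.
  by rewrite -NN -scaleNr eqp ?ltr0_norm // oppr_ge0 ltW.
- have quasi s : 0 < s -> S (f + g) <= (1 + s) * S f + (1 + s^-1) * S g.
    move=> s0; rewrite /S opprD; have := dual_formD f g s0; have := dual_formD (- f) (- g) s0.
    lra.
  have small h h' : N h = 0 -> N (h + h') <= N h'.
    move=> Nh; have /andP[hh _] := dual_form_norm_equiv h; rewrite Nh mul1r in hh.
    have -> : h = 0 by apply: (dual_norm_eq0 equivalent_norm_id); apply/eqP; rewrite eq_le hh dn_ge0.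
    by rewrite add0r.
  have [f0|f0] := eqVneq (N f) 0; first by rewrite f0 add0r small.
  have [g0|g0] := eqVneq (N g) 0; first by rewrite g0 addr0 addrC small.
  have fp : 0 < N f by rewrite lt_neqAle eq_sym f0 N_ge0.
  have gp : 0 < N g by rewrite lt_neqAle eq_sym g0 N_ge0.
  rewrite -(@ler_pXn2r _ 2) ?nnegrE ?addr_ge0 // N_sqr.
  (* The value of [s] for which the right-hand side becomes [(N f + N g) ^+ 2]. *)
  apply: le_trans (quasi (N g / N f) _) _; first by rewrite divr_gt0.
  rewrite -!N_sqr invf_div le_eqVlt; apply/orP; left; apply/eqP; field.
  by rewrite f0 g0.
Qed.

(** Along an ultrafilter on the unit ball that converges to [f], the two summands of the squared
    norm have separate limits [a] and [b] with [a + b <= 1]. The representing measures of [g] and of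
    [- g] converge too, which bounds [Q f] by [a] and [Q (- f)] by [b]. *)
Lemma dual_form_norm_closed : closed [set f : dual X | N f <= 1].
Proof.
move=> f clf.
have PW : ProperFilter (within [set f : dual X | N f <= 1] (nbhs f)).
  by apply: within_nbhs_proper.
have [U [UU sU]] := ultraFilterLemma PW.
have PU : ProperFilter U by exact: ultra_proper.
have UN : U [set f | N f <= 1] by apply: sU; exact: withinT.
have Uf : U --> f by move=> A hA; apply: sU; exact: cvg_within hA.
have S1 : \forall g \near U, S g <= 1.
  by apply: filterS UN => g g1; rewrite -N_sqr -[leRHS](expr1n _ 2) lerXn2r ?nnegrE.
pose T := {g : dual X | S g <= 1}.
(* [r] sends everything outside the unit ball to 0, so that the bounds hold for all indices and not
   merely along the ultrafilter. *)
have /choice[r hr] : forall g : dual X, exists g' : dual X, S g' <= 1 /\ (S g <= 1 -> g' = g).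
  move=> g; have [h|h] := pselect (S g <= 1); first by exists g.
  exists 0; split=> //; rewrite /S oppr0; have := dual_form_le_norm 0.
  rewrite (dual_norm0 equivalent_norm_id) expr0n mulr0 => h0.
  by have := lerD h0 h0; rewrite addr0 => /le_trans; apply.
have rf x : (fun g => r g x) @ U --> (f : dual X) x.
  have h : (fun g : dual X => g x) @ U --> (f : dual X) x.
    by have /dual_cvgP : U --> f := Uf; exact.
  apply: cvg_trans h; apply: near_eq_cvg; apply: filterS S1 => g /((hr g).2) ->.
  by [].
have Qb g : `|Q (r g)| <= 1 /\ `|Q (- r g)| <= 1.
  have := (hr g).1; rewrite /S; have := dual_form_ge0 (r g); have := dual_form_ge0 (- r g).
  by move=> h1 h2 h3; rewrite !ger0_norm //; split; lra.
have [a ha] := ultra_bounded_cvg UU (fun g => (Qb g).1).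
have [b hb] := ultra_bounded_cvg UU (fun g => (Qb g).2).
have ab : a + b <= 1.
  apply: (@cvg_le_cst _ _ U (fun g => Q (r g) + Q (- r g))); first exact: cvgD.
  by apply: nearW => g; exact: (hr g).1.
have rep g : exists mu, [/\ represents mu g, q mu = Q g & Q g <= 1 -> mass mu <= 1].
  have [mu h E] := dual_form_attained g; exists mu; split=> // Q1.
  have := quadratic_ge_mass cls0 cls_all h.1; rewrite E => h2.
  by rewrite -(@ler_pXn2r _ 2) ?nnegrE ?(mass_ge0 h.1) // expr1n; apply: le_trans h2 _.
have [mu hmu] := choice rep.
have Qf : Q f <= a.
  have [|||||la h1 h2] := @represents_limit (dual X) U (fun g => mu (r g)) r (fun g => Q (r g)) f 1 a UU.
  - by move=> g; have [] := hmu (r g).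
  - move=> g; have [_ _] := hmu (r g); apply; have := (Qb g).1; exact: le_trans (ler_norm _).
  - by move=> g; have [_ ->] := hmu (r g).
  - exact: rf.
  - exact: ha.
  - exact: le_trans (dual_form_le h1) h2.
have Qf' : Q (- f) <= b.
  have [|||||la h1 h2] := @represents_limit (dual X) U (fun g => mu (- r g)) (fun g => - r g) (fun g => Q (- r g)) (- f) 1 b UU.
  - by move=> g; have [] := hmu (- r g).
  - move=> g; have [_ _] := hmu (- r g); apply; have := (Qb g).2; exact: le_trans (ler_norm _).
  - by move=> g; have [_ ->] := hmu (- r g).
  - move=> x; rewrite dual_oppE; under eq_fun do rewrite dual_oppE.
    by apply: cvgN; exact: rf.
  - exact: hb.
  - exact: le_trans (dual_form_le h1) h2.
rewrite /= -(@ler_pXn2r _ 2) ?nnegrE ?N_ge0 // N_sqr expr1n /S; lra.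
Qed.

Lemma dual_form_norm_exists : exists2 M : X -> R, equivalent_norm M & forall f, dual_norm M f = N f.
Proof.
exact: (bipolar_norm dual_form_is_norm ltr01 (ltr0n _ 2) dual_form_norm_equiv dual_form_norm_closed).
Qed.

(** The part of the right-hand side coming from [- f] and [- g] is nonnegative by [dual_formD] at
    [s = 1], and may be dropped. *)
Lemma dual_form_deficit f g mu nu : represents mu f -> represents nu g ->
  q mu = Q f -> q nu = Q g ->
  deficit cls mu nu <= 2 * N f ^+ 2 + 2 * N g ^+ 2 - N (f + g) ^+ 2.
Proof.
move=> h1 h2 e1 e2; rewrite !N_sqr /S /deficit e1 e2.
have := dual_form_le (represents_add h1 h2).
have := dual_formD (- f) (- g) (@ltr01 R); rewrite -opprD invr1; lra.
Qed.

End Representations.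

(** * Closing a stratification under finite intersections *)

Section CapClosure.
Context {R : realType} {K : topologicalType} {I : countType} {J : choiceType}.
Variables (G : I -> set K) (V : I -> J -> set K).
Hypothesis hV : stratification G V.

(** An intersection of strata with indices in [s] is relatively open only outside all the
    corresponding [G i], whence the union. Lists [s] and [t] of different lengths are given the
    empty stratum. *)
Fixpoint cap_open (s : seq I) : set K :=
  if s is i :: s' then G i `|` cap_open s' else set0.

Fixpoint cap_stratum (s : seq I) (t : seq J) : set K :=
  match s, t with
  | [::], [::] => setT
  | i :: s', j :: t' => V i j `&` cap_stratum s' t'
  | _, _ => set0
  end.

Lemma cap_stratum_size s t : size s <> size t -> cap_stratum s t = set0.
Proof.
elim: s t => [|i s IH] [|j t] //= h.
by rewrite IH ?setI0 // => E; apply: h; rewrite E.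
Qed.

Lemma cap_stratum_cat s t s' t' : size s = size t ->
  cap_stratum s t `&` cap_stratum s' t' = cap_stratum (s ++ s') (t ++ t').
Proof.
elim: s t => [|i s IH] [|j t] //= h; first by rewrite setTI.
by rewrite -setIA IH //; case: h.
Qed.

Lemma cap_stratification : stratification cap_open cap_stratum.
Proof.
have [h1 h2 h3 h4] := hV.
have oG s : open (cap_open s) by elim: s => [|i s IH] /=; [exact: open0|exact: openU].
have oGV s t : open (cap_open s `|` cap_stratum s t).
  elim: s t => [|i s IH] [|j t] /=.
  - by rewrite setUT; exact: openT.
  - by rewrite setU0; exact: open0.
  - by rewrite setU0; apply: openU => //; exact: oG.
  - have -> : (G i `|` cap_open s) `|` (V i j `&` cap_stratum s t) =
       (G i `|` cap_open s) `|` ((G i `|` V i j) `&` (cap_open s `|` cap_stratum s t)).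
      apply/seteqP; split=> k /=; first by move=> [?|[? ?]]; [left|right; split; right].
      move=> [?|[[?|?] [?|?]]]; [by left|by left; left|by left; left|by left; right|by right].
    by apply: openU; [apply: openU => //; exact: oG|exact: openI].
split=> //.
- elim=> [|i s IH] [|j t] //=; rewrite ?set0I ?setI0 //.
  apply/seteqP; split=> k // [[Gk|Gk] [Vk Vk']].
    by rewrite -(h3 i j).
  by rewrite -(IH t).
- elim=> [|i s IH] [|j t] [|j' t'] //=; rewrite ?set0I ?setI0 // => ne.
  apply/seteqP; split=> k // [[Vk Ck] [Vk' Ck']].
  have [jj'|jj'] := pselect (j = j'); last by rewrite -(h4 i j j').
  by rewrite -(IH t t') // => E; apply: ne; rewrite jj' E.
Qed.

Lemma cap_closed : strata_cap_closed cap_stratum.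
Proof.
split=> [|s t s' t']; first by exists [::], [::].
have [E|E] := pselect (size s = size t); first by exists (s ++ s'), (t ++ t'); rewrite cap_stratum_cat.
by exists s, t; rewrite (cap_stratum_size E) set0I.
Qed.

Lemma cap_stratum1 i j : cap_stratum [:: i] [:: j] = V i j.
Proof. by rewrite /= setIT. Qed.

End CapClosure.

(** * The two renormings *)

Section DualRenorming.
Context {R : realType} {X : normedModType R}.
Local Notation B := (set_type (@dual_ball R X)).
Context {I : countType} {J : choiceType} (G : I -> set B) (V : I -> J -> set B).
Hypotheses (hV : stratification G V) (capV : strata_cap_closed V).

Let cls := stratum_class G V.
Let cls0 : forall n, cls n set0 := stratum_class0 G V.
Let cls_all : forall C, closed C -> cls 0%N C. Proof. by []. Qed.
Let compK := @compact_ball R X.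
Let normK := @normal_ball R X.
Local Notation N := (dual_form_norm cls).

Let strata_limit (mu : (B -> R) -> R) (nu : nat -> (B -> R) -> R) :
  positive_functional mu -> (forall n, positive_functional (nu n)) ->
  (forall d, 0 < d -> \forall n \near \oo, deficit cls mu (nu n) < d) ->
  forall i j, (fun n => outer_content (nu n) (V i j)) @ \oo --> outer_content mu (V i j).
Proof.
move=> hm hn hd i j; apply/cvgrPdist_le => e e0.
have [d d0 h] := content_stratum_cvg hV normK hm i j e0.
by apply: filterS (hd d d0) => n /(h _ (hn n)); rewrite distrC.
Qed.

Let mass_limit (mu : (B -> R) -> R) (nu : nat -> (B -> R) -> R) :
  positive_functional mu -> (forall n, positive_functional (nu n)) ->
  (forall i j, (fun n => outer_content (nu n) (V i j)) @ \oo --> outer_content mu (V i j)) ->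
  (fun n => mass (nu n)) @ \oo --> mass mu.
Proof.
move=> hm hn h; have [[i [j E]] _] := capV; have := h i j.
by rewrite E (outer_setT hm); under eq_fun do rewrite (outer_setT (hn _)).
Qed.

Lemma wstar_LUR_renorming :
  (forall (k : B) W, open W -> W k -> exists i j, V i j k /\ V i j `<=` W) ->
  exists2 M : X -> R, equivalent_norm M & wstar_LUR (dual_norm M).
Proof.
move=> net; have [M hM ME] := dual_form_norm_exists cls0 cls_all.
exists M => // f g; rewrite ME => Nf Ng.
have -> : (fun n => dual_norm M (f + g n)) = (fun n => N (f + g n)) by apply/funext => n; rewrite ME.
move=> Nfg.
have [mu hmu muE] := dual_form_attained cls0 cls_all f.
have /choice[nu hnu] : forall n, exists nu, represents nu (g n) /\ quadratic_form cls nu = dual_form cls (g n).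
  by move=> n; have [nu ? ?] := dual_form_attained cls0 cls_all (g n); exists nu.
have hd d : 0 < d -> \forall n \near \oo, deficit cls mu (nu n) < d.
  move=> d0.
  have : (fun n => 2 * N f ^+ 2 + 2 * N (g n) ^+ 2 - N (f + g n) ^+ 2) @ \oo --> (0 : R).
    have -> : (0 : R) = 4 - 2 * 2 by lra.
    have -> : (fun n => 2 * N f ^+ 2 + 2 * N (g n) ^+ 2 - N (f + g n) ^+ 2) = (fun n => 4 - N (f + g n) * N (f + g n)).
      by apply/funext => n; rewrite Nf -ME Ng expr1n expr2; lra.
    by apply: cvgB; [exact: cvg_cst|exact: cvgM].
  move=> /(@cvgr_lt _ _ _ _ _ 0)/(_ d d0); apply: filterS => n; apply: le_lt_trans.
  exact: (dual_form_deficit cls0 cls_all hmu (hnu n).1 muE (hnu n).2).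
have hc := strata_limit hmu.1 (fun n => (hnu n).1.1) hd.
have hm := mass_limit hmu.1 (fun n => (hnu n).1.1) hc.
have port := network_portmanteau hV compK normK capV hmu.1 (fun n => (hnu n).1.1) hc net.
apply/dual_cvgP => x; rewrite -(hmu.2 x).
suff : (fun n => g n x) @ \oo --> mu (fun k : B => set_val k x) by [].
have -> : (fun n => g n x) = (fun n => nu n (fun k : B => set_val k x)).
  by apply/funext => n; rewrite (hnu n).1.2.
exact: (posf_cvg hmu.1 (fun n => (hnu n).1.1) (port eventually_filter) hm
  (@ball_eval_continuous _ _ x) (fun k => ball_eval_le k x)).
Qed.

Lemma strictly_convex_renorming :
  (forall x y : B, x <> y -> exists i j, (V i j x /\ ~ V i j y) \/ (V i j y /\ ~ V i j x)) ->
  exists2 M : X -> R, equivalent_norm M & strictly_convex (dual_norm M).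
Proof.
move=> sep; have [M hM ME] := dual_form_norm_exists cls0 cls_all.
exists M => // f g; rewrite !ME => Nfg Nfg2.
have [mu hmu muE] := dual_form_attained cls0 cls_all f.
have [nu hnu nuE] := dual_form_attained cls0 cls_all g.
have def0 : deficit cls mu nu <= 0.
  apply: le_trans (dual_form_deficit cls0 cls_all hmu hnu muE nuE) _.
  have -> : N (f + g) = 2 * N g by rewrite Nfg2 mulrA mulfV // mul1r.
  rewrite Nfg; have -> : (2 * N g) ^+ 2 = 4 * N g ^+ 2 by ring.
  lra.
(* The limit theorems are applied to the constant sequence [nu], for which convergence means
   equality. *)
have hd d : 0 < d -> \forall n \near \oo, deficit cls mu ((fun=> nu) n) < d.
  by move=> d0; apply: nearW => n; exact: le_lt_trans def0 d0.
have hc := strata_limit hmu.1 (fun n : nat => hnu.1) hd.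
have hm := mass_limit hmu.1 (fun n => hnu.1) hc.
have eqV i j : outer_content mu (V i j) = outer_content nu (V i j).
  apply: (@cvg_unique _ (@norm_hausdorff _ R^o) _ _ _ _ (hc i j)); exact: cvg_cst.
have port (C W : set B) (d : R) : closed C -> open W -> C `<=` W -> 0 < d ->
    \forall n \near \oo, content mu C <= inner_content ((fun n : nat => nu) n) W + d.
  move=> cC oW CW d0; apply: nearW => n.
  exact: (separating_portmanteau hV compK normK capV hmu.1 hnu.1 eqV sep).
apply: dual_eqP => x; rewrite -(hmu.2 x) -(hnu.2 x).
have := posf_cvg hmu.1 (fun n => hnu.1) port hm (@ball_eval_continuous _ _ x) (fun k => ball_eval_le k x).
move=> /(_ eventually_filter) h.
apply: (@cvg_unique _ (@norm_hausdorff _ R^o) _ _ _ _ h); exact: cvg_cst.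
Qed.

End DualRenorming.

(** * Strata in Gruenhage and in descriptive spaces *)

Section GruenhageDescriptive.
Context {T : topologicalType}.

(** [H n k] is the open set of points in more than [k] members of [U n]. Outside it, the points
    lying in all members of a [k]-element subfamily [D] lie in no other member, so these sets are
    disjoint as [D] varies. The flag [true] makes [H n k] itself a stratum, needed when [y] lies in
    more members than [x]. *)
Lemma gruenhage_stratification : gruenhage_space T ->
  exists (I : countType) (J : choiceType) (G : I -> set T) (V : I -> J -> set T),
    stratification G V /\
    forall x y, x <> y -> exists i j, (V i j x /\ ~ V i j y) \/ (V i j y /\ ~ V i j x).
Proof.
move=> [_ [U [oU sepU]]].
pose sub n (D : {fset set T}) := forall W, W \in D -> U n W.
pose cap (D : {fset set T}) := [set x | forall W, W \in D -> W x].
pose H n k := [set x | exists D : {fset set T}, [/\ sub n D, (k < #|` D|)%N & cap D x]].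
have ocap n (D : {fset set T}) : sub n D -> open (cap D).
  move=> hD; suff h (s : seq (set T)) : (forall W, W \in s -> open W) ->
      open [set x | forall W, W \in s -> W x].
    by apply: h => W WD; exact: oU (hD _ WD).
  elim: s => [|W s IH] hs.
    have -> : [set x : T | forall W : set T, W \in [::] -> W x] = setT.
      by apply/seteqP; split=> // x _ W; rewrite in_nil.
    exact: openT.
  have -> : [set x | forall W', W' \in W :: s -> W' x] = W `&` [set x | forall W, W \in s -> W x].
    apply/seteqP; split=> x /= h.
      by split=> [|W' W's]; apply: h; rewrite inE ?eqxx ?W's ?orbT.
    by move=> W'; rewrite inE => /predU1P[->|]; [exact: h.1|exact: h.2].
  apply: openI; first by apply: hs; rewrite inE eqxx.
  by apply: IH => W' W's; apply: hs; rewrite inE W's orbT.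
have oH n k : open (H n k).
  have -> : H n k = \bigcup_(D in [set D | sub n D /\ (k < #|` D|)%N]) cap D.
    by apply/seteqP; split=> x; [move=> [D [? ? ?]]; exists D|move=> [D [? ?] ?]; exists D].
  by apply: bigcup_open => D [hD _]; exact: ocap hD.
pose G (p : nat * nat * bool) := if p.2 then set0 else H p.1.1 p.1.2.
pose V (p : nat * nat * bool) (D : {fset set T}) :=
  if p.2 then (if D == fset0 then H p.1.1 p.1.2 else set0)
  else if `[< sub p.1.1 D /\ #|` D| = p.1.2 >] then cap D `\` H p.1.1 p.1.2 else set0.
exists (nat * nat * bool)%type, {fset set T}, G, V; split.
  split.
  - by move=> [[n k] []]; [exact: open0|exact: oH].
  - move=> [[n k] []] D; rewrite /G /V /=.
      by rewrite set0U; case: ifP => _; [exact: oH|exact: open0].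
    case: ifP => [/asboolP[hD _]|_]; last by rewrite setU0; exact: oH.
    have -> : H n k `|` cap D `\` H n k = H n k `|` cap D.
      apply/seteqP; split=> x /=; first by move=> [|[]]; [left|right].
      by move=> [|]; [left|have [?|?] := pselect (H n k x); [left|right]].
    by apply: openU; [exact: oH|exact: ocap hD].
  - move=> [[n k] []] D; rewrite /G /V /= ?set0I //.
    by case: ifP => _; rewrite ?setI0 // setDE setICA setICr setI0.
  - move=> [[n k] []] D D' DD'; rewrite /V /=.
      case: eqP => [D0|]; last by rewrite set0I.
      by case: eqP => [D'0|]; rewrite ?setI0 //; case: DD'; rewrite D0 D'0.
    case: ifP => [/asboolP[hD Dk]|_]; last by rewrite set0I.
    case: ifP => [/asboolP[hD' D'k]|_]; last by rewrite setI0.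
    (* A point of both strata would lie in all members of the union of [D] and [D'], which has more
       than [k] elements. *)
    apply/seteqP; split=> x // [[cx nHx] [cx' _]]; apply: nHx.
    exists (D `|` D')%fset; split=> [W|| W].
    - by rewrite in_fsetU => /orP[/hD|/hD'].
    - rewrite ltnNge -Dk; apply/negP => le.
      have DE : D = (D `|` D')%fset.
        by apply/eqP; rewrite eqEfcard fsubsetUl le.
      apply: DD'; apply/eqP; rewrite eq_sym eqEfcard Dk D'k leqnn andbT DE.
      exact: fsubsetUr.
    - by rewrite in_fsetU => /orP[/cx|/cx'].
have main n x y W : U n W -> (W x /\ ~ W y \/ W y /\ ~ W x) ->
    finite_set [set W | U n W /\ W x] ->
    exists i j, (V i j x /\ ~ V i j y) \/ (V i j y /\ ~ V i j x).
  move=> UW sep /finite_fsetP[D DE].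
  have hD Z : Z \in D <-> U n Z /\ Z x by rewrite -[_ /\ _]/([set W | U n W /\ W x] Z) DE.
  have nHx : ~ H n #|` D| x.
    move=> [D' [hD' lt cx]]; move: lt; apply/negP; rewrite -leqNgt.
    by apply/fsubset_leq_card/fsubsetP => Z ZD'; apply/hD; split; [exact: hD'|exact: cx].
  have [Hy|nHy] := pselect (H n #|` D| y).
    have E : V (n, #|` D|, true) fset0 = H n #|` D| by rewrite /V; case: eqP.
    by exists (n, #|` D|, true), fset0; right; rewrite E.
  have Vx : V (n, #|` D|, false) D x.
    rewrite /V /= asboolT; last by split=> // Z /hD[].
    by split=> // Z /hD[].
  exists (n, #|` D|, false), D; left; split=> //.
  rewrite /V /= asboolT; last by split=> // Z /hD[].
  move=> [cy _]; case: sep => -[Wx Wy]; first by apply: Wy; apply: cy; apply/hD.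
  (* Here [W] contains [y] but not [x], so it is outside [D], and [y] lies in [k + 1] members. *)
  apply: nHy; exists (W |` D)%fset; split=> [Z||Z].
  - by rewrite in_fset1U => /predU1P[->//|/hD[]].
  - rewrite cardfsU1; have -> : W \notin D by apply/negP => /hD[].
    by rewrite add1n.
  - by rewrite in_fset1U => /predU1P[->//|/cy].
move=> x y xy; have [n [W UW [[z Wz] fin]]] := sepU _ _ xy.
have sep : W x /\ ~ W y \/ W y /\ ~ W x.
  have zxy : (W `&` [set x; y]) z by rewrite Wz.
  have [Wzz [zx|zy]] := zxy.
    left; split; first by rewrite -zx.
    move=> Wy; apply: xy; rewrite -zx; have : [set z] y by rewrite -Wz; split=> //; right.
    by move=> /= ->.
  right; split; first by rewrite -zy.
  move=> Wx; apply: xy; rewrite -zy; have : [set z] x by rewrite -Wz; split=> //; left.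
  by move=> /= ->.
case: fin => fin; first exact: (main n x y W).
have [|i [j h]] := main n y x W UW _ fin; first by case: sep; [right|left].
by exists i, j; case: h; [right|left].
Qed.

(** [V n N] enlarges [N] to a set that is open relative to the closure of the union of [F n].
    Isolation gives [N] inside [V n N], which itself lies in the closure of [N]; regularity of the
    space lets that closure be placed inside [W]. *)
Lemma descriptive_stratification : descriptive T ->
  exists (I : countType) (J : choiceType) (G : I -> set T) (V : I -> J -> set T),
    stratification G V /\
    forall (x : T) W, open W -> W x -> exists i j, V i j x /\ V i j `<=` W.
Proof.
move=> [reg _ [Nw [net [F [iso E]]]]]; rewrite E in net.
pose rest n N := closure (\bigcup_(M in F n `\ N) M).
pose all n := closure (\bigcup_(M in F n) M).
pose V n N := if `[< F n N >] then all n `\` rest n N else set0.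
have call n : closed (all n) by exact: closed_closure.
have crest n N : closed (rest n N) by exact: closed_closure.
exists nat, (set T), (fun n => ~` all n), V; split.
  split.
  - by move=> n; exact: closed_openC.
  - move=> n N; rewrite /V; case: ifP => _; last by rewrite setU0; exact: closed_openC.
    have -> : ~` all n `|` (all n `\` rest n N) = ~` all n `|` ~` rest n N.
      apply/seteqP; split=> x /=; first by move=> [|[]]; [left|right].
      by move=> [|]; [left|have [?|?] := pselect (all n x); [right|left]].
    by apply: openU; exact: closed_openC.
  - move=> n N; rewrite /V; case: ifP => _; last by rewrite setI0.
    by apply/seteqP; split=> x // [? []].
  - move=> n N N' NN'; rewrite /V; case: ifP => _; last by rewrite set0I.
    case: ifP => _; last by rewrite setI0.
    apply/seteqP; split=> x // [[Ax Nx] [_ N'x]].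
    have : closure ((\bigcup_(M in F n `\ N) M) `|` (\bigcup_(M in F n `\ N') M)) x.
      apply: closureS Ax => y [M FM My].
      have [MN|MN] := pselect (M = N); [right|left]; exists M => //; split=> //= MN'.
      by apply: NN'; rewrite -MN.
    by rewrite closureU => -[|].
move=> x W oW Wx.
have [W' W'x cW'] := reg x W (open_nbhs_nbhs (conj oW Wx)).
have [N NN [Nx NW']] := net x W'° (open_interior _) W'x.
have [n _ FnN] : (\bigcup_n F n) N by [].
exists n, N; rewrite /V asboolT //; split.
  split; first by apply: subset_closure; exists N.
  move=> rx; have : (N `&` closure (\bigcup_(M in F n `\ N) M)) x by [].
  by rewrite iso.
move=> y [Ay ry]; apply: cW'.
have : closure (N `|` (\bigcup_(M in F n `\ N) M)) y.
  apply: closureS Ay => z [M FM Mz].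
  by have [<-|MN] := pselect (M = N); [left|right; exists M].
rewrite closureU => -[|//]; apply: closureS; apply: subset_trans NW' _.
exact: interior_subset.
Qed.

End GruenhageDescriptive.

Section Renormings.
Context {R : realType} {X : normedModType R}.
Local Notation B := (set_type (@dual_ball R X)).

Lemma gruenhage_strictly_convex : gruenhage_compact B ->
  exists2 N : X -> R, equivalent_norm N & strictly_convex (dual_norm N).
Proof.
move=> [_ /gruenhage_stratification[I [J [G [V [hV sep]]]]]].
apply: (strictly_convex_renorming (cap_stratification hV) (cap_closed V)) => x y /sep[i [j h]].
by exists [:: i], [:: j]; rewrite cap_stratum1.
Qed.

Lemma descriptive_wstar_LUR : descriptive B ->
  exists2 N : X -> R, equivalent_norm N & wstar_LUR (dual_norm N).
Proof.
move=> /descriptive_stratification[I [J [G [V [hV net]]]]].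
apply: (wstar_LUR_renorming (cap_stratification hV) (cap_closed V)) => x W oW Wx.
have [i [j h]] := net x W oW Wx.
by exists [:: i], [:: j]; rewrite cap_stratum1.
Qed.

(** The normalised [g], as a constant sequence, must converge to the normalised [f]. *)
Lemma wstar_LUR_strictly_convex (N : X -> R) : equivalent_norm N ->
  wstar_LUR (dual_norm N) -> strictly_convex (dual_norm N).
Proof.
move=> hN lur f g Nfg Ng2.
have [g0|g0] := eqVneq (dual_norm N g) 0.
  by rewrite (dual_norm_eq0 hN g0) (dual_norm_eq0 hN (etrans Nfg g0)).
have gp : 0 < dual_norm N g by rewrite lt_neqAle eq_sym g0 dual_norm_ge0.
pose a := (dual_norm N g)^-1.
have a0 : 0 < a by rewrite invr_gt0.
have Na h : dual_norm N (a *: h) = a * dual_norm N h by rewrite dual_normZ // gtr0_norm.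
have h1 : dual_norm N (a *: f) = 1 by rewrite Na Nfg mulVf.
have h2 : dual_norm N (a *: g) = 1 by rewrite Na mulVf.
have h3 : dual_norm N (a *: f + a *: g) = 2.
  rewrite -scalerDr Na; have -> : dual_norm N (f + g) = 2 * dual_norm N g.
    by rewrite Ng2 mulrA mulfV // mul1r.
  by rewrite mulrCA mulVf // mulr1.
have lim : (fun n : nat => (a *: g : dual X)) @ \oo --> (a *: f : dual X).
  by apply: lur => //; rewrite h3; exact: cvg_cst.
have E : a *: g = a *: f :> dual X.
  apply: dual_eqP => x; have /dual_cvgP/(_ x) hx := lim.
  have hc : (fun n : nat => (a *: g : dual X) x) @ \oo --> (a *: g : dual X) x by exact: cvg_cst.
  exact: (@cvg_unique _ (@norm_hausdorff _ R^o) _ _ _ _ hc hx).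
apply: dual_eqP => x; have := congr1 (fun h : dual X => h x) E.
rewrite !dual_scaleE => /(mulfI _) ->//; exact: lt0r_neq0.
Qed.

End Renormings.

(** * Descriptive spaces are Gruenhage *)

Section DescriptiveGruenhage.
Context {T : topologicalType}.

(** Let [x] lie in a member [N] whose closure misses [y]. The only set [~ rest n N'] containing [x]
    is that of [N]; it separates when [y] is in [rest n N]. Otherwise [y] lies in the smaller set
    without the closure of [N], while [x] is in no set of that second family. *)
Lemma descriptive_gruenhage : hausdorff_space T -> descriptive T -> gruenhage_compact T.
Proof.
move=> hT [reg cT [Nw [net [F [iso E]]]]]; rewrite E in net.
split=> //; split=> //.
pose rest n N := closure (\bigcup_(M in F n `\ N) M).
pose U (m : nat) : set (set T) :=
  if (choice.unpickle m : option (nat * bool)) is Some (n, b)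
  then [set W | exists2 N, F n N & W = if b then ~` rest n N `\` closure N else ~` rest n N]
  else set0.
exists U; split=> [m V|x y xy].
  rewrite /U; case: choice.unpickle => [[n b]|//] [N FN ->].
  have o : open (~` rest n N) by apply: closed_openC; exact: closed_closure.
  by case: b => //; rewrite setDE; apply: openI => //; apply: closed_openC; exact: closed_closure.
have [W [oW Wx Wy]] : exists W, [/\ open W, W x & ~ W y].
  have /hausdorff_accessible/(_ x y) := hT; move=> h.
  have [W [oW Wx Wy]] := h (introN eqP xy).
  by exists W; split=> //; [exact: set_mem Wx|exact: set_mem Wy].
have [W' W'x cW'] := reg x W (open_nbhs_nbhs (conj oW Wx)).
have [N NN [Nx NW']] := net x W'° (open_interior _) W'x.
have [n _ FnN] : (\bigcup_n F n) N by [].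
have rx : ~ rest n N x.
  move=> rx; have : (N `&` closure (\bigcup_(M in F n `\ N) M)) x by [].
  by rewrite iso.
have nNy : ~ closure N y.
  move=> cy; apply: Wy; apply: cW'; apply: closureS cy.
  by apply: subset_trans NW' _; exact: interior_subset.
have only N' : F n N' -> ~ rest n N' x -> N' = N.
  move=> FN' h; apply: contrapT => ne; apply: h; apply: subset_closure.
  by exists N => //; split=> // E'; apply: ne.
have single (b : bool) V : U (choice.pickle (n, b)) V <->
    exists2 N, F n N & V = if b then ~` rest n N `\` closure N else ~` rest n N.
  by rewrite /U choice.pickleK.
have [ry|ry] := pselect (rest n N y).
  exists (choice.pickle (n, false)), (~` rest n N); first by apply/single; exists N.
  split; last first.
    left; apply: (@sub_finite_set _ _ [set ~` rest n N]); last exact: finite_set1.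
    by move=> V [/single[N' FN' ->] h] /=; rewrite (only N').
  exists x; apply/seteqP; split=> z /=.
    by move=> [rz [//|zy]]; case: rz; rewrite zy.
  by move=> ->; split=> //; left.
exists (choice.pickle (n, true)), (~` rest n N `\` closure N); first by apply/single; exists N.
split; last first.
  left; apply: (@sub_finite_set _ _ set0); last exact: finite_set0.
  move=> V [/single[N' FN' ->] [h1 h2]] /=; apply: h2.
  by rewrite (only N' FN' h1); apply: subset_closure.
exists y; apply/seteqP; split=> z /=.
  by move=> [[_ cz] [zx|//]]; case: cz; rewrite zx; apply: subset_closure.
by move=> ->; split=> //; right.
Qed.

End DescriptiveGruenhage.

(** * Functionals and unconditional bases *)

Section Basis.
Context {R : realType} {X : normedModType R} {I : choiceType} (e : I -> X).
Hypotheses (he_basis : unconditional_basis e) (he_norm : normalised e)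
  (he_unc : one_unconditional e).
Implicit Types (f g : dual X) (x y : X) (a b : I -> R) (i j : I) (A : set I).

Lemma partial_sumE a (D : {fset I}) :
  summability.partial_sum (fun i => a i *: e i) D = \sum_(i <- D) a i *: e i.
Proof. by rewrite /summability.partial_sum big_seq_fsetE. Qed.

Lemma totally_superset (D : {fset I}) :
  summability.totally [set D' : {fset I} | (D `<=` D')%fset].
Proof. by exists D. Qed.

#[local] Instance totally_proper : ProperFilter (@summability.totally I) := summability.totally_filter.

Lemma expansion_finite a (D : {fset I}) : (forall i, i \notin D -> a i = 0) ->
  expansion e a (\sum_(i <- D) a i *: e i).
Proof.
move=> h; apply: (@cvg_near_cst _ _ _ _ _ totally_proper).
apply: filterS (totally_superset D) => D' /= DD'.
rewrite partial_sumE; apply/esym/eqP; apply/eqP.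
apply: (big_fset_incl _ DD') => i _ iD; by rewrite h // scale0r.
Qed.

Lemma expansionD a b x y : expansion e a x -> expansion e b y ->
  expansion e (fun i => a i + b i) (x + y).
Proof.
move=> h1 h2; rewrite /expansion.
have -> : summability.partial_sum (fun i => (a i + b i) *: e i) =
   (fun D => summability.partial_sum (fun i => a i *: e i) D + summability.partial_sum (fun i => b i *: e i) D).
  by apply/funext => D; rewrite !partial_sumE -big_split /=; apply: eq_bigr => i _; rewrite scalerDl.
exact: (@cvgD _ _ _ _ totally_proper _ _ _ _ h1 h2).
Qed.

Lemma expansionZ (t : R) a x : expansion e a x -> expansion e (fun i => t * a i) (t *: x).
Proof.
move=> h1; rewrite /expansion.
have -> : summability.partial_sum (fun i => (t * a i) *: e i) =
   (fun D => t *: summability.partial_sum (fun i => a i *: e i) D).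
  by apply/funext => D; rewrite !partial_sumE scaler_sumr; apply: eq_bigr => i _; rewrite scalerA.
exact: cvgZl_tmp.
Qed.

Definition coef x : I -> R := sval (cid (he_basis x)).

Lemma coefP x : expansion e (coef x) x.
Proof. by rewrite /coef; case: cid => a []. Qed.

Lemma coef_unique a x : expansion e a x -> coef x = a.
Proof. by rewrite /coef; case: cid => b [h1 h2] /= /h2. Qed.

Lemma coef_linear i : linear ((fun x => coef x i) : X -> R^o).
Proof.
move=> t x y; have /coef_unique -> := expansionD (@expansionZ t _ _ (@coefP x)) (@coefP y).
by [].
Qed.

Lemma coef_finite a (D : {fset I}) : (forall i, i \notin D -> a i = 0) ->
  coef (\sum_(i <- D) a i *: e i) = a.
Proof. by move=> h; apply/coef_unique/expansion_finite. Qed.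

Lemma coef_basis i : coef (e i) = fun j => (j == i)%:R.
Proof.
have h j : j \notin [fset i]%fset -> (j == i)%:R = 0 :> R by rewrite inE => /negPf ->.
by have := coef_finite h; rewrite big_seq_fset1 eqxx scale1r.
Qed.

Lemma finite_part_le a x (D : {fset I}) : (forall i, `|a i| <= `|coef x i|) ->
  `|\sum_(i <- D) a i *: e i| <= `|x|.
Proof.
move=> h; pose b i := if i \in D then a i else 0.
have -> : \sum_(i <- D) a i *: e i = \sum_(i <- D) b i *: e i.
  by rewrite big_seq_cond [RHS]big_seq_cond; apply: eq_bigr => i; rewrite /b andbT => ->.
have hb : expansion e b (\sum_(i <- D) b i *: e i).
  by apply: expansion_finite => i; rewrite /b => /negPf ->.
apply: (he_unc hb (@coefP x)) => i.
by rewrite /b; case: ifP => // _; rewrite normr0.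
Qed.

Lemma coef_le x i : `|coef x i| <= `|x|.
Proof.
have := @finite_part_le (coef x) x [fset i]%fset (fun=> lexx _).
by rewrite big_seq_fset1 normrZ he_norm mulr1.
Qed.

Lemma coordinate_functional i : exists f : dual X, forall x, f x = coef x i.
Proof.
apply: (@dual_of_bounded _ _ _ 1); first exact: coef_linear.
by move=> x; rewrite mul1r; exact: coef_le.
Qed.

Lemma basis_approx x (eta : R) : 0 < eta ->
  exists D : {fset I}, `|x - \sum_(i <- D) coef x i *: e i| < eta.
Proof.
move=> eta0; have h0 := @coefP x; rewrite /expansion in h0; move/cvgrPdist_lt : h0 => /(_ _ eta0) h.
have [D hD] := @filter_ex _ _ totally_proper _ h.
by exists D; rewrite -partial_sumE.
Qed.

(** Finite sections of the expansion approximate [x], so on norm-bounded sets of functionals the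
    w*-topology is that of the coordinates. *)
Lemma coordinate_control x (C eta : R) : 0 <= C -> 0 < eta ->
  exists s : seq I, exists2 d : R, 0 < d & forall f g,
    (forall y, `|f y| <= C * `|y|) -> (forall y, `|g y| <= C * `|y|) ->
    (forall i, i \in s -> `|g (e i) - f (e i)| < d) -> `|g x - f x| < eta.
Proof.
move=> C0 eta0; have C1 : 0 < 4 * (C + 1) by rewrite mulr_gt0 // ltr_wpDl.
(* The tails of [f] and of [g] cost [eta / 4] each and the coordinates the remaining half; [C + 1]
   guards against [C = 0]. *)
have [D hD] : exists D : {fset I}, `|x - \sum_(i <- D) coef x i *: e i| < eta / (4 * (C + 1)).
  by apply: basis_approx; rewrite divr_gt0.
move: hD; set y := \sum_(i <- D) _ => hD.
pose M := \sum_(i <- D) `|coef x i| + 1.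
have M0 : 0 < M by rewrite ltr_wpDl // sumr_ge0.
exists (D : seq I), (eta / (2 * M)) => [|f g hf hg h]; first by rewrite divr_gt0 // mulr_gt0.
have tail (k : dual X) : (forall y, `|k y| <= C * `|y|) -> `|k x - k y| <= eta / 4.
  move=> hk; rewrite -(linfunB (dual_linear k)); apply: le_trans (hk _) _.
  apply: (@le_trans _ _ ((C + 1) * (eta / (4 * (C + 1))))).
    apply: ler_pM => //; [by rewrite lerDl|exact: ltW].
  by rewrite le_eqVlt; apply/orP; left; apply/eqP; field; rewrite gt_eqF // ltr_wpDl.
have main : `|g y - f y| <= eta / 2 * (\sum_(i <- D) `|coef x i| / M).
  rewrite /y (linfun_sum (dual_linear g)) (linfun_sum (dual_linear f)) -sumrB mulr_sumr.
  apply: le_trans (ler_norm_sum _ _ _) _; rewrite big_seq_cond [leRHS]big_seq_cond.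
  apply: ler_sum => i; rewrite andbT => iD.
  rewrite (linfunZ (dual_linear g)) (linfunZ (dual_linear f)) -mulrBr normrM.
  have -> : eta / 2 * (`|coef x i| / M) = `|coef x i| * (eta / (2 * M)).
    by field; rewrite gt_eqF.
  by rewrite ler_wpM2l // ltW // h.
have sM : \sum_(i <- D) `|coef x i| / M < 1.
  by rewrite -mulr_suml ltr_pdivrMr // mul1r /M ltrDl.
have main2 : `|g y - f y| < eta / 2.
  by apply: le_lt_trans main _; rewrite -[ltRHS]mulr1 ltr_pM2l // divr_gt0.
have -> : g x - f x = (g x - g y) + (g y - f y) - (f x - f y) by ring.
apply: le_lt_trans (ler_normB _ _) _; have := ler_normD (g x - g y) (g y - f y).
have := tail f hf; have := tail g hg; lra.
Qed.

Lemma dual_eq_basis f g : (forall i, f (e i) = g (e i)) -> f = g.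
Proof.
move=> h; apply: dual_eqP => x; apply/eqP; rewrite -subr_eq0 -normr_le0.
apply/ler_addgt0Pr => eta eta0; rewrite add0r.
have [C C0 hf] := dual_bounded f; have [C' C'0 hg] := dual_bounded g.
have b k y : `|k| <= C * `|y| \/ `|k| <= C' * `|y| -> `|k| <= (C + C') * `|y| :> R.
  by rewrite mulrDl => -[]/le_trans; apply; rewrite ?lerDl ?lerDr mulr_ge0 // ltW.
have [s [d d0 H]] := @coordinate_control x (C + C') eta (addr_ge0 (ltW C0) (ltW C'0)) eta0.
by apply/ltW/H => [y|y|i _]; [apply: b; right|apply: b; left|rewrite h subrr normr0].
Qed.

(* The multiplier [a / f] acts on [X] by 1-unconditionality; the functional is
   recovered from its finite sections by w*-compactness. *)
Lemma dual_solid f a (C : R) : (forall x, `|f x| <= C * `|x|) ->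
  (forall i, `|a i| <= `|f (e i)|) ->
  exists2 g : dual X, forall i, g (e i) = a i & forall x, `|g x| <= C * `|x|.
Proof.
move=> hf ha.
have sec (D : {fset I}) x : `|\sum_(i <- D) a i * coef x i| <= C * `|x|.
  (* Where [f (e i)] vanishes so does [a i], and the division by 0 is harmless. *)
  pose b i := a i / f (e i) * coef x i.
  have -> : \sum_(i <- D) a i * coef x i = f (\sum_(i <- D) b i *: e i).
    rewrite (linfun_sum (dual_linear f)); apply: eq_bigr => i _.
    rewrite (linfunZ (dual_linear f)) /b; have [f0|f0] := eqVneq (f (e i)) 0.
      have := ha i; rewrite f0 normr0 normr_le0 => /eqP ->.
      by rewrite !mul0r.
    by rewrite mulrAC divfK.
  have C0 : 0 <= C \/ `|x| = 0.
    have [->|x0] := eqVneq x 0; first by right; rewrite normr0.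
    by left; have := le_trans (normr_ge0 _) (hf x); rewrite pmulr_lge0 // normr_gt0.
  apply: le_trans (hf _) _.
  have le : `|\sum_(i <- D) b i *: e i| <= `|x|.
    apply: finite_part_le => i; rewrite /b normrM ler_piMl // normrM normfV.
    have [f0|f0] := eqVneq (f (e i)) 0; first by rewrite f0 normr0 invr0 mulr0.
    by rewrite ler_pdivrMr ?normr_gt0 // mul1r.
  case: C0 => [C0|x0]; first by rewrite ler_wpM2l.
  by move: le; rewrite x0 normr_le0 => /eqP ->; rewrite normr0.
have /choice[F hF] : forall D : {fset I}, exists h : dual X, forall x, h x = \sum_(i <- D) a i * coef x i.
  move=> D; apply: (@dual_of_bounded _ _ _ C); last exact: sec.
  move=> t x y; rewrite scaler_sumr -big_split /=; apply: eq_bigr => i _.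
  have -> : coef (t *: x + y) i = t * coef x i + coef y i := coef_linear i t x y.
  by rewrite /GRing.scale /=; ring.
have [U [UU sU]] := ultraFilterLemma totally_proper.
have PU : ProperFilter U by exact: ultra_proper.
have [g hg bg] := @ultra_dual_limit _ _ _ U F C UU (fun D x => eq_rect_r (fun z => `|z| <= _) (sec D x) (hF D x)).
exists g => // i.
have h1 : (fun D => F D (e i)) @ U --> a i.
  apply: cvg_near_cst; apply: sU; apply: filterS (totally_superset [fset i]%fset) => D /=.
  rewrite fsub1set => iD; rewrite hF (big_fsetD1 i) //= coef_basis eqxx mulr1.
  rewrite big_seq_cond big1 ?addr0 // => j; rewrite andbT in_fsetD1 => /andP[/negPf -> _].
  by rewrite mulr0.
exact: (@cvg_unique _ (@norm_hausdorff _ R^o) _ _ _ _ (hg (e i)) h1).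
Qed.

Lemma functional_sets_sub A (A' : set I) : functional_sets e A -> A' `<=` A -> functional_sets e A'.
Proof.
move=> [f [f1 f0]] A'A; have [C C0 hf] := dual_bounded f.
have [|g gE _] := @dual_solid f (fun i => if `[< A' i >] then 1 else 0) C hf.
  move=> i; case: ifP => [/asboolP/A'A/f1 ->|_]; first by [].
  by rewrite normr0.
by exists g; split=> i A'i; rewrite gE; case: asboolP.
Qed.

Lemma functional_setsU1 A i : functional_sets e A -> functional_sets e (i |` A).
Proof.
move=> [f [f1 f0]]; have [Ai|nAi] := pselect (A i).
  have -> : i |` A = A by apply/seteqP; split=> j; [case=> [->|]|right].
  by exists f.
have [h hE] := coordinate_functional i.
exists (f + h); split=> j.
  rewrite dual_addE hE coef_basis => -[/= ->|Aj]; first by rewrite eqxx f0 // add0r.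
  by rewrite f1 //; case: eqP => [E|]; [case: nAi; rewrite E|rewrite addr0].
move=> h'; rewrite dual_addE hE coef_basis f0; last by move=> Aj; apply: h'; right.
by rewrite add0r; case: eqP => [E|//]; case: h'; left.
Qed.

Definition level_set f (r : R) : set I := [set i | r < `|f (e i)|].

(** The indicator of the level set is dominated by the coordinates of [r^-1 *: f]. *)
Lemma level_set_functional f (r : R) : 0 < r -> functional_sets e (level_set f r).
Proof.
move=> r0; have [C C0 hf] := dual_bounded (r^-1 *: f).
have [|g gE _] := @dual_solid (r^-1 *: f) (fun i => if `[< level_set f r i >] then 1 else 0) C hf.
  move=> i; case: ifP => [/asboolP|_]; last by rewrite normr0.
  rewrite /level_set /= dual_scaleE normrM gtr0_norm ?invr_gt0 // normr1 => h.
  by rewrite ler_pdivlMl // mulr1 ltW.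
by exists g; split=> i Ai; rewrite gE; case: asboolP.
Qed.

Lemma ball_coordinate_nbhs (k : set_type (@dual_ball R X)) (V : set (set_type (@dual_ball R X))) :
  nbhs k V -> exists s : seq I, exists2 d : R, 0 < d &
    forall g : set_type (@dual_ball R X),
      (forall i, i \in s -> `|set_val g (e i) - set_val k (e i)| < d) -> V g.
Proof.
move=> /ball_nbhsP[s [eta eta0 h]].
suff [t [d d0 ht]] : exists t : seq I, exists2 d : R, 0 < d &
    forall g : set_type (@dual_ball R X),
      (forall i, i \in t -> `|set_val g (e i) - set_val k (e i)| < d) ->
      forall x, x \in s -> `|set_val g x - set_val k x| < eta.
  by exists t, d => // g /ht; exact: h.
elim: s {h} => [|x s [t [d d0 ht]]]; first by exists [::], 1.
have [t' [d' d'0 ht']] := coordinate_control x (@ler01 R) eta0.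
exists (t ++ t'), (Num.min d d') => [|g hg y]; first by rewrite lt_min d0.
rewrite inE => /predU1P[->|ys].
  apply: ht' => [z|z|i it']; rewrite ?mul1r ?ball_eval_le //.
  by have := hg i; rewrite mem_cat it' orbT lt_min => /(_ isT)/andP[].
apply: ht ys => i it; have := hg i; rewrite mem_cat it lt_min => /(_ isT)/andP[] //.
Qed.

End Basis.

(** * Strictly increasing lower semicontinuous maps *)

Section CriticalFamilies.
Context {I : choiceType}.

(* A countable encoding, through finite sets, of a strictly increasing lower
   semicontinuous map on [S]: [F n] collects the finite sets on which the map
   exceeds the n-th rational. *)
Definition critical_families (S : set (set I)) (F : nat -> set {fset I}) :=
  forall A i, S A -> A i -> exists n,
    (exists2 D, F n D & [set` D] `<=` A) /\
    forall D, F n D -> [set` D] `<=` A -> i \in D.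

End CriticalFamilies.

Section IncreasingMaps.
Context {R : realType} {X : normedModType R} {I : choiceType} (e : I -> X).
Hypotheses (he_basis : unconditional_basis e) (he_unc : one_unconditional e).
Local Notation S := (functional_sets e).
Local Notation K := (set_type (indicator_space e)).
Implicit Types (x y : K) (A : set I).

Lemma indicator_point A : S A -> exists x : K, set_val x = \1_A :> (I -> R).
Proof.
move=> SA; have h : indicator_space e \1_A by exists A.
by exists (SigSub (mem_set h)).
Qed.

Lemma indicator_support x : exists2 A, S A & set_val x = \1_A :> (I -> R).
Proof. by have [A SA Ax] := set_valP x; exists A. Qed.

Lemma indicator_nbhs x (V : set K) : nbhs x V -> exists s : seq I,
  forall y, (forall i, i \in s -> set_val y i = set_val x i) -> V y.
Proof.
move=> [_ [[W oW <-] /= Wx WV]].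
have [s [eta eta0 h]] := ptws_nbhsP (open_nbhs_nbhs (conj oW Wx)).
by exists s => y yx; apply/WV/h => i is_; rewrite yx // subrr normr0.
Qed.

Lemma nbhs_indicator x (s : seq I) :
  \forall y \near nbhs x, forall i, i \in s -> set_val y i = set_val x i.
Proof.
elim: s => [|j s IH]; first by apply: nearW.
have cj : continuous (fun y : K => set_val y j).
  move=> y; apply: (@continuous_comp _ _ _ (set_val : K -> {ptws I -> R}) (fun a : {ptws I -> R} => a j)).
    exact: initial_continuous.
  exact: (@proj_continuous I (fun=> R) j).
have /cvgrPdist_lt/(_ 1 ltr01) hj := cj x.
near=> y; move=> i; rewrite inE => /predU1P[->|]; last by move: i; near: y.
have : `|set_val x j - set_val y j| < 1 by near: y.
have [A _ ->] := indicator_support x; have [B _ ->] := indicator_support y.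
rewrite !indicE; case: (_ \in A); case: (_ \in B) => //=; rewrite ?subr0 ?sub0r ?normrN normr1 ltxx //.
Unshelve. all: by end_near. Qed.

(** Take a rational [q] strictly between the values of [rho] at [A \ i] and at [A]. By lower
    semicontinuity [rho] exceeds [q] already on a finite subset of [A]; a finite subset avoiding [i]
    lies in [A \ i], where [rho] is below [q]. *)
Lemma critical_of_increasing (rho : K -> R) : strictly_increasing rho ->
  lower_semicontinuous (fun x => (rho x)%:E) -> exists F, critical_families S F.
Proof.
move=> incr lsc.
exists (fun n => [set D : {fset I} | exists q : rat, choice.pickle q = n /\
  exists2 x : K, set_val x = \1_[set` D] :> (I -> R) & ratr q < rho x]).
move=> A i SA Ai.
have [x xA] := indicator_point SA.
have [y yA] := indicator_point (functional_sets_sub he_basis he_unc SA (@subDsetl _ A [set i])).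
have yx : rho y < rho x.
  apply: incr; split=> [j|].
    by rewrite xA yA !indicE ler_nat; case: (boolP (j \in A `\ i)) => // /set_mem[/mem_set ->].
  move=> /(congr1 (fun a => a i)); rewrite xA yA !indicE (mem_set Ai).
  have -> : (i \in A `\ i) = false by apply/negP => /set_mem[_]; apply.
  by move/esym/eqP; rewrite oner_eq0.
have [q] := rat_in_itvoo yx; rewrite in_itv /= => /andP[yq qx].
exists (choice.pickle q); split.
  have [V nV Vq] := lsc x (ratr q) qx.
  have [s hs] := indicator_nbhs nV.
  pose D := [fset j in s | `[< A j >]]%fset.
  have DA : [set` D] `<=` A by move=> j /=; rewrite !inE /= => /andP[_ /asboolP].
  have [z zD] := indicator_point (functional_sets_sub he_basis he_unc SA DA).
  exists D => //; exists q; split=> //; exists z => //.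
  apply/Vq/hs => j js; rewrite zD xA !indicE; congr (_%:R); apply: congr1.
  by apply/idP/idP => /set_mem h; apply/mem_set; [exact: DA|rewrite /= !inE /= js; exact/asboolP].
move=> D [q' [/(pcan_inj choice.pickleK) -> [z zD qz]]] DA.
apply: contrapT => iD; have : rho z <= rho y.
  have le j : set_val z j <= set_val y j.
    rewrite zD yA !indicE ler_nat; case: (boolP (j \in [set` D])) => // /set_mem h.
    by rewrite mem_set //; split; [exact: DA|move=> /= E; apply: iD; rewrite -E].
  have [E|ne] := pselect (set_val z = set_val y); last exact/ltW/incr.
  by rewrite (val_inj E).
by move=> /(lt_le_trans qz)/(lt_trans yq); rewrite ltxx.
Qed.

(** [rho] adds [2^-(n+1)] for each [n] such that the support contains a member of [F n]; finiteness
    of members gives lower semicontinuity. If [B] lacks some [i] of [A], then for the [n] attached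
    to [A] and [i] no member fits into [B], and this term is gained. *)
Lemma increasing_of_critical (F : nat -> set {fset I}) : critical_families S F ->
  exists rho : K -> R, [/\ forall x, 0 <= rho x <= 1, strictly_increasing rho
    & lower_semicontinuous (fun x => (rho x)%:E)].
Proof.
move=> hF.
pose P n x := exists2 D, F n D & forall i, i \in D -> set_val x i != 0.
pose T x n : R := (`[< P n x >])%:R * 2^-1 ^+ n.+1.
pose Sm x m := \sum_(0 <= n < m) T x n.
have h0 n : 0 < 2^-1 ^+ n :> R by rewrite exprn_gt0 // invr_gt0.
have T0 x n : 0 <= T x n by rewrite mulr_ge0 // ltW.
have S0 x m : 0 <= Sm x m by apply: sumr_ge0.
have S1 x m : Sm x m <= 1.
  suff : Sm x m <= 1 - 2^-1 ^+ m by move/le_trans; apply; rewrite gerBl ltW.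
  rewrite /Sm; elim: m => [|m IH]; first by rewrite big_geq // expr0 subrr.
  rewrite big_nat_recr //=; have : T x m <= 2^-1 ^+ m.+1.
    by apply: ler_piMl; [exact/ltW|rewrite lern1 leq_b1].
  have := exprS (2^-1 : R) m; lra.
have Smono x m m' : (m <= m')%N -> Sm x m <= Sm x m'.
  by move=> mm'; rewrite /Sm (big_cat_nat (leq0n m) mm') /= lerDl sumr_ge0.
pose rho x := sup (range (Sm x)).
have ub x : ubound (range (Sm x)) 1 by move=> _ [m _ <-].
have ne x : range (Sm x) !=set0 by exists (Sm x 0); exists 0.
have leS x m : Sm x m <= rho x by apply: (le_supP _ (ub x)); exists m.
exists rho; split=> [x|y x [yx yxne]|x c].
- by rewrite (le_trans (S0 x 0) (leS x 0)) sup_leP.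
- have [A SA xA] := indicator_support x; have [B SB yB] := indicator_support y.
  have BA : B `<=` A.
    move=> i Bi; have := yx i; rewrite xA yB !indicE (mem_set Bi).
    by case: (boolP (i \in A)) => [/set_mem|_] //; rewrite ler10.
  have [i Ai nBi] : exists2 i, A i & ~ B i.
    apply: contrapT => h; apply: yxne; rewrite xA yB.
    have -> // : B = A; apply/seteqP; split=> // i Ai.
    by apply: contrapT => nBi; apply: h; exists i.
  have supp (C : set I) i0 : (\1_C i0 != 0 :> R) <-> C i0.
    rewrite indicE; case: (boolP (i0 \in C)) => [/set_mem|/negP h]; first by rewrite oner_eq0.
    by rewrite eqxx; split=> // /mem_set.
  have Pmono n : P n y -> P n x.
    by move=> [D FD h]; exists D => // j /h; rewrite xA yB => /supp/BA/supp.
  have Tmono n : T y n <= T x n.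
    rewrite /T; apply: ler_wpM2r; first exact/ltW.
    by rewrite ler_nat; case: asboolP => // /Pmono Px; rewrite asboolT.
  have [n [[D FD DA] crit]] := hF A i SA Ai.
  have Pnx : P n x by exists D => // j jD; rewrite xA; apply/supp/DA.
  have nPny : ~ P n y.
    move=> [D' FD' h]; apply: nBi; apply/supp; rewrite -yB; apply: (h); apply: crit => //.
    by move=> j /= /h; rewrite yB => /supp/BA.
  have step m : Sm y m + 2^-1 ^+ n.+1 <= rho x.
    apply: le_trans (leS x (maxn m n.+1)).
    apply: (@le_trans _ _ (Sm y (maxn m n.+1) + 2^-1 ^+ n.+1)).
      by rewrite lerD2r Smono // leq_maxl.
    rewrite /Sm !big_mkord; have nm : (n < maxn m n.+1)%N by rewrite leq_max ltnSn orbT.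
    rewrite (bigD1 (Ordinal nm)) //= [leRHS](bigD1 (Ordinal nm)) //=.
    have -> : T y n = 0 by rewrite /T asboolF // mul0r.
    have -> : T x n = 2^-1 ^+ n.+1 by rewrite /T asboolT // mul1r.
    by rewrite add0r [leRHS]addrC; apply: lerD => //; apply: ler_sum.
  have : rho y <= rho x - 2^-1 ^+ n.+1.
    by apply: sup_leP (ne y) _ => _ [m _ <-]; rewrite lerBrDr.
  by move/le_lt_trans; apply; rewrite ltrBlDr ltrDl.
- rewrite lte_fin => /(sup_gtP (ne x) (ub x))[_ [m _ <-] cm].
  have near_le : \forall y \near nbhs x, Sm x m <= Sm y m.
    have one n : \forall y \near nbhs x, T x n <= T y n.
      have [[D FD h]|nP] := pselect (P n x); last first.
        by apply: nearW => y; rewrite {1}/T asboolF // mul0r.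
      apply: filterS (nbhs_indicator x D) => y hy.
      rewrite /T; apply: ler_wpM2r; first exact/ltW.
      rewrite ler_nat (_ : `[< P n y >] = true) ?leq_b1 //; apply/asboolP.
      by exists D => // i iD; rewrite hy // h.
    rewrite /Sm; elim: (m) => [|k IH]; first by apply: nearW => y; rewrite !big_geq.
    near=> y; rewrite !big_nat_recr //= lerD //; near: y; [exact: IH|exact: one].
  exists [set y | Sm x m <= Sm y m]; first exact: near_le.
  by move=> y /= h; rewrite lte_fin (lt_le_trans cm) // (le_trans h).
Unshelve. all: by end_near. Qed.

End IncreasingMaps.

(** * Averages of strictly convex functions over signs *)

Section SignAverages.
Context {R : realType} {I : choiceType}.
Implicit Types (a b c : I -> R) (s t : seq I) (i j k : I) (A : set I) (G : (I -> R) -> R).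

Definition shift a i (u : R) : I -> R := fun k => a k + u * (k == i)%:R.

Lemma shiftC a i j u v : shift (shift a i u) j v = shift (shift a j v) i u.
Proof. by apply/funext => k; rewrite /shift addrAC. Qed.

Lemma shift_neq a i (u v : R) : u != v -> shift a i u <> shift a i v.
Proof.
move=> uv /(congr1 (fun f => f i)); rewrite /shift eqxx !mulr1 => /addrI E.
by rewrite E eqxx in uv.
Qed.

Fixpoint sign_average G s a : R :=
  if s is i :: s' then
    2^-1 * (sign_average G s' (shift a i 1) + sign_average G s' (shift a i (-1)))
  else G a.

Definition spread G i a := 2^-1 * (G (shift a i 1) + G (shift a i (-1))).

(** Shifts commute, so the sign at [i] can be averaged innermost. *)
Lemma sign_average_gap G s a i :
  sign_average G (i :: s) a - sign_average G s a =
  sign_average (fun b => spread G i b - G b) s a.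
Proof.
elim: s a => [//|j s IH] a.
have := IH (shift a j 1); have := IH (shift a j (-1)); rewrite /= => <- <-.
rewrite ![shift (shift a j _) i _]shiftC; by field.
Qed.

(** When [1_A] exists in the dual, solidity makes every such [a] the coordinates of a functional,
    with a bound depending only on [A]. *)
Definition dominated A a := (forall k, `|a k| <= 1) /\ (forall k, ~ A k -> a k = 0).

Lemma dominated_sub A A' a : A `<=` A' -> dominated A a -> dominated A' a.
Proof. by move=> AA' [h1 h2]; split=> // k kA; apply: h2 => /AA'. Qed.

Lemma dominated_shift A a i u : dominated A a -> A i -> a i = 0 -> `|u| <= 1 ->
  dominated A (shift a i u).
Proof.
move=> [h1 h2] Ai ai u1; split=> k.
  by rewrite /shift; case: eqP => [->|_]; rewrite ?ai ?add0r ?mulr1 // mulr0 addr0.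
move=> nAk; rewrite /shift h2 // add0r; case: eqP => [E|]; last by rewrite mulr0.
by rewrite E in nAk.
Qed.

Definition sign_vector t a :=
  forall k, if k \in t then `|a k| = 1 else a k = 0.

Lemma sign_vector_nil : sign_vector [::] (fun=> 0). Proof. by []. Qed.

Lemma sign_vector_shift t a j (u : R) : sign_vector t a -> j \notin t -> `|u| = 1 ->
  sign_vector (j :: t) (shift a j u).
Proof.
move=> h jt u1 k; rewrite inE /shift; have := h k; case: eqP => [->|_] /=.
  by rewrite (negPf jt) => ->; rewrite add0r mulr1.
by rewrite mulr0 addr0.
Qed.

Lemma sign_vector_dominated A t a : [set` t] `<=` A -> sign_vector t a -> dominated A a.
Proof.
move=> tA h; split=> k; have := h k; case: ifP => // kt; first by move=> ->.
  by move=> ->; rewrite normr0.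
by move=> _ /(_ (tA k kt)).
Qed.

Section Convex.
Variables (A : set I) (G : (I -> R) -> R).
Hypothesis convexG : forall a b c, dominated A a -> dominated A b ->
  (forall k, a k + b k = 2 * c k) -> G c <= 2^-1 * (G a + G b).

Let adm s a := dominated A a /\ forall k, k \in s -> a k = 0.

Let adm_shift i s a (u : R) : uniq (i :: s) -> A i -> adm (i :: s) a -> `|u| <= 1 ->
  adm s (shift a i u).
Proof.
move=> /= /andP[iis us] Ai [da a0] u1; split.
  by apply: dominated_shift => //; apply: a0; rewrite mem_head.
move=> k ks; rewrite /shift a0 ?inE ?ks ?orbT // add0r; case: eqP => [E|]; last by rewrite mulr0.
by rewrite -E ks in iis.
Qed.

Lemma sign_average_convex s a b c : uniq s -> [set` s] `<=` A -> adm s a -> adm s b ->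
  (forall k, a k + b k = 2 * c k) ->
  sign_average G s c <= 2^-1 * (sign_average G s a + sign_average G s b).
Proof.
elim: s a b c => [a b c _ _ [da _] [db _]|i s IH a b c us sA aa ab h]; first exact: convexG.
have Ai : A i by apply: sA; rewrite /= mem_head.
have s'A : [set` s] `<=` A by move=> k ks; apply: sA; rewrite /= inE ks orbT.
have us' : uniq s by case/andP: us.
have one (u : R) : `|u| <= 1 -> sign_average G s (shift c i u) <=
    2^-1 * (sign_average G s (shift a i u) + sign_average G s (shift b i u)).
  move=> u1; apply: IH => //; [exact: adm_shift|exact: adm_shift|].
  by move=> k; have := h k; rewrite /shift; lra.
have := one 1; have := one (-1); rewrite normrN normr1 lexx /= => /(_ isT) h1 /(_ isT) h2.
lra.
Qed.

Lemma sign_average_cons i s : uniq (i :: s) -> [set` i :: s] `<=` A ->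
  sign_average G s (fun=> 0) <= sign_average G (i :: s) (fun=> 0).
Proof.
move=> us sA; have s'A : [set` s] `<=` A by move=> k ks; apply: sA; rewrite /= inE ks orbT.
have Ai : A i by apply: sA; rewrite /= mem_head.
have a0 : adm (i :: s) (fun=> 0) by split=> //; split=> [k|//]; rewrite normr0.
rewrite [leRHS]/=; apply: sign_average_convex => //; first by case/andP: us.
- by apply: adm_shift => //; rewrite normr1.
- by apply: adm_shift => //; rewrite normrN normr1.
- by move=> k; rewrite /shift; ring.
Qed.

Lemma sign_average_cat s' s : uniq (s' ++ s) -> [set` s' ++ s] `<=` A ->
  sign_average G s (fun=> 0) <= sign_average G (s' ++ s) (fun=> 0).
Proof.
elim: s' => [//|i s' IH us sA]; apply: le_trans (sign_average_cons us sA).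
apply: IH; first by case/andP: us.
by move=> k ks; apply: sA; rewrite /= inE; apply/orP; right.
Qed.

Lemma sign_average_bound (C : R) s a : (forall b, dominated A b -> G b <= C) ->
  uniq s -> [set` s] `<=` A -> adm s a -> sign_average G s a <= C.
Proof.
move=> hC; elim: s a => [a _ _ [da _]|i s IH a us sA aa]; first exact: hC.
have Ai : A i by apply: sA; rewrite /= mem_head.
have s'A : [set` s] `<=` A by move=> k ks; apply: sA; rewrite /= inE ks orbT.
have us' : uniq s by case/andP: us.
have h1 : sign_average G s (shift a i 1) <= C by apply: IH => //; apply: adm_shift; rewrite ?normr1.
have h2 : sign_average G s (shift a i (-1)) <= C by apply: IH => //; apply: adm_shift; rewrite ?normrN ?normr1.
rewrite /=; lra.
Qed.

Lemma sign_average_bound0 (C : R) s : (forall b, dominated A b -> G b <= C) ->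
  uniq s -> [set` s] `<=` A -> sign_average G s (fun=> 0) <= C.
Proof.
by move=> hC us sA; apply: sign_average_bound => //; split=> //; split=> [k|//]; rewrite normr0.
Qed.

End Convex.

(* A function that is nonnegative on sign vectors and at least [eta] on those
   extending [sg] on [s0] averages to at least [eta / 2 ^ #s0], as a sign
   vector agrees with [sg] on [s0] with probability [1 / 2 ^ #s0]. *)
Lemma sign_average_lower (A : set I) (K : (I -> R) -> R) (eta : R) (s0 : seq I) (sg : I -> R) :
    0 <= eta ->
    (forall t a, [set` t] `<=` A -> sign_vector t a -> 0 <= K a) ->
    (forall k, k \in s0 -> `|sg k| = 1) ->
    (forall t a, [set` t] `<=` A -> sign_vector t a -> {subset s0 <= t} ->
       {in s0, a =1 sg} -> eta <= K a) ->
  forall s, uniq s -> [set` s] `<=` A -> {subset s0 <= s} ->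
    eta * 2^-1 ^+ size s0 <= sign_average K s (fun=> 0).
Proof.
move=> eta0 K0 sg1 Keta.
(* In the induction [t] holds the coordinates whose signs, recorded in [a], are already drawn; only
   those of [s0] still in [s] cost a factor one half. *)
suff main s t a : uniq s -> [set` s] `<=` A -> [set` t] `<=` A ->
    (forall k, k \in s -> k \notin t) -> sign_vector t a ->
    0 <= sign_average K s a /\
    ((forall k, k \in s0 -> (k \in t /\ a k = sg k) \/ k \in s) ->
     eta * 2^-1 ^+ count (mem s0) s <= sign_average K s a).
  move=> s us sA s0s; have [_ h] := main s [::] (fun=> 0) us sA (fun=> (fun H => match notF H with end))
    (fun=> fun=> isT) sign_vector_nil.
  apply: le_trans (h _); last by move=> k /s0s; right.
  rewrite ler_wpM2l // ler_wiXn2l ?invr_ge0 ?ler0n // ?invf_le1 ?ler1n //.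
  rewrite -size_filter; apply: uniq_leq_size; first exact: filter_uniq.
  by move=> k; rewrite mem_filter => /andP[].
elim: s t a => [|j s IH] t a us sA tA st va.
  rewrite /= expr0 mulr1; split; first exact: K0 va.
  by move=> h; apply: (Keta t) => // k /h [] // [].
have Aj : A j by apply: sA; rewrite /= mem_head.
have s'A : [set` s] `<=` A by move=> k ks; apply: sA; rewrite /= inE ks orbT.
have jtA : [set` j :: t] `<=` A by move=> k; rewrite /= inE => /predU1P[->|/tA].
have [js us'] := andP us; have jt : j \notin t by apply: st; rewrite mem_head.
have st' k : k \in s -> k \notin j :: t.
  move=> ks; rewrite inE negb_or st ?andbT ?inE ?ks ?orbT //.
  by apply: contraNneq js => <-.
have step (u : R) : `|u| = 1 -> 0 <= sign_average K s (shift a j u) /\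
    ((forall k, k \in s0 -> (k \in j :: t /\ shift a j u k = sg k) \/ k \in s) ->
     eta * 2^-1 ^+ count (mem s0) s <= sign_average K s (shift a j u)).
  by move=> u1; apply: IH => //; exact: sign_vector_shift.
have [p1 q1] := step 1 (normr1 _); have [p2 q2] := step (-1) (etrans (normrN _) (normr1 _)).
split; first by rewrite /= mulr_ge0 ?invr_ge0 ?addr_ge0.
move=> h.
have aj : a j = 0 by have := va j; rewrite (negPf jt).
have ext (u : R) : (j \in s0 -> u = sg j) ->
    forall k, k \in s0 -> (k \in j :: t /\ shift a j u k = sg k) \/ k \in s.
  move=> hu k ks0; have [E|kj] := eqVneq k j.
    by left; rewrite E mem_head /shift eqxx aj add0r mulr1 -hu // -E.
  have [[kt ak]|] := h k ks0; last by rewrite inE (negPf kj); right.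
  by left; rewrite inE kt orbT /shift (negPf kj) mulr0 addr0.
(* Off [s0] both signs keep the pattern possible. On [s0] only the sign [sg j] does, and the other
   half of the mean is merely nonnegative. *)
rewrite [count _ _]/=; have [js0|js0] := boolP (j \in s0); last first.
  have := q1 (ext 1 _); have := q2 (ext (-1) _); rewrite (negPf js0) add0n /=.
  move=> /(_ (fun H => match notF H with end)) h2 /(_ (fun H => match notF H with end)) h1; lra.
rewrite add1n exprS; have := sg1 j js0; have [s1|s1] := leP 0 (sg j).
  rewrite ger0_norm // => E; have := q1 (ext 1 (fun=> esym E)); rewrite /=; lra.
rewrite ltr0_norm // => E; have Em : -1 = sg j by rewrite -E opprK.
have := q2 (ext (-1) (fun=> Em)); rewrite /=; lra.
Qed.


Section Gap.
Variables (A : set I) (G : (I -> R) -> R) (i : I).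
Hypothesis Ai : A i.
Hypothesis convexG : forall a b c, dominated A a -> dominated A b ->
  (forall k, a k + b k = 2 * c k) -> G c <= 2^-1 * (G a + G b).
Hypothesis strictG : forall a b c, dominated A a -> dominated A b ->
  (forall k, a k + b k = 2 * c k) -> a <> b -> G c < 2^-1 * (G a + G b).
Hypothesis lscG : forall a (x : R), dominated A a -> x < G a ->
  exists s, forall b, dominated A b -> {in s, b =1 a} -> x < G b.

Local Notation A' := (A `\ i).

Let A'A : A' `<=` A. Proof. exact: subDsetl. Qed.

Let dominated_spread a (u : R) : dominated A' a -> `|u| = 1 -> dominated A (shift a i u).
Proof.
move=> da u1; apply: dominated_shift => //; [exact: dominated_sub da|by apply: da.2 => -[_]; apply|].
by rewrite u1.
Qed.

Let spread_lsc a (x : R) : dominated A' a -> x < spread G i a ->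
  exists s, forall b, dominated A' b -> {in s, b =1 a} -> x < spread G i b.
Proof.
move=> da xa; pose d := spread G i a - x.
have d0 : 0 < d by rewrite subr_gt0.
have d1 := dominated_spread da (normr1 _).
have d2 := dominated_spread da (etrans (normrN _) (normr1 _)).
have [s1 h1] := @lscG _ (G (shift a i 1) - d) d1 (ltac:(by rewrite ltrBlDr ltrDl)).
have [s2 h2] := @lscG _ (G (shift a i (-1)) - d) d2 (ltac:(by rewrite ltrBlDr ltrDl)).
exists (s1 ++ s2) => b db ba.
have b1 : G (shift a i 1) - d < G (shift b i 1).
  apply: h1; first by apply: dominated_spread; rewrite ?normr1.
  by move=> k ks; rewrite /shift ba // mem_cat ks.
have b2 : G (shift a i (-1)) - d < G (shift b i (-1)).
  apply: h2; first by apply: dominated_spread; rewrite ?normrN ?normr1.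
  by move=> k ks; rewrite /shift ba // mem_cat ks orbT.
have E : d = spread G i a - x by [].
move: E b1 b2; rewrite /spread; lra.
Qed.

Let spread_gt a : dominated A' a -> G a < spread G i a.
Proof.
move=> da; apply: strictG.
- exact: dominated_spread (normr1 _).
- by apply: dominated_spread; rewrite ?normrN ?normr1.
- by move=> k; rewrite /shift; ring.
- apply: shift_neq; rewrite -subr_eq0 opprK; by rewrite gt_eqF // addr_gt0.
Qed.

Definition extends (p p' : seq I * (I -> R)) :=
  {subset p.1 <= p'.1} /\ {in p.1, p'.2 =1 p.2}.

Let extends_refl p : extends p p. Proof. by split. Qed.

Let pattern (p : seq I * (I -> R)) := [set` p.1] `<=` A' /\ sign_vector p.1 p.2.

Let pattern_dominated p : pattern p -> dominated A' p.2.
Proof. by move=> [h1 h2]; apply: sign_vector_dominated h2. Qed.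

(* A sign pattern is the midpoint of two sign vectors on all of [A'], and [G]
   exceeds [x] at one of these as soon as it does at the pattern. *)
Let persist p (x : R) : pattern p -> x < G p.2 -> exists p',
  [/\ pattern p', extends p p' &
   forall b, dominated A' b -> {in p'.1, b =1 p'.2} -> x < G b].
Proof.
move=> pp xp; have [tA vp] := pp; have dp := pattern_dominated pp.
pose f (u : R) k := if k \in p.1 then p.2 k else if `[< A' k >] then u else 0.
have df (u : R) : `|u| = 1 -> dominated A' (f u).
  move=> u1; split=> k; rewrite /f; case: ifP => kp.
  - exact: dp.1.
  - by case: ifP; rewrite ?u1 ?normr0.
  - by move=> nA; exact: dp.2.
  - by case: asboolP.
have [u u1 xf] : exists2 u : R, `|u| = 1 & x < G (f u).
  apply: contrapT => h.
  have h1 (u : R) : `|u| = 1 -> G (f u) <= x by move=> u1; rewrite leNgt; apply/negP => xf; apply: h; exists u.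
  have m1 : `|(- 1 : R)| = 1 by rewrite normrN normr1.
  have := @convexG (f 1) (f (-1)) p.2 (dominated_sub A'A (df _ (normr1 _))) (dominated_sub A'A (df _ m1)).
  have hk k : f 1 k + f (-1) k = 2 * p.2 k.
    have := vp k; rewrite /f; case: ifP => _; first by move=> _; ring.
    by move=> ->; case: ifP => _; ring.
  move=> /(_ hk); have := h1 1 (normr1 _); have := h1 _ m1; move: xp; lra.
have [s hs] := lscG (dominated_sub A'A (df u u1)) xf.
pose t := p.1 ++ [seq k <- s | `[< A' k >]].
have tA' : [set` t] `<=` A'.
  by move=> k; rewrite /= mem_cat mem_filter => /orP[/tA|/andP[/asboolP]].
pose g k := if k \in t then f u k else 0.
exists (t, g); split=> [| |b db bg].
- split=> // k; rewrite /g /=; case: (boolP (k \in t)) => kt //; rewrite /f; have := vp k.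
  by case: ifP => // _ _; rewrite asboolT //; exact: tA'.
- split=> [k kp|k kp] /=; first by rewrite mem_cat kp.
  by rewrite /g /t mem_cat kp /f kp.
- apply: hs; first exact: dominated_sub db.
  move=> k ks; have [kA|kA] := pselect (A' k); last by rewrite db.2 // (df u u1).2.
  have kt : k \in t by rewrite mem_cat mem_filter ks andbT; apply/orP; right; apply/asboolP.
  by rewrite (bg k kt) /= /g kt.
Qed.

(** Otherwise patterns are extended step by step so that, for each rational pair [q < q'] and
    infinitely often, either [G] stays above [q] on all further extensions or [spread] is below
    [q']. At the limit vector [g] strict convexity gives rationals with
    [G g < q < q' < spread G i g]; the first case contradicts the former inequality, the second the
    lower semicontinuity of [spread]. *)
Lemma uniform_gap : exists p q, exists2 eta : R, 0 < eta &
  [/\ pattern p, G p.2 <= q &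
   forall p', pattern p' -> extends p p' -> G p'.2 <= q /\ q + eta <= spread G i p'.2].
Proof.
apply: contrapT => no.
(* The 2-adic valuation of [n + 1] takes every value infinitely often, so each pair is treated at
   arbitrarily late stages. *)
have step : forall np : (nat * (seq I * (I -> R))), exists p', pattern np.2 ->
   [/\ pattern p', extends np.2 p' & forall q q' : rat,
     choice.unpickle (logn 2 np.1.+1) = Some (q, q') -> (ratr q : R) < ratr q' ->
     (forall b, dominated A' b -> {in p'.1, b =1 p'.2} -> ratr q < G b) \/
     spread G i p'.2 < ratr q'].
  move=> [n p]; have [pp|] := pselect (pattern p); last by exists p.
  rewrite /=; case E : (choice.unpickle (logn 2 n.+1)) => [[q q']|]; last by exists p => _; split; [|exact: extends_refl|].
  have [qq'|qq'] := ltP (ratr q : R) (ratr q'); last first.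
    by exists p => _; split; [|exact: extends_refl|move=> _ _ [<- <-]; rewrite ltNge qq'].
  have [p' [pp' ext alt]] : exists p', [/\ pattern p', extends p p' &
      ratr q < G p'.2 \/ spread G i p'.2 < ratr q'].
    apply: contrapT => h; apply: no; exists p, (ratr q), (ratr q' - ratr q).
      by rewrite subr_gt0.
    have h' p' : pattern p' -> extends p p' -> G p'.2 <= ratr q /\ ratr q' <= spread G i p'.2.
      move=> pp' ext; rewrite !leNgt; split; apply/negP => H; apply: h; exists p'; split=> //.
        by left.
      by right.
    split=> //; first exact: (h' p pp (extends_refl p)).1.
    by move=> p' pp' ext; rewrite subrKC; exact: h'.
  case: alt => [/(persist pp')[p2 [pp2 [ss e2] hb]]|alt].
    exists p2 => _; split=> //; last by move=> _ _ [<- <-] _; left.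
    split=> [k /ext.1/ss //|k kp]; by rewrite e2 ?ext.1 ?ext.2.
  by exists p' => _; split=> // _ _ [<- <-] _; right.
have [next hnext] := choice step.
pose P := fix P n := if n is m.+1 then next (m, P m) else ([::], fun=> 0).
have PP n : pattern (P n).
  elim: n => [|n IH]; first by split=> // k.
  by have [] := hnext (n, P n) IH.
have Pext n : extends (P n) (P n.+1) by have [] := hnext (n, P n) (PP n).
have Pmono n m : extends (P n) (P (n + m)%N).
  elim: m => [|m [h1 h2]]; first by rewrite addn0.
  rewrite addnS; have [h3 h4] := Pext (n + m)%N.
  by split=> [k /h1/h3 //|k kp]; rewrite h4 ?h2 // h1.
have Ple n m : (n <= m)%N -> extends (P n) (P m).
  by move=> /subnKC <-; exact: Pmono.
have /choice[g hg] : forall k, exists r : R, (forall n, k \in (P n).1 -> r = (P n).2 k) /\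
    ((forall n, k \notin (P n).1) -> r = 0).
  move=> k; have [[n kn]|h] := pselect (exists n, k \in (P n).1); last first.
    exists 0; split=> // n kn; by case: h; exists n.
  exists ((P n).2 k); split=> [m km|/(_ n)]; last by rewrite kn.
  have [nm|mn] := leqP n m; first by rewrite (Ple _ _ nm).2.
  by rewrite (Ple _ _ (ltnW mn)).2.
have dg : dominated A' g.
  split=> k.
    have [[n kn]|h] := pselect (exists n, k \in (P n).1).
      by rewrite ((hg k).1 n kn); exact: (pattern_dominated (PP n)).1.
    rewrite (hg k).2 ?normr0 // => n; apply/negP => kn; by apply: h; exists n.
  move=> nA; rewrite (hg k).2 // => n; apply/negP => kn; apply: nA; exact: (PP n).1.
have agree s : exists n, forall m, (n <= m)%N -> {in s, (P m).2 =1 g}.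
  elim: s => [|k s [n hn]]; first by exists 0.
  have [[n' kn]|h] := pselect (exists n, k \in (P n).1).
    exists (maxn n n') => m; rewrite geq_max => /andP[nm n'm] k'; rewrite inE => /predU1P[->|].
      by rewrite ((hg k).1 m) //; exact: (Ple _ _ n'm).1.
    exact: hn.
  have nk m : k \notin (P m).1 by apply/negP => km; apply: h; exists m.
  exists n => m nm k'; rewrite inE => /predU1P[->|]; last exact: hn.
  by rewrite (hg k).2 //; have := (PP m).2 k; rewrite (negPf (nk m)).
have [q] := rat_in_itvoo (spread_gt dg); rewrite in_itv /= => /andP[gq qg].
have [q'] := rat_in_itvoo qg; rewrite in_itv /= => /andP[qq' q'g].
have [s hs] := spread_lsc dg q'g.
have [n0 hn0] := agree s.
pose c := choice.pickle (q, q').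
(* A stage beyond [n0] at which the pair coded by [c] is treated. *)
pose n := (2 ^ c * n0.*2.+1).-1.
have nE : n.+1 = (2 ^ c * n0.*2.+1)%N by rewrite prednK // muln_gt0 expn_gt0.
have logE : logn 2 n.+1 = c.
  rewrite nE lognM ?expn_gt0 // lognX logn_prime // eqxx muln1.
  by rewrite logn_coprime ?addn0 // coprime2n /= odd_double.
have n0n : (n0 <= n)%N.
  rewrite -ltnS nE; apply: (@leq_trans n0.*2.+1); first by rewrite ltnS -addnn leq_addr.
  by rewrite leq_pmull // expn_gt0.
have [_ _ /(_ q q')] := hnext (n, P n) (PP n).
rewrite logE choice.pickleK => /(_ erefl qq')[h|h].
  have : ratr q < G g by apply: h => // k kn; exact: (hg k).1 n.+1 kn.
  by move=> /(lt_trans gq); rewrite ltxx.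
have : ratr q' < spread G i (P n.+1).2.
  apply: hs; first exact: pattern_dominated (PP n.+1).
  exact: hn0 (leqW n0n).
by move=> /(lt_trans h); rewrite ltxx.
Qed.

(** The gain [eta / 2 ^ #s0] from adding [i] depends on the pattern of [uniform_gap] alone and not
    on [s], hence it survives the supremum. *)
Lemma sign_average_sup_lt (C : R) : (forall b, dominated A b -> G b <= C) ->
  sup [set sign_average G s (fun=> 0) | s in [set s | uniq s /\ [set` s] `<=` A']] <
  sup [set sign_average G s (fun=> 0) | s in [set s | uniq s /\ [set` s] `<=` A]].
Proof.
move=> hC; have [[s1 sg] [q [eta eta0 [[s1A sgv] _ gap]]]] := uniform_gap.
pose s0 := undup s1.
have s01 : s0 =i s1 by exact: mem_undup.
have s0A : [set` s0] `<=` A' by move=> k; rewrite /= s01; exact: s1A.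
pose de := eta * 2^-1 ^+ size s0.
have de0 : 0 < de by rewrite mulr_gt0 // exprn_gt0 // invr_gt0.
have ub : ubound [set sign_average G s (fun=> 0) | s in [set s | uniq s /\ [set` s] `<=` A]] C.
  by move=> _ [s [us sA] <-]; exact: (sign_average_bound0 hC).
suff : sup [set sign_average G s (fun=> 0) | s in [set s | uniq s /\ [set` s] `<=` A']] <=
    sup [set sign_average G s (fun=> 0) | s in [set s | uniq s /\ [set` s] `<=` A]] - de.
  by move/le_lt_trans; apply; rewrite ltrBlDr ltrDl.
apply: sup_leP; first by exists (sign_average G [::] (fun=> 0)), [::].
move=> _ [s [us sA] <-]; rewrite lerBrDr.
(* By convexity, enlarging [s] to contain the pattern's coordinates does not lower the average. *)
pose s' := [seq k <- s0 | k \notin s] ++ s.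
have us' : uniq s'.
  rewrite cat_uniq us filter_uniq ?undup_uniq // andbT /=.
  by apply/hasPn => k ks; rewrite mem_filter ks.
have s'A : [set` s'] `<=` A'.
  by move=> k; rewrite /= mem_cat mem_filter => /orP[/andP[_ /s0A]|/sA].
have s0s' : {subset s0 <= s'}.
  by move=> k k0; rewrite mem_cat mem_filter k0 andbT orNb.
have is' : i \notin s' by apply/negP => /s'A[_]; apply.
have isA : [set` i :: s'] `<=` A by move=> k; rewrite /= inE => /predU1P[->|/s'A[]].
apply: (@le_trans _ _ (sign_average G (i :: s') (fun=> 0))); last first.
  by apply: (le_supP _ ub); exists (i :: s') => //; split=> //; rewrite /= is'.
apply: (@le_trans _ _ (sign_average G s' (fun=> 0) + de)).
  rewrite lerD2r; apply: (sign_average_cat convexG us').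
  by move=> k /s'A[].
rewrite addrC -lerBrDr sign_average_gap.
apply: (@sign_average_lower A' (fun b => spread G i b - G b) eta s0 sg (ltW eta0)) => //.
- move=> t a tA va; rewrite subr_ge0 ltW //; apply: spread_gt.
  exact: sign_vector_dominated va.
- by move=> k; rewrite s01 => ks; have := sgv k; rewrite /= ks.
- move=> t a tA va s0t asg; have [h1 h2] := gap (t, a) (conj tA va)
    (conj (fun k ks => s0t k (etrans (s01 k) ks)) (fun k ks => asg k (etrans (s01 k) ks))).
  by move: h1 h2 => /=; lra.
Qed.

End Gap.

(** The suprema of sign averages over [A \ i] and over [A] now play the part of [rho]; being suprema
    over finite subsets, they yield the finite member of the family directly. *)
Lemma critical_of_strictly_convex (S : set (set I)) (G : (I -> R) -> R) :
    (forall A, S A -> [/\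
       forall a b c, dominated A a -> dominated A b ->
         (forall k, a k + b k = 2 * c k) -> G c <= 2^-1 * (G a + G b),
       forall a b c, dominated A a -> dominated A b ->
         (forall k, a k + b k = 2 * c k) -> a <> b -> G c < 2^-1 * (G a + G b),
       forall a (x : R), dominated A a -> x < G a ->
         exists s, forall b, dominated A b -> {in s, b =1 a} -> x < G b
     & exists C, forall b, dominated A b -> G b <= C]) ->
  exists F, critical_families S F.
Proof.
move=> hG.
exists (fun n => [set D : {fset I} | exists q : rat, choice.pickle q = n /\
  exists s, [/\ uniq s, s =i D & ratr q < sign_average G s (fun=> 0)]]).
move=> A i SA Ai; have [cG sG lG [C hC]] := hG A SA.
have := sign_average_sup_lt Ai cG sG lG hC.
move=> /rat_in_itvoo[q]; rewrite in_itv /= => /andP[q1 q2].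
have ub (B : set I) : B `<=` A ->
    ubound [set sign_average G s (fun=> 0) | s in [set s | uniq s /\ [set` s] `<=` B]] C.
  by move=> BA _ [s [us sB] <-]; apply: (sign_average_bound0 hC) => // k /sB/BA.
exists (choice.pickle q); split.
  have [|_ [s [us sA] <-] qs] := sup_gtP _ (ub A (fun=> id)) q2.
    by exists (sign_average G [::] (fun=> 0)), [::].
  exists [fset k in s]%fset; last by move=> k /=; rewrite inE => /sA.
  by exists q; split=> //; exists s; split=> // k; rewrite inE.
move=> D [q' [/(pcan_inj choice.pickleK) -> [s [us sD qs]]]] DA.
apply: contrapT => iD; move: (lt_trans q1 qs); apply/negP; rewrite -leNgt.
apply: (le_supP _ (ub _ (@subDsetl _ A [set i]))); exists s => //; split=> // k /= ks.
split; first by apply: DA; rewrite /= -sD.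
by move=> E; apply: iD; rewrite -E -sD.
Qed.

End SignAverages.

(** * A network on the dual ball *)

Section IsolatedFamilies.
Context {T : topologicalType}.
Implicit Types (F G : set (set T)) (M E : set T).

Lemma isolated_nbhs F : isolated_family F <->
  forall E x, F E -> E x ->
    exists2 V, nbhs x V & forall M, F M -> M `&` V !=set0 -> M = E.
Proof.
split=> [iF E x FE Ex|h E FE].
  have : ~ closure (\bigcup_(M in F `\ E) M) x.
    by move=> cx; have : (E `&` closure (\bigcup_(M in F `\ E) M)) x by []; rewrite iF.
  rewrite /closure /= => /existsNP[V /not_implyP[nV nVM]]; exists V => // M FM [y [My Vy]].
  by apply: contrapT => ME; apply: nVM; exists y; split=> //; exists M.
rewrite -subset0 => x [Ex]; have [V nV hV] := h E x FE Ex.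
move=> /(_ V nV)[y [[M [FM ME] My] Vy]]; apply: ME; apply: hV => //.
by exists y.
Qed.

Lemma isolated_set0 : isolated_family (set0 : set (set T)).
Proof. by []. Qed.

Lemma isolated_set1 M : isolated_family [set M].
Proof.
by apply/isolated_nbhs => E x -> _; exists setT => [|M' -> //]; exact: filterT.
Qed.

Definition pairwise_meets F G := [set M | exists2 E, F E & exists2 E', G E' & M = E `&` E'].

Lemma isolated_meets F G : isolated_family F -> isolated_family G ->
  isolated_family (pairwise_meets F G).
Proof.
move=> /isolated_nbhs hF /isolated_nbhs hG; apply/isolated_nbhs.
move=> _ x [E FE [E' GE' ->]] [Ex E'x].
have [V nV hV] := hF E x FE Ex; have [V' nV' hV'] := hG E' x GE' E'x.
exists (V `&` V') => [|_ [M FM [M' GM' ->]] [y [[My M'y] [Vy V'y]]]]; first exact: filterI.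
have -> : M = E by apply: hV => //; exists y.
by have -> : M' = E' by apply: hV' => //; exists y.
Qed.

(** For a fixed list of families, the intersections of one member from each form an isolated family,
    and there are only countably many lists. *)
Lemma countable_meets_network (J : countType) (N : J -> set (set T)) :
    (forall j, isolated_family (N j)) ->
    (forall x V, nbhs x V -> exists Q : seq (set T),
       (forall P, P \in Q -> exists j, exists2 M, N j M & M x /\ M `<=` P) /\
       forall y, (forall P, P \in Q -> P y) -> V y) ->
  exists N' : set (set T), network N' /\ sigma_isolated (T := T) N'.
Proof.
move=> iN hN.
pose L := foldr (fun j F => pairwise_meets (N j) F) [set setT].
have iL s : isolated_family (L s).
  by elim: s => [|j s IH]; [exact: isolated_set1|exact: isolated_meets].
pose L' n := if choice.unpickle n is Some s then L s else set0.
exists (\bigcup_n L' n); split; last first.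
  by exists L'; split=> // n; rewrite /L'; case: choice.unpickle => [s|]; [exact: iL|exact: isolated_set0].
move=> x V oV Vx; have [Q [hQ QV]] := hN x V (open_nbhs_nbhs (conj oV Vx)).
suff [s [M LM [Mx MQ]]] : exists s, exists2 M, L s M & M x /\ forall P, P \in Q -> M `<=` P.
  exists M; first by exists (choice.pickle s) => //; rewrite /L' choice.pickleK.
  by split=> // y My; apply: QV => P /MQ; apply.
elim: Q hQ {QV} => [_|P Q IH hQ]; first by exists [::], setT.
have [|s [M LM [Mx MQ]]] := IH; first by move=> P' P'Q; apply: hQ; rewrite inE P'Q orbT.
have [|j [M' NM' [M'x M'P]]] := hQ P; first by rewrite mem_head.
exists (j :: s), (M' `&` M); first by exists M' => //; exists M.
split=> // P'; rewrite inE => /predU1P[->|/MQ h] y [M'y My]; [exact: M'P|exact: h].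
Qed.

End IsolatedFamilies.

(** * A sigma-isolated network from critical families *)

Section CriticalDescriptive.
Context {R : realType} {X : normedModType R} {I : choiceType} (e : I -> X).
Hypotheses (he_basis : unconditional_basis e) (he_norm : normalised e)
  (he_unc : one_unconditional e).
Local Notation S := (functional_sets e).
Local Notation B := (set_type (@dual_ball R X)).
Variable F : nat -> set {fset I}.
Hypothesis hF : critical_families S F.
Implicit Types (f g : B) (A : set I) (n m p : nat) (D : {fset I}).

Let lev m f : set I := level_set e (set_val f) m.+1%:R^-1.
Let has_member n A := exists2 D, F n D & [set` D] `<=` A.
Let crit n A : set I := [set i | A i /\ forall D, F n D -> [set` D] `<=` A -> i \in D].
(** The code gives the values on [D] to precision [1 / p], and its length the size of [D], without
    naming the elements of [D]: so there are countably many codes. *)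
Let code p f D := [seq Num.floor (p%:R * set_val f (e i)) | i <- (D : seq I)].
Let cell n m p c D := [set f |
  [/\ has_member n (lev m f), crit n (lev m f) = [set` D] & code p f D = c]].
Let no_cell n m := [set f | ~ has_member n (lev m f)].

Let cells (j : (nat * nat * nat * seq int) + (nat * nat)) : set (set B) :=
  match j with
  | inl (n, m, p, c) => range (cell n m p c)
  | inr (n, m) => [set no_cell n m]
  end.

Let eval_nbhs (r : R) f (i : I) : r < `|set_val f (e i)| ->
  nbhs f [set g : B | r < `|set_val g (e i)|].
Proof.
move=> h; have := @ball_eval_continuous R X (e i) f; move/cvg_norm => hc.
exact: (cvgr_gt _ hc _ h).
Qed.

Let eval_nbhs_fset (r : R) f D : (forall i, i \in D -> r < `|set_val f (e i)|) ->
  nbhs f [set g : B | forall i, i \in D -> r < `|set_val g (e i)|].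
Proof.
move=> h; exact: (@filter_bigI _ I D (fun i => [set g : B | r < `|set_val g (e i)|]) (nbhs f) _
  (fun i iD => eval_nbhs (h i iD))).
Qed.

(** Near [f] the witness [D'] stays inside the level set, and so does, for each [i] in [D'] but not
    in [D], a member of [F n] that misses [i]. Hence the critical set of a nearby [g] is included in
    [D], and equal code lengths force equality. *)
Let isolated_cells j : isolated_family (cells j).
Proof.
case: j => [[[[n m] p] c]|[n m]]; last exact: isolated_set1.
apply/isolated_nbhs => _ f [D _ <-] [[D' FD' D'f] critf codef].
pose V := [set g : B | [set` D'] `<=` lev m g /\ forall i, i \in D' ->
  i \in D \/ exists D1, [/\ F n D1, [set` D1] `<=` lev m g & i \notin D1]].
exists V => [|_ [E _ <-] [g [[_ critg codeg] [D'g Vg]]]].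
  apply: filterI; first exact: eval_nbhs_fset.
  apply: (@filter_bigI _ I D' (fun i => [set g : B | i \in D \/
      exists D1, [/\ F n D1, [set` D1] `<=` lev m g & i \notin D1]]) (nbhs f) _) => i iD'.
  have [iD|iD] := boolP (i \in D); first by apply: (@filterS _ (nbhs f) _ setT) => [g _|]; [left|exact: filterT].
  have [D1 FD1 [D1f iD1]] : exists2 D1, F n D1 & [set` D1] `<=` lev m f /\ i \notin D1.
    apply: contrapT => h; move/negP: iD; apply.
    have : crit n (lev m f) i.
      split=> [|D1 FD1 D1f]; first exact: D'f.
      by apply: contrapT => /negP iD1; apply: h; exists D1.
    by rewrite critf.
  by apply: filterS (eval_nbhs_fset D1f) => g hg; right; exists D1.
have ED : (E `<=` D)%fset.
  apply/fsubsetP => i iE; have [gi hi] : crit n (lev m g) i by rewrite critg.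
  have [//|[D1 [FD1 D1g /negP iD1]]] := Vg i (hi D' FD' D'g).
  by case: iD1; exact: hi.
have DE : (#|` D| <= #|` E|)%N.
  have : size (code p f D) = size (code p g E) by rewrite codef codeg.
  rewrite !size_map => h; change (size (D : seq I) <= size (E : seq I))%N.
  by rewrite h.
by have /eqP -> : E == D by rewrite eqEfcard ED DE.
Qed.

Let good f (P : set B) := exists Q : seq (set B),
  (forall P', P' \in Q -> exists j, exists2 M, cells j M & M f /\ M `<=` P') /\
  forall g, (forall P', P' \in Q -> P' g) -> P g.

Let good_cell f j M : cells j M -> M f -> good f M.
Proof.
move=> NM Mf; exists [:: M]; split=> [P|g]; last by apply; rewrite mem_head.
by rewrite mem_seq1 => /eqP ->; exists j, M => //; split.
Qed.

Let goodS f (P P' : set B) : P `<=` P' -> good f P -> good f P'.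
Proof. by move=> PP' [Q [hQ QP]]; exists Q; split=> // g /QP/PP'. Qed.

Let goodI f (P P' : set B) : good f P -> good f P' -> good f (P `&` P').
Proof.
move=> [Q [hQ QP]] [Q' [hQ' QP']]; exists (Q ++ Q'); split=> [P1|g h].
  by rewrite mem_cat => /orP[/hQ|/hQ'].
by split; [apply: QP|apply: QP'] => P1 h1; apply: h; rewrite mem_cat h1 ?orbT.
Qed.

Let good_seq f (s : seq I) (P : I -> set B) : (forall i, i \in s -> good f (P i)) ->
  good f [set g | forall i, i \in s -> P i g].
Proof.
elim: s => [_|i s IH h]; first by exists [::].
have gs : good f [set g | forall i, i \in s -> P i g].
  by apply: IH => k ks; apply: h; rewrite inE ks orbT.
have gi : good f (P i) by apply: h; rewrite mem_head.
by apply: goodS (goodI gi gs) => g [gi' gs'] k; rewrite inE => /predU1P[->|/gs'].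
Qed.

Let small (d : R) : 0 < d -> exists m : nat, m.+1%:R^-1 < d.
Proof.
move=> d0; have [m] := @ltr_add_invr R 0 d d0.
by rewrite add0r => h; exists m.
Qed.

(** For [m] large [i] is in the level set, and its critical index [n] puts [i] into the critical
    set; equal codes then determine the value at [e i] up to less than [d]. *)
Let good_nonzero f i (d : R) : 0 < d -> set_val f (e i) != 0 ->
  good f [set g : B | `|set_val g (e i) - set_val f (e i)| < d].
Proof.
move=> d0 fi; have [m mf] : exists m : nat, m.+1%:R^-1 < `|set_val f (e i)|.
  by apply: small; rewrite normr_gt0.
have SA : S (lev m f) by apply: level_set_functional => //; rewrite invr_gt0.
have [n [[D FD DA] cr]] := hF SA (mf : lev m f i).
have [p pd] := small d0.
have [E critE] : exists E : {fset I}, crit n (lev m f) = [set` E].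
  exists [fset k in D | `[< crit n (lev m f) k >]]%fset; apply/seteqP; split=> k.
    by move=> h; rewrite /= !inE /= (h.2 D FD DA); exact/asboolP.
  by rewrite /= !inE /= => /andP[_ /asboolP].
have iE : i \in E by have : crit n (lev m f) i by []; rewrite critE.
have Mf : cell n m p.+1 (code p.+1 f E) E f by split=> //; exists D.
have := @good_cell f (inl (n, m, p.+1, code p.+1 f E)) _ (imageT _ E) Mf.
apply: goodS => g [_ _ /eq_in_map/(_ i iE) /= E1].
have h1 := floor_itv (p.+1%:R * set_val f (e i)); have h2 := floor_itv (p.+1%:R * set_val g (e i)).
apply: lt_trans pd; rewrite -(ltr_pM2l (_ : 0 < p.+1%:R :> R)) // divff //.
rewrite -[X in X * _]ger0_norm // -normrM mulrBr ltr_norml.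
by move: h1 h2; rewrite E1 intrD => /andP[? ?] /andP[? ?]; lra.
Qed.

(** If [f] vanishes at [e i], the critical index is taken for the level set with [i] added. All
    members inside this larger set contain [i], so [f] lies in [no_cell]. A [g] in [no_cell] that is
    still above the level on [D \ i] cannot be above it at [i], or [D] would fit. *)
Let good_coordinate f i (d : R) : 0 < d ->
  good f [set g : B | `|set_val g (e i) - set_val f (e i)| < d].
Proof.
move=> d0; have [fi|] := eqVneq (set_val f (e i)) 0; last exact: good_nonzero.
have [m md] := small d0.
have SA : S (i |` lev m f).
  by apply: functional_setsU1 => //; apply: level_set_functional => //; rewrite invr_gt0.
have [|n [[D FD DA] cr]] := hF SA (_ : _ i); first by left.
have nc : no_cell n m f.
  move=> [D' FD' D'A]; have : i \in D' by apply: cr => // k /D'A; right.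
  by move=> /D'A; rewrite /lev /level_set /= fi normr0 ltNge invr_ge0 ler0n.
have Df k : k \in (D `\ i)%fset -> m.+1%:R^-1 < `|set_val f (e k)|.
  by rewrite in_fsetD1 => /andP[ki /DA[/= E|//]]; rewrite E eqxx in ki.
have gD := @good_seq f (D `\ i)%fset (fun k => [set g : B | m.+1%:R^-1 < `|set_val g (e k)|]).
have : good f [set g : B | forall k, k \in (D `\ i)%fset -> m.+1%:R^-1 < `|set_val g (e k)|].
  apply: gD => k /Df fk.
  apply: (@goodS _ [set g : B | `|set_val g (e k) - set_val f (e k)| < `|set_val f (e k)| - m.+1%:R^-1]).
    have aux (x y r : R) : `|x - y| < `|y| - r -> r < `|x|.
      by have := ler_normB x (x - y); rewrite subKr; lra.
    by move=> g /= /aux.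
  apply: good_nonzero; rewrite ?subr_gt0 // -normr_gt0.
  by apply: lt_trans fk; rewrite invr_gt0.
move/(goodI (@good_cell f (inr (n, m)) _ erefl nc)); apply: goodS => g [ncg hg] /=.
rewrite fi subr0; apply: le_lt_trans md; rewrite leNgt; apply/negP => gi; apply: ncg.
exists D => // k kD; have [->//|ki] := eqVneq k i.
by apply: hg; rewrite in_fsetD1 ki.
Qed.

Lemma descriptive_of_critical : descriptive B.
Proof.
split; [exact: regular_ball|exact: compact_ball|].
apply: (@countable_meets_network _ _ cells isolated_cells) => f V nV.
have [s [d d0 h]] := ball_coordinate_nbhs he_basis nV.
have [Q [hQ QV]] := @good_seq f s _ (fun i _ => @good_coordinate f i d d0).
by exists Q; split=> // g /QV; exact: h.
Qed.

End CriticalDescriptive.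

(** * Critical families from a strictly convex dual norm *)

Section StrictlyConvexNorms.
Context {R : realType} {X : normedModType R} {I : choiceType} (e : I -> X).
Hypotheses (he_basis : unconditional_basis e) (he_unc : one_unconditional e).
Variable N : X -> R.
Hypotheses (hN : equivalent_norm N) (scN : strictly_convex (dual_norm N)).
Implicit Types (a b c : I -> R) (f g : dual X).

(** The functional with coordinates [a], or 0 when there is none. *)
Let vec a : dual X := xget 0 [set f : dual X | forall i, f (e i) = a i].

Let vec_dominated A : functional_sets e A -> exists2 C : R, 0 <= C &
  forall a, dominated A a ->
    (forall i, vec a (e i) = a i) /\ (forall x, `|vec a x| <= C * `|x|).
Proof.
move=> [f [f1 f0]]; have [C C0 hf] := dual_bounded f; exists C; first exact: ltW.
move=> a [a1 a0]; have [|g gE gC] := dual_solid he_basis he_unc (a := a) hf.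
  move=> i; have [Ai|nAi] := pselect (A i); first by rewrite f1 // normr1.
  by rewrite a0 // normr0.
have vE : forall i, vec a (e i) = a i.
  by rewrite /vec; case: xgetP => [h _ //|/(_ g)/(_ gE)].
by split=> // x; have -> : vec a = g by apply: (dual_eq_basis he_basis) => i; rewrite vE gE.
Qed.

Let n f := dual_norm N f.
Let n0 f : 0 <= n f. Proof. exact: dual_norm_ge0. Qed.
(** The square is strictly convex also along rays, where the norm itself is affine. *)
Let G a := n (vec a) ^+ 2.

Let midpoint A a b c : functional_sets e A -> dominated A a -> dominated A b ->
  (forall k, a k + b k = 2 * c k) -> vec a + vec b = 2 *: vec c.
Proof.
move=> SA da db h; have [C _ hv] := vec_dominated SA.
have dc : dominated A c.
  split=> k; have := h k.
    have := da.1 k; have := db.1 k; rewrite !ler_norml; lra.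
  by move=> hk kA; move: hk; rewrite da.2 // db.2 //; lra.
apply: (dual_eq_basis he_basis) => k.
by rewrite dual_addE dual_scaleE !(hv _ _).1.
Qed.

Let midpoint_norm f g h : f + g = 2 *: h -> 2 * n h <= n f + n g.
Proof.
move=> E; have := dual_normD hN f g; rewrite E dual_normZ //.
by rewrite ger0_norm.
Qed.

Let square_mean (x y z : R) : 0 <= z -> 2 * z <= x + y -> z ^+ 2 <= 2^-1 * (x ^+ 2 + y ^+ 2).
Proof.
move=> z0 h; have h1 : (2 * z) ^+ 2 <= (x + y) ^+ 2 by rewrite lerXn2r // nnegrE; lra.
have h2 := sqr_ge0 (x - y); move: h1 h2; rewrite !expr2; lra.
Qed.

Let square_mean_strict (x y z : R) : 0 <= z -> 2 * z <= x + y -> (x = y -> z != x) ->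
  z ^+ 2 < 2^-1 * (x ^+ 2 + y ^+ 2).
Proof.
move=> z0 h ne; have h1 : (2 * z) ^+ 2 <= (x + y) ^+ 2 by rewrite lerXn2r // nnegrE; lra.
have [E|xy] := eqVneq x y.
  have zx : z < x by rewrite lt_neqAle ne //= ; lra.
  have : z ^+ 2 < x ^+ 2 by rewrite ltrXn2r // nnegrE; lra.
  by rewrite -E; lra.
have h2 : 0 < (x - y) ^+ 2 by rewrite exprn_even_gt0 //= subr_eq0.
move: h1 h2; rewrite !expr2; lra.
Qed.

Lemma critical_of_strictly_convex_norm : exists F, critical_families (functional_sets e) F.
Proof.
apply: (critical_of_strictly_convex (G := G)) => A SA; have [C C0 hv] := vec_dominated SA.
split.
- move=> a b c da db h; apply: square_mean => //.
  exact/midpoint_norm/(midpoint SA).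
- move=> a b c da db h ab; have E := midpoint SA da db h.
  apply: square_mean_strict => //; first exact: midpoint_norm.
  move=> nab; apply/eqP => nca; apply: ab.
  have : vec a = vec b.
    apply: scN => //; rewrite E dual_normZ // ger0_norm // mulKf ?pnatr_eq0 //.
    by rewrite -[LHS]nab -nca.
  by move=> v; apply/funext => k; rewrite -(hv a da).1 -(hv b db).1 v.
- move=> a x da xa; have [x0|x0] := ltP x 0.
    by exists [::] => b _ _; apply: lt_le_trans x0 _; exact: sqr_ge0.
  have sx : Num.sqrt x < n (vec a).
    by rewrite -(ger0_norm (n0 (vec a))) -sqrtr_sqr ltr_sqrt // (le_lt_trans x0).
  have [y [Ny xy]] := dual_norm_lsc hN sx.
  have eta0 : 0 < vec a y - Num.sqrt x by rewrite subr_gt0.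
  have [s [d d0 hs]] := coordinate_control he_basis y C0 eta0.
  exists s => b db ba.
  have := hs _ _ (hv a da).2 (hv b db).2.
  have h i : i \in s -> `|vec b (e i) - vec a (e i)| < d.
    by move=> /ba E; rewrite (hv a da).1 (hv b db).1 E subrr normr0.
  move=> /(_ h); rewrite ltr_norml => /andP[h1 _].
  have h2 : Num.sqrt x < n (vec b).
    apply: (@lt_le_trans _ _ (vec b y)); first by move: h1; lra.
    apply: le_trans (ler_norm _) _; apply: le_trans (dual_norm_ge hN _ _) _.
    by rewrite ler_piMr.
  rewrite -(sqr_sqrtr x0) ltrXn2r // nnegrE ?sqrtr_ge0 //.
- have [_ [k [K [k0 K0 hk]]]] := hN.
  exists ((C / k) ^+ 2) => b db; have Ck : 0 <= C / k by rewrite divr_ge0 // ltW.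
  rewrite lerXn2r ?nnegrE //; apply: dual_norm_le => // x.
  apply: le_trans ((hv b db).2 x) _; rewrite -mulrA ler_wpM2l // ler_pdivlMl //.
  by have /andP[] := hk x.
Qed.

End StrictlyConvexNorms.

Theorem theorem2p9 (R : realType) (X : completeNormedModType R)
    (Gamma : choiceType) (e : Gamma -> X)
    (he_basis : unconditional_basis e) (he_norm : normalised e)
    (he_unc : one_unconditional e) :
  [<-> gruenhage_compact (set_type (@dual_ball R X));
       exists2 N : X -> R, equivalent_norm N & strictly_convex (dual_norm N);
       exists rho : set_type (indicator_space e) -> R,
         [/\ forall x, 0 <= rho x <= 1,
             strictly_increasing rho
           & lower_semicontinuous (fun x => (rho x)%:E)];
       descriptive (set_type (@dual_ball R X));
       exists2 N : X -> R, equivalent_norm N & wstar_LUR (dual_norm N)].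
Proof.
tfae.
- exact: gruenhage_strictly_convex.
- move=> [N hN scN]; have [F hF] := critical_of_strictly_convex_norm he_basis he_unc hN scN.
  exact: (increasing_of_critical hF).
- move=> [rho [_ incr lsc]].
  have [F hF] := critical_of_increasing he_basis he_unc incr lsc.
  exact: (descriptive_of_critical he_basis he_norm he_unc hF).
- exact: descriptive_wstar_LUR.
(* The cycle closes through strict convexity: its critical families make the ball descriptive, and a
   compact Hausdorff descriptive space is Gruenhage. *)
- move=> [N hN lur]; have scN := wstar_LUR_strictly_convex hN lur.
  have [F hF] := critical_of_strictly_convex_norm he_basis he_unc hN scN.
  apply: descriptive_gruenhage; first exact: hausdorff_ball.
  exact: (descriptive_of_critical he_basis he_norm he_unc hF).
Qed.
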